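(* Let $\mathcal{P}$ be a finite index irreducible subfactor planar algebra. If all the biprojections of $\mathcal{P}_{2,+}$ are normal and form a distributive lattice, then there is a minimal projection $u \in \mathcal{P}_{2,+}$ generating the identity biprojection, i.e. $\langle u \rangle = id$.
   Context: A subfactor planar algebra $\mathcal{P}=(\mathcal{P}_{n,\pm})_{n\in\mathbb{N}}$ is a (shaded) planar $\star$-algebra with finite-dimensional box spaces, $\mathcal{P}_{0,\pm}=\mathbb{C}$, spherical (left and right normalized traces coincide, denoted $tr$, with $tr(id)=1$), and such that $\langle a\vert b\rangle = tr(b^{\star}a)$ is an inner product on each box space. Every closed string counts for the same constant $\delta>0$; the index is $\delta^2$. $\mathcal{P}$ is irreducible if $\mathcal{P}_{1,\pm}=\mathbb{C}$. The $2$-box space $\mathcal{P}_{2,+}$ is a finite-dimensional ${\rm C}^{\star}$-algebra with unit $id$; $e_1\in\mathcal{P}_{2,+}$ is the Jones projection ($\delta^{-1}$ times the cup-cap diagram). $\mathcal{F}:\mathcal{P}_{2,\pm}\to\mathcal{P}_{2,\mp}$ is the one-click ($90^{\circ}$) rotation. A biprojection is a (nonzero) projection $b\in\mathcal{P}_{2,+}$ such that $\mathcal{F}(b)$ is a positive multiple of a projection. The biprojections, ordered by $\le$, form a finite lattice with smallest element $e_1$ and greatest element $id$. A biprojection $b$ is normal if $b$ is central in $\mathcal{P}_{2,+}$ and $\mathcal{F}(b)$ is central in $\mathcal{P}_{2,-}$. For a positive $a\in\mathcal{P}_{2,+}$ with range projection $R(a)$, $\langle a\rangle$ denotes the smallest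 biprojection $b$ with $R(a)\le b$ (the biprojection generated by $a$). *)

(* Defs.v *)
From HB Require Import structures.
From mathcomp Require Import all_boot all_order all_algebra.
From mathcomp Require Import reals complex zify.

Set Implicit Arguments.
Unset Strict Implicit.
Unset Printing Implicit Defensive.

Import Order.TTheory GRing.Theory Num.Theory.

(** * Shaded planar tangles

  A tangle has one outer disc and a finite family of inner discs; the discs
  carry boundary points joined pairwise by disjoint strings, there may be
  closed strings, and the complement of discs and strings is a checkerboard
  shaded family of regions.  Isotopy classes of tangles are encoded by the
  incidence data between boundary points, boundary segments, strings and
  regions.

  The colour (n, s) of a disc means: 2n boundary points, and the marked segment
  lies in a shaded region iff s = true.  Thus (n, false) is the colour "n, +"
  and (n, true) is the colour "n, -".  Points and segments are numbered
  clockwise (for the outer disc too, seen from the inside): segment 0 is the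
  marked one and point j lies between the segments j and j + 1 (mod 2n).  A disc
  with no boundary point has one segment, its whole boundary. *)

Definition color : Type := (nat * bool)%type.

Notation npts c := (c.1.*2).
Notation nsegs c := ((c.1.*2).-1.+1).

Definition seg_before (c : color) (j : 'I_(npts c)) : 'I_(nsegs c) := inord j.
Definition seg_after (c : color) (j : 'I_(npts c)) : 'I_(nsegs c) :=
  inord (j.+1 %% npts c).
Definition seg_shade (c : color) (j : nat) : bool := c.2 (+) odd j.

(** [side l b] is the region of shading [b] bordering the string [l]: every
  string separates a shaded region from an unshaded one.  Closed strings are
  the elements of [str] that carry no boundary point. *)
Record pretangle (I : finType) (c : I -> color) (c0 : color) := Pretangle {
  str : finType;
  reg : finType;
  ipt : forall i : I, 'I_(npts (c i)) -> str;
  opt : 'I_(npts c0) -> str;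
  iseg : forall i : I, 'I_(nsegs (c i)) -> reg;
  oseg : 'I_(nsegs c0) -> reg;
  side : str -> bool -> reg;
  shade : reg -> bool
}.

Definition symrel (T : Type) (e : rel T) : rel T :=
  fun x y => e x y || e y x.

Section Planarity.
Variables (I : finType) (c : I -> color) (c0 : color) (T : pretangle c c0).

Definition point : finType :=
  ({i : I & 'I_(npts (c i))} + 'I_(npts c0))%type.
Definition segment : finType :=
  ({i : I & 'I_(nsegs (c i))} + 'I_(nsegs c0))%type.

Definition pt (p : point) : str T :=
  match p with inl q => ipt T (tagged q) | inr j => opt T j end.
Definition seg (x : segment) : reg T :=
  match x with inl q => iseg T (tagged q) | inr j => oseg T j end.
Definition before (p : point) : segment :=
  match p with
  | inl q => inl (Tagged (fun i => 'I_(nsegs (c i))) (seg_before (tagged q)))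
  | inr j => inr (seg_before j)
  end.
Definition after (p : point) : segment :=
  match p with
  | inl q => inl (Tagged (fun i => 'I_(nsegs (c i))) (seg_after (tagged q)))
  | inr j => inr (seg_after j)
  end.
Definition shade_seg (x : segment) : bool :=
  match x with
  | inl q => seg_shade (c (tag q)) (tagged q)
  | inr j => seg_shade c0 j
  end.
Definition shade_before (p : point) : bool :=
  match p with
  | inl q => seg_shade (c (tag q)) (tagged q)
  | inr j => seg_shade c0 j
  end.

(** Orient every string with the shaded region on its left; [sign p] tells
  whether that orientation leaves a boundary disc at p or arrives there. *)
Definition sign (p : point) : bool :=
  match p with inl _ => shade_before p | inr _ => ~~ shade_before p end.

(** The boundary circles of the regions are the connected components of the
  following graph, whose vertices are the boundary segments and the sides of
  the strings, two of them being adjacent when they meet at a boundary point. *)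
Definition boundary_edge : rel (segment + str T * bool) :=
  fun x y => [exists p : point,
    ((x == inl (before p)) && (y == inr (pt p, shade_before p)))
    || ((x == inl (after p)) && (y == inr (pt p, ~~ shade_before p)))].
Definition boundary_circles : nat :=
  n_comp (symrel boundary_edge) predT.

Definition reg_edge : rel (reg T) :=
  fun r r' => [exists l : str T, (r == side l false) && (r' == side l true)].

(** Cap off the discs (Euler characteristic 1 each), attach the open strings as
  bands (-1 each, and there are as many as half the number of boundary points),
  and glue in every region as a sphere with one hole for each boundary circle.
  The outcome is a closed oriented surface.  [pl_connected] says that it is
  connected and [pl_euler] that its Euler characteristic is 2, i.e. that it is
  a sphere; since the two sides of closed strings are counted among the
  boundary circles, these strings contribute nothing more. *)
Record planar : Prop := Planar {
  pl_seg : forall x, shade (seg x) = shade_seg x;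
  pl_side : forall l b, shade (side l b : reg T) = b;
  pl_before : forall p, seg (before p) = side (pt p) (shade_before p);
  pl_after : forall p, seg (after p) = side (pt p) (~~ shade_before p);
  pl_inj : forall p q, pt p = pt q -> sign p = sign q -> p = q;
  pl_mate : forall p, exists q, pt q = pt p /\ sign q = ~~ sign p;
  pl_connected : forall r r', connect (symrel reg_edge) r r';
  pl_euler : (#|I|.+1 + 2 * #|reg T|
              = 2 + (\sum_(i : I) (c i).1 + c0.1) + boundary_circles)%N
}.

End Planarity.

Arguments pt {I c c0} T p.
Arguments seg {I c c0} T x.
Arguments sign {I c c0} p.
Arguments boundary_edge {I c c0} T.
Arguments reg_edge {I c c0} T.

Record tangle (I : finType) (c : I -> color) (c0 : color) := Tangle {
  tangle_data :> pretangle c c0;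
  tangle_planar : planar tangle_data
}.

(** ** Relabelling of the inner discs (in particular, isotopy), reflection *)

Definition relabelling (I I' : finType) (c : I -> color) (c0 : color)
    (f : I' -> I) (T : tangle c c0) (T' : tangle (c \o f) c0) : Prop :=
  exists (fs : str T' -> str T) (fr : reg T' -> reg T),
    [/\ bijective fs, bijective fr,
        (forall i j, ipt T (i := f i) j = fs (@ipt _ _ _ T' i j)) /\
        (forall j, opt T j = fs (opt T' j)),
        (forall i j, iseg T (i := f i) j = fr (@iseg _ _ _ T' i j)) /\
        (forall j, oseg T j = fr (oseg T' j))
      & forall l b, side (fs l) b = fr (side l b)].

Definition rev_pt (c : color) (j : 'I_(npts c)) : 'I_(npts c) := rev_ord j.
Definition rev_seg (c : color) (j : 'I_(nsegs c)) : 'I_(nsegs c) :=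
  inord ((npts c - j) %% npts c).

Definition reflection (I : finType) (c : I -> color) (c0 : color)
    (T T' : tangle c c0) : Prop :=
  exists (fs : str T -> str T') (fr : reg T -> reg T'),
    [/\ bijective fs, bijective fr,
        (forall i j, ipt T' (i := i) j = fs (ipt T (rev_pt j))) /\
        (forall j, opt T' j = fs (opt T (rev_pt j))),
        (forall i j, iseg T' (i := i) j = fr (iseg T (rev_seg j))) /\
        (forall j, oseg T' j = fr (oseg T (rev_seg j)))
      & forall l b, side (fs l) b = fr (side l b)].

(** ** Composition *)

Section Gluing.
Variables (I : finType) (J : I -> finType).
Variables (c : I -> color) (c0 : color) (c' : forall i, J i -> color).

Definition glued_color (p : {i : I & J i}) : color := c' (tagged p).

Variables (T : tangle c c0) (S : forall i, tangle (@c' i) (c i)).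

Definition pre_str : finType := (str T + {i : I & str (S i)})%type.
Definition pre_reg : finType := (reg T + {i : I & reg (S i)})%type.

Definition glue_str_edge : rel pre_str := fun x y =>
  [exists i : I, exists j : 'I_(npts (c i)),
    (x == inl (ipt T j))
    && (y == inr (Tagged (fun i => str (S i)) (opt (S i) j)))].
Definition glue_reg_edge : rel pre_reg := fun x y =>
  [exists i : I, exists j : 'I_(nsegs (c i)),
    (x == inl (iseg T j))
    && (y == inr (Tagged (fun i => reg (S i)) (oseg (S i) j)))].

Definition in_str (i : I) (l : str (S i)) : pre_str :=
  inr (Tagged (fun i => str (S i)) l).
Definition in_reg (i : I) (r : reg (S i)) : pre_reg :=
  inr (Tagged (fun i => reg (S i)) r).

(** U is obtained by inserting S_i in the i-th inner disc of T for every i: its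
  strings (resp. regions) are those of T and of the S_i, identified along the
  boundary points (resp. segments) of the discs that have been filled. *)
Definition gluing (U : tangle glued_color c0) : Prop :=
  exists (fs : pre_str -> str U) (fr : pre_reg -> reg U),
    [/\ (forall l, exists x, fs x = l) /\ (forall r, exists x, fr x = r),
        (forall x y, (fs x == fs y) = connect (symrel glue_str_edge) x y) /\
        (forall x y, (fr x == fr y) = connect (symrel glue_reg_edge) x y),
        (forall p j, ipt U (i := p) j = fs (in_str (ipt (S (tag p)) j))) /\
        (forall j, opt U j = fs (inl (opt T j))),
        (forall p j, iseg U (i := p) j = fr (in_reg (iseg (S (tag p)) j))) /\
        (forall j, oseg U j = fr (inl (oseg T j)))
      & (forall l b, side (fs (inl l)) b = fr (inl (side l b))) /\
        (forall i (l : str (S i)) b,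
            side (fs (in_str l)) b = fr (in_reg (side l b)))].

End Gluing.

(** * Basic tangles *)

Section Components.

Lemma symrel_sym (T : Type) (e : rel T) : symmetric (symrel e).
Proof. by move=> x y; rewrite /symrel orbC. Qed.

Lemma connect_symrel_sym (T : finType) (e : rel T) : connect_sym (symrel e).
Proof. exact/sym_connect_sym/symrel_sym. Qed.

Lemma connect_symrelP (T : finType) (B : eqType) (e : rel T) (f : T -> B) :
  (forall x y, e x y -> f x = f y) ->
  forall x y, connect (symrel e) x y -> f x = f y.
Proof.
move=> He x y /connectP[p + ->]; elim: p x => //= z p IHp x /andP[/orP H /IHp <-].
by case: H => [/He|/He ->].
Qed.

Lemma n_comp_card (T B : finType) (e : rel T) (f : T -> B) :
  (forall x y, e x y -> f x = f y) ->
  (forall x y, f x = f y -> connect (symrel e) x y) ->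
  (forall b, exists x, f x = b) ->
  n_comp (symrel e) predT = #|B|.
Proof.
move=> He Hc Hs; have cs := connect_symrel_sym e.
have fP x y : connect (symrel e) x y = (f x == f y).
  by apply/idP/eqP; [exact: connect_symrelP | exact: Hc].
have -> : n_comp (symrel e) predT = #|[set x | roots (symrel e) x]|.
  by rewrite cardsE; apply: eq_card => x; rewrite !inE andbT.
rewrite -(@card_in_imset _ _ f) => [|x y].
  rewrite -cardsT; apply: eq_card => b; rewrite inE.
  have [x <-] := Hs b; apply/imsetP; exists (fingraph.root (symrel e) x).
    by rewrite inE; apply: roots_root.
  by apply/eqP; rewrite -fP connect_root.
rewrite !inE => rx ry /Hc; rewrite -(root_connect cs) => /eqP.
by rewrite (eqP rx) (eqP ry).
Qed.

End Components.

(** Column of a boundary point, resp. position of a boundary segment, of a disc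
  with 2n boundary points drawn as a rectangle with the marked segment on the
  left, the points 0, ..., n - 1 on top and n, ..., 2n - 1 at the bottom.  The
  column i lies between the positions i and i + 1. *)
Definition col_nat (n j : nat) : nat := if (j < n)%N then j else (n.*2 - j.+1)%N.
Definition pos_nat (n j : nat) : nat := if (j <= n)%N then j else (n.*2 - j)%N.

Lemma col_subproof (n : nat) (j : 'I_n.*2) : (col_nat n j < n)%N.
Proof. by rewrite /col_nat; case: (ltnP j n); have := ltn_ord j; lia. Qed.
Definition column (n : nat) (j : 'I_n.*2) : 'I_n := Ordinal (col_subproof j).

Definition pos (n j : nat) : 'I_n.+1 := inord (pos_nat n j).

(** The region of shading b next to the column i, when the leftmost one has
  shading s. *)
Definition col_side (n : nat) (s : bool) (i : 'I_n) (b : bool) : 'I_n.+1 :=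
  inord (if s (+) odd i == b then i : nat else i.+1).

Lemma col_sideE (n : nat) (s : bool) (i : 'I_n) (b : bool) :
  (col_side s i b : nat) = if s (+) odd i == b then i : nat else i.+1.
Proof. by rewrite /col_side inordK //; case: ifP => _; have /= := ltn_ord i; lia. Qed.

Lemma posE (n j : nat) : (pos n j : nat) = pos_nat n j.
Proof. by rewrite /pos inordK // /pos_nat; case: ifP; lia. Qed.

Lemma seg_beforeE (c : color) (j : 'I_(npts c)) : (seg_before j : nat) = j.
Proof. by rewrite /seg_before inordK //; have := ltn_ord j; lia. Qed.

Lemma seg_afterE (c : color) (j : 'I_(npts c)) :
  (seg_after j : nat) = if j.+1 == npts c then 0%N else j.+1.
Proof.
have jlt := ltn_ord j; rewrite /seg_after inordK; last first.
  have : (j.+1 %% npts c < npts c)%N by rewrite ltn_mod; lia.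
  lia.
by case: eqP => [->|H]; [rewrite modnn | rewrite modn_small //; lia].
Qed.

Lemma pos_shade (n : nat) (s : bool) (j : nat) : (j <= n.*2)%N ->
  s (+) odd (pos n j) = s (+) odd j.
Proof. by rewrite posE /pos_nat => ?; case: ifP => // _; congr addb; lia. Qed.

Lemma col_side_shade (n : nat) (s : bool) (i : 'I_n) (b : bool) :
  s (+) odd (col_side s i b) = b.
Proof. by rewrite col_sideE; case: eqP => //=; case: s b (odd i) => [] [] []. Qed.

Lemma pos_before (n : nat) (s : bool) (j : 'I_n.*2) :
  pos n j = col_side s (column j) (s (+) odd j).
Proof.
apply/val_inj; rewrite /= posE col_sideE /= /pos_nat /col_nat.
have := ltn_ord j; case: (ltngtP j n) => [jn|jn|jn] jlt; rewrite ?eqxx //.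
  suff -> : (s (+) odd (n.*2 - j.+1) == s (+) odd j) = false by lia.
  have -> : odd (n.*2 - j.+1) = ~~ odd j by lia.
  by case: s (odd j) => [] [].
suff -> : (s (+) odd (n.*2 - j.+1) == s (+) odd j) = false by lia.
have -> : odd (n.*2 - j.+1) = ~~ odd j by lia.
by case: s (odd j) => [] [].
Qed.

Lemma pos_after (n : nat) (s : bool) (j : 'I_n.*2) :
  pos n (if j.+1 == n.*2 then 0 else j.+1)
  = col_side s (column j) (~~ (s (+) odd j)).
Proof.
apply/val_inj; rewrite /= posE col_sideE /= /pos_nat /col_nat.
have := ltn_ord j; case: (ltnP j n) => [jn|jn] jlt.
  have -> : (s (+) odd j == ~~ (s (+) odd j)) = false by case: (_ (+) _).
  by case: eqP => ?; case: leqP; lia.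
have -> : (s (+) odd (n.*2 - j.+1) == ~~ (s (+) odd j)) = true.
  have -> : odd (n.*2 - j.+1) = ~~ odd j by lia.
  by case: s (odd j) => [] [].
by case: eqP => ?; case: leqP; lia.
Qed.

Lemma col_inj (n : nat) (j j' : 'I_n.*2) :
  column j = column j' -> odd j = odd j' -> j = j'.
Proof.
move=> /(congr1 val) /= + + ; rewrite /col_nat => H1 H2; apply/val_inj => /=.
by move: H1 H2; have := ltn_ord j; have := ltn_ord j';
  case: (ltnP j n); case: (ltnP j' n); lia.
Qed.

Lemma col_rev (n : nat) (j : 'I_n.*2) : column (rev_ord j) = column j.
Proof.
apply/val_inj; rewrite /= /col_nat; have := ltn_ord j.
by case: (ltnP j n); case: (ltnP (n.*2 - j.+1) n); lia.
Qed.

Lemma odd_rev (n : nat) (j : 'I_n.*2) : odd (rev_ord j) = ~~ odd j.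
Proof. by have := ltn_ord j; rewrite /=; lia. Qed.

(** ** Stacks

  [stack k n s] has k inner discs on top of each other, joined by n vertical
  strands: it is the tangle of the unit for k = 0, the identity tangle for k = 1
  and the multiplication tangle for k = 2.  The inner disc i lies between the
  layers i and i + 1; the leftmost and rightmost regions meet all the layers. *)

Definition stack_reg_pred (k n : nat) (x : 'I_k.+1 * 'I_n.+1) : bool :=
  (0 < x.2 < n)%N || (x.1 == ord0).
Definition stack_region (k n : nat) : finType :=
  {x : 'I_k.+1 * 'I_n.+1 | stack_reg_pred x}.

Definition stack_norm (k n : nat) (l : 'I_k.+1) (p : 'I_n.+1) :=
  (if (0 < p < n)%N then l else ord0, p).
Lemma stack_norm_subproof (k n : nat) (l : 'I_k.+1) (p : 'I_n.+1) :
  stack_reg_pred (stack_norm l p).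
Proof. by rewrite /stack_reg_pred /=; case: ifP => //; rewrite eqxx orbT. Qed.

(** The region at position p of the layer l. *)
Definition stack_reg (k n : nat) (l : 'I_k.+1) (p : 'I_n.+1) :
  stack_region k n := Sub (stack_norm l p) (stack_norm_subproof l p).

Section Stack.
Variables (k n : nat) (s : bool).

Definition stack_color : 'I_k -> color := fun _ => (n, s).

(** Layer seen by the point, resp. segment, j of a disc whose top is in the layer
  u and whose bottom is in the layer v. *)
Definition stack_layer (u v : 'I_k.+1) (j : nat) : 'I_k.+1 :=
  if (j < n)%N then u else v.
Definition above (i : 'I_k) : 'I_k.+1 := widen_ord (leqnSn k) i.
Definition below (i : 'I_k) : 'I_k.+1 := lift ord0 i.

Definition stack_data : pretangle stack_color (n, s) :=
  @Pretangle _ stack_color (n, s)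
    ('I_k.+1 * 'I_n)%type (stack_region k n)
    (fun i j => (stack_layer (above i) (below i) j, column j))
    (fun j => (stack_layer ord0 ord_max j, column j))
    (fun i j => stack_reg (stack_layer (above i) (below i) j) (pos n j))
    (fun j => stack_reg (stack_layer ord0 ord_max j) (pos n j))
    (fun l b => stack_reg l.1 (col_side s l.2 b))
    (fun r => s (+) odd (val r).2).

Let T := stack_data.

Lemma stack_reg_eq (l l' : 'I_k.+1) (p p' : 'I_n.+1) :
  p = p' -> ((0 < p < n)%N -> l = l') -> stack_reg l p = stack_reg l' p'.
Proof.
by move=> <- H; apply/val_inj; rewrite /= /stack_norm; case: ifP => // /H ->.
Qed.

Lemma stack_before (u v : 'I_k.+1) (j : 'I_n.*2) :
  stack_reg (stack_layer u v (@seg_before (n, s) j))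
            (pos n (@seg_before (n, s) j))
  = stack_reg (stack_layer u v j) (col_side s (column j) (s (+) odd j)).
Proof. by rewrite seg_beforeE; apply: stack_reg_eq => //; apply: pos_before. Qed.

Lemma stack_after (u v : 'I_k.+1) (j : 'I_n.*2) :
  stack_reg (stack_layer u v (@seg_after (n, s) j))
            (pos n (@seg_after (n, s) j))
  = stack_reg (stack_layer u v j) (col_side s (column j) (~~ (s (+) odd j))).
Proof.
rewrite seg_afterE; apply: stack_reg_eq; first exact: pos_after.
have jlt := ltn_ord j.
rewrite posE /pos_nat /stack_layer /=.
case: (j.+1 =P n.*2) => /= H; first by case: (leqP 0 n); lia.
by case: (ltnP j n) => jn; case: (ltnP j.+1 n) => jn' // K; exfalso; lia.
Qed.

Lemma stack_seg : forall x, shade (seg T x) = shade_seg x.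
Proof.
case=> [[i j]|j] /=; rewrite pos_shade // -ltnS;
  have /= := ltn_ord j; lia.
Qed.

Lemma stack_bef p : seg T (before p) = side (pt T p) (shade_before p).
Proof. by case: p => [[i j]|j]; apply: stack_before. Qed.

Lemma stack_aft p : seg T (after p) = side (pt T p) (~~ shade_before p).
Proof. by case: p => [[i j]|j]; apply: stack_after. Qed.


Definition top_pt (i : 'I_n) : 'I_n.*2 :=
  widen_ord (leq_trans (leq_addr n n) (eq_leq (addnn n))) i.
Definition bot_pt (i : 'I_n) : 'I_n.*2 := rev_ord (top_pt i).

Lemma col_top i : column (top_pt i) = i.
Proof. by apply/val_inj; rewrite /= /col_nat ltn_ord. Qed.
Lemma col_bot i : column (bot_pt i) = i.
Proof. by rewrite col_rev col_top. Qed.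
Lemma layer_top u v i : stack_layer u v (top_pt i) = u.
Proof. by rewrite /stack_layer /= ltn_ord. Qed.
Lemma layer_bot u v i : stack_layer u v (bot_pt i) = v.
Proof. by rewrite /stack_layer ifN //=; have := ltn_ord i; lia. Qed.

Let inner_pt i (j : 'I_n.*2) : point stack_color (n, s) :=
  inl (Tagged (fun i => 'I_(npts (stack_color i))) (j : 'I_(npts (stack_color i)))).
Let outer_pt (j : 'I_n.*2) : point stack_color (n, s) := inr j.

(* the lower end (b = true) and the upper end (b = false) of a string *)
Let endpoint (b : bool) (l : 'I_k.+1) (i : 'I_n) : point stack_color (n, s) :=
  if b then if unlift ord_max l is Some l' then inner_pt l' (top_pt i)
            else outer_pt (bot_pt i)
  else if unlift ord0 l is Some l' then inner_pt l' (bot_pt i)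
       else outer_pt (top_pt i).

Lemma above_lift i : above i = lift ord_max i.
Proof. by apply/val_inj; apply: esym (lift_max i). Qed.

Lemma pt_endpoint b l i : pt T (endpoint b l i) = (l, i).
Proof.
rewrite /endpoint; case: b; case: unliftP => [l'|] -> /=;
by rewrite ?col_top ?col_bot ?layer_top ?layer_bot ?above_lift.
Qed.

Lemma sign_endpoint b l i :
  sign (endpoint b l i) = b (+) (s (+) ~~ odd i).
Proof.
have H j : s (+) odd (rev_ord (top_pt j)) = s (+) ~~ odd j by rewrite odd_rev.
rewrite /endpoint; case: b; [case: (unlift ord_max l)|case: (unlift ord0 l)];
  move=> *; rewrite /= /seg_shade ?H /=; by case: s (odd i) => [] [].
Qed.

Lemma endpointP p : exists b l i, p = endpoint b l i.
Proof.
have jP (j : 'I_n.*2) : (exists i, j = top_pt i) \/ (exists i, j = bot_pt i).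
  case: (ltnP j n) => jn; [left; exists (column j)|right; exists (column j)];
  apply/val_inj; rewrite /= /col_nat; have := ltn_ord j; case: ifP; lia.
case: p => [[l j]|j]; case: (jP j) => -[i ->].
- exists true, (above l), i; rewrite /endpoint above_lift liftK //.
- by exists false, (below l), i; rewrite /endpoint liftK.
- by exists false, ord0, i; rewrite /endpoint unlift_none.
- by exists true, ord_max, i; rewrite /endpoint unlift_none.
Qed.

Lemma stack_inj p q : pt T p = pt T q -> sign p = sign q -> p = q.
Proof.
case: (endpointP p) => b [l [i ->]]; case: (endpointP q) => b' [l' [i' ->]].
by rewrite !pt_endpoint !sign_endpoint => -[-> ->] /addIb ->.
Qed.

Lemma stack_mate p : exists q, pt T q = pt T p /\ sign q = ~~ sign p.
Proof.
case: (endpointP p) => b [l [i ->]]; exists (endpoint (~~ b) l i).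
by rewrite !pt_endpoint !sign_endpoint addNb.
Qed.

Lemma stack_regP (r : reg T) : exists l p, r = stack_reg l p.
Proof.
case: r => -[l p] rP; exists l, p; apply/val_inj; rewrite /= /stack_norm.
by move: rP; rewrite /stack_reg_pred /=; case: ifP => //= _ H; rewrite (eqP H).
Qed.

Lemma stack_side l b : shade (side (l : str T) b : reg T) = b.
Proof. by case: l => l i; rewrite /= col_side_shade. Qed.

Lemma stack_connected (r r' : reg T) : connect (symrel (reg_edge T)) r r'.
Proof.
suff H r1 : connect (symrel (reg_edge T)) (stack_reg ord0 ord0) r1.
  by apply: (connect_trans _ (H r')); rewrite connect_symrel_sym.
have [l [p ->]] := stack_regP r1; case: p => p; elim: p => [|p IHp] pn.
  by rewrite (_ : stack_reg l _ = stack_reg ord0 ord0) //;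
     apply: stack_reg_eq => //; apply/val_inj.
apply: connect_trans (IHp (ltnW pn)) (connect1 _).
have pn' : (p < n)%N by [].
have E b : side ((l, Ordinal pn') : str T) b
    = stack_reg l (inord (if s (+) odd p == b then p else p.+1)) by [].
have F q (Hq : (q < n.+1)%N) : inord q = Ordinal Hq :> 'I_n.+1.
  by apply/val_inj; rewrite /= inordK.
rewrite /symrel; case H : (s (+) odd p); apply/orP; [right|left];
  apply/existsP; exists (l, Ordinal pn'); rewrite !E H /=;
  rewrite (F _ pn) (F _ (ltnW pn)) ?eqxx /=; exact: isT.
Qed.

Lemma card_stack_region m : n = m.+1 ->
  #|stack_region k n| = (2 + k.+1 * m)%N.
Proof.
move=> nm; rewrite card_sig -sum1_card.
rewrite (eq_bigl (fun x : 'I_k.+1 * 'I_n.+1 =>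
    predT x.1 && stack_reg_pred (x.1, x.2))); last by case.
rewrite -(pair_big_dep predT (fun l p => stack_reg_pred (l, p))
            (fun=> fun=> 1%N)) /=.
rewrite (exchange_big_dep predT) //= nm big_ord_recl big_ord_recr /=.
have S1 (p : 'I_m.+2) : p = 0%N :> nat \/ p = m.+1 :> nat ->
    (\sum_(l < k.+1 | @stack_reg_pred k m.+1 (l, p)) 1 = 1)%N.
  move=> Hp; rewrite (big_pred1 ord0) // => l; rewrite /stack_reg_pred /=.
  by case: Hp => ->; rewrite ?ltnn ?andbF.
rewrite !S1 ?[lift _ _ : nat]/= ?[bump _ _]/=; [|by right|by left].
rewrite (eq_bigr (fun=> k.+1)) ?sum_nat_const ?card_ord; first by lia.
move=> p _; rewrite -[RHS]card_ord -sum1_card; apply: eq_bigl => l.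
by rewrite /stack_reg_pred /= /bump /= !inE; have := ltn_ord p; lia.
Qed.

Lemma stack_circles0 : n = 0%N -> boundary_circles T = k.+1.
Proof.
move=> n0.
have nopt (j : 'I_n.*2) : False
  by have := leq_ltn_trans (leq0n j) (ltn_ord j); rewrite n0.
have nopoint (p : point stack_color (n, s)) : False.
  by case: p => [[i j]|j]; apply: (nopt j).
have nostr (l : str T) : False.
  by case: l => _ i; have := leq_ltn_trans (leq0n i) (ltn_ord i); rewrite n0.
pose f (x : segment stack_color (n, s) + str T * bool) : option 'I_k :=
  match x with
  | inl (inl q) => Some (tag q)
  | _ => None
  end.
rewrite /boundary_circles (@n_comp_card _ _ (boundary_edge T) f).
- by rewrite card_option card_ord.
- by move=> x y /existsP[p]; case: (nopoint p).
- have ordeq (i j : 'I_(n.*2).-1.+1) : i = j.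
    by apply/val_inj; have /= := ltn_ord i; have /= := ltn_ord j; lia.
  case=> [[[i j]|j]|[l b]]; last by case: (nostr l).
  + case=> [[[i' j']|j']|[l b]] //=.
    by move=> [E]; move: j'; rewrite -E => j'; rewrite (ordeq j' j) connect0.
  + case=> [[[i' j']|j']|lb] //=; last by case: (nostr lb.1).
    by move=> _; rewrite (ordeq j' j) connect0.
- case=> [i|]; last by exists (inl (inr ord0)).
  by exists (inl (inl (@Tagged _ i (fun i => 'I_(nsegs (stack_color i))) ord0))).
Qed.

Let node : finType := (segment stack_color (n, s) + str T * bool)%type.
Let node_reg (x : node) : reg T :=
  match x with inl x => seg T x | inr lb => side lb.1 lb.2 end.
Let conn (x y : node) := connect (symrel (boundary_edge T)) x y.

Lemma stack_edge_reg (x y : node) :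
  boundary_edge T x y -> node_reg x = node_reg y.
Proof.
move=> /existsP[p /orP[] /andP[/eqP -> /eqP ->]];
by rewrite /node_reg ?stack_bef ?stack_aft.
Qed.

Lemma conn_before p : conn (inl (before p)) (inr (pt T p, shade_before p)).
Proof.
by apply/connect1/orP; left; apply/existsP; exists p; rewrite !eqxx.
Qed.

Lemma conn_after p : conn (inl (after p)) (inr (pt T p, ~~ shade_before p)).
Proof.
by apply/connect1/orP; left; apply/existsP; exists p; rewrite !eqxx orbT.
Qed.

Lemma conn_sym x y : conn x y -> conn y x.
Proof. by rewrite /conn connect_symrel_sym. Qed.

Lemma conn_trans y x z : conn x y -> conn y z -> conn x z.
Proof. exact: connect_trans. Qed.

(* two consecutive points of a disc *)
Lemma conn_consecutive p q : after p = before q ->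
  conn (inr (pt T p, ~~ shade_before p)) (inr (pt T q, shade_before q)).
Proof.
move=> pq; apply: conn_trans (conn_before q).
by rewrite -pq; apply/conn_sym/conn_after.
Qed.

Lemma next_pt (c : color) (j j' : 'I_(npts c)) :
  (j' : nat) = (if j.+1 == npts c then 0 else j.+1) -> seg_after j = seg_before j'.
Proof. by move=> H; apply/val_inj; rewrite /= seg_afterE seg_beforeE. Qed.

Lemma next_inner i (j j' : 'I_n.*2) :
  (j' : nat) = (if j.+1 == n.*2 then 0 else j.+1) ->
  after (inner_pt i j) = before (inner_pt i j').
Proof. by move=> H; rewrite /= (@next_pt (n, s) j j' H). Qed.

Lemma next_outer (j j' : 'I_n.*2) :
  (j' : nat) = (if j.+1 == n.*2 then 0 else j.+1) ->
  after (outer_pt j) = before (outer_pt j').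
Proof. by move=> H; rewrite /= (@next_pt (n, s) j j' H). Qed.

Let sd (l : 'I_k.+1) (i : 'I_n) (b : bool) : node := inr ((l, i), b).

Lemma shade_inner i j : shade_before (inner_pt i j) = s (+) odd j.
Proof. by []. Qed.
Lemma shade_outer j : shade_before (outer_pt j) = s (+) odd j.
Proof. by []. Qed.
Lemma pt_inner_top l i : pt T (inner_pt l (top_pt i)) = (above l, i).
Proof. by rewrite /= layer_top col_top. Qed.
Lemma pt_inner_bot l i : pt T (inner_pt l (bot_pt i)) = (below l, i).
Proof. by rewrite /= layer_bot col_bot. Qed.
Lemma pt_outer_top i : pt T (outer_pt (top_pt i)) = (ord0, i).
Proof. by rewrite /= layer_top col_top. Qed.
Lemma odd_top i : odd (top_pt i) = odd i. Proof. by []. Qed.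
Lemma odd_bot i : odd (bot_pt i) = ~~ odd i.
Proof. by rewrite odd_rev. Qed.
Let ptE := (shade_inner, shade_outer, pt_inner_top, pt_inner_bot, pt_outer_top,
            odd_top, odd_bot).

Lemma conn_layers (i : 'I_n) (b : bool) :
  (forall x : 'I_k, conn (sd (below x) i b) (sd (above x) i b)) ->
  forall l, conn (sd l i b) (sd ord0 i b).
Proof.
move=> H [l lk]; elim: l lk => [|l IHl] lk.
  by rewrite (_ : Ordinal lk = ord0) ?/conn ?connect0 //; apply/val_inj.
have := H (Ordinal (lk : (l < k)%N)).
have -> : below (Ordinal (lk : (l < k)%N)) = Ordinal lk by apply/val_inj.
have -> : above (Ordinal (lk : (l < k)%N)) = Ordinal (ltnW lk) by apply/val_inj.
by move=> H1; apply: conn_trans H1 (IHl _).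
Qed.

Lemma conn_left (i : 'I_n) (l : 'I_k.+1) :
  i = 0%N :> nat -> conn (sd l i s) (sd ord0 i s).
Proof.
move=> i0; apply: conn_layers l => l.
have /conn_consecutive : after (inner_pt l (bot_pt i)) = before (inner_pt l (top_pt i)).
  by apply: next_inner; have /= := ltn_ord i; case: eqP; lia.
by rewrite !ptE i0 /= !addbT negbK !addbF.
Qed.

Lemma conn_right (i : 'I_n) (l : 'I_k.+1) : i.+1 = n ->
  conn (sd l i (~~ (s (+) odd i))) (sd ord0 i (~~ (s (+) odd i))).
Proof.
move=> iN; apply: conn_layers l => l; apply: conn_sym.
have /conn_consecutive : after (inner_pt l (top_pt i)) = before (inner_pt l (bot_pt i)).
  by apply: next_inner; have /= := ltn_ord i; case: eqP; lia.
by rewrite !ptE addbN.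
Qed.

Lemma conn_middle (i i' : 'I_n) (l : 'I_k.+1) : i.+1 = i' ->
  conn (sd l i (~~ (s (+) odd i))) (sd l i' (s (+) odd i')).
Proof.
move=> ii'; case: (unliftP ord0 l) => [l'|] ->.
  have /conn_consecutive :
      after (inner_pt l' (bot_pt i')) = before (inner_pt l' (bot_pt i)).
    by apply: next_inner; have /= := ltn_ord i'; case: eqP; lia.
  by rewrite !ptE !addbN negbK => /conn_sym.
have /conn_consecutive :
    after (outer_pt (top_pt i)) = before (outer_pt (top_pt i')).
  by apply: next_outer; have /= := ltn_ord i'; case: eqP; lia.
by rewrite !ptE.
Qed.

Let cano (i0 : 'I_n) (r : reg T) : node :=
  sd (val r).1 (insubd i0 (val r).2) (shade r).

Lemma conn_side (i0 : 'I_n) l i b : i0.+1 = n ->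
  conn (sd l i b) (cano i0 (stack_reg l (col_side s i b))).
Proof.
move=> i0n; rewrite /cano [shade _](stack_side (l, i)) /=.
have := col_sideE s i b; case: (eqVneq (s (+) odd i) b) => [<-|ib] p_i.
  have -> : insubd i0 (col_side s i (s (+) odd i)) = i.
    by apply/val_inj; rewrite /= val_insubd p_i ltn_ord.
  case: ifP => [_|]; first exact: connect0.
  rewrite p_i ltn_ord andbT => /negbT; rewrite -eqn0Ngt => /eqP i_0.
  by rewrite i_0 addbF; apply: conn_left.
have aux (x y : bool) : x != y -> y = ~~ x by case: x y => [] [].
have {ib}bE := aux _ _ ib.
case: (ltnP i.+1 n) => iN.
  have -> : insubd i0 (col_side s i b) = Ordinal iN.
    by apply/val_inj; rewrite /= val_insubd p_i iN.
  rewrite p_i iN /= bE; have := @conn_middle i (Ordinal iN) l erefl.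
  by rewrite /= addbN.
have iN1 : i.+1 = n by have := ltn_ord i; lia.
have -> : insubd i0 (col_side s i b) = i.
  by apply/val_inj/succn_inj; rewrite /= val_insubd p_i iN1 ltnn i0n.
by rewrite p_i iN1 ltnn andbF bE; apply: conn_right.
Qed.

Lemma node_side (x : node) : (0 < n)%N ->
  exists l i b, conn x (sd l i b) /\ node_reg x = node_reg (sd l i b).
Proof.
move=> n0; have H p : exists l i b, conn (inl (before p)) (sd l i b) /\
    node_reg (inl (before p)) = node_reg (sd l i b).
  exists (pt T p).1, (pt T p).2, (shade_before p).
  have -> : sd (pt T p).1 (pt T p).2 (shade_before p) = inr (pt T p, shade_before p).
    by rewrite /sd -surjective_pairing.
  by split; [exact: conn_before | exact: stack_bef].
have nseg (j : 'I_(n.*2).-1.+1) : (j < n.*2)%N by have /= := ltn_ord j; lia.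
case: x => [[[l j]|j]|[[l i] b]]; last by exists l, i, b; split=> //; exact: connect0.
- have := H (inner_pt l (Ordinal (nseg j))).
  rewrite /before /=; rewrite (_ : seg_before _ = j) //.
  by apply/val_inj; rewrite /= (@seg_beforeE (n, s)).
- have := H (outer_pt (Ordinal (nseg j))).
  rewrite /before /=; rewrite (_ : seg_before _ = j) //.
  by apply/val_inj; rewrite /= (@seg_beforeE (n, s)).
Qed.

Lemma stack_circles : (0 < n)%N -> boundary_circles T = #|reg T|.
Proof.
move=> n0; have n1 : (n.-1 < n)%N by lia.
have n1S : (Ordinal n1).+1 = n by rewrite /=; lia.
apply: (@n_comp_card _ _ _ node_reg); first exact: stack_edge_reg.
- move=> x y; have [l [i [b [+ ->]]]] := node_side x n0.
  have [l' [i' [b' [+ ->]]]] := node_side y n0.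
  move=> /conn_sym yc xc rr; apply: conn_trans (conn_trans xc _) yc.
  apply: conn_trans (@conn_side (Ordinal n1) l i b n1S) _.
  apply: conn_sym; move: rr => /= ->; exact: conn_side.
- move=> r; have [l [p ->]] := stack_regP r.
  case: (ltnP p n) => pn.
    exists (sd l (Ordinal pn) (s (+) odd p)).
    rewrite /node_reg /=; congr stack_reg; apply/val_inj.
    by rewrite /= col_sideE /= eqxx.
  exists (sd l (Ordinal n1) (~~ (s (+) odd n.-1))).
  rewrite /node_reg /=; congr stack_reg; apply/val_inj.
  rewrite /= col_sideE /=; have := ltn_ord p; move: pn; clear -n0.
by case: (s (+) _) => /=; lia.
Qed.

Lemma stack_euler :
  (#|'I_k|.+1 + 2 * #|reg T|
   = 2 + (\sum_(i < k) (stack_color i).1 + n) + boundary_circles T)%N.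
Proof.
rewrite card_ord sum_nat_const card_ord /=.
case: (posnP n) => n0.
  rewrite stack_circles0 //.
  suff -> : #|stack_region k n| = 1%N by rewrite n0; lia.
  rewrite card_sig; apply/eqP; rewrite -[_ == _]/(_ == 1%N).
  rewrite (eq_card1 (x := (ord0, ord0))) // => -[l p].
  rewrite !inE /stack_reg_pred /= xpair_eqE.
  have -> : (p == ord0) by apply/eqP/val_inj => /=; have := ltn_ord p; lia.
  by rewrite andbT; case: (l == ord0); rewrite ?orbT ?orbF //; lia.
have nm : n = n.-1.+1 by lia.
by rewrite stack_circles //= (card_stack_region nm); lia.
Qed.

Lemma stack_planar : planar T.
Proof.
split.
- exact: stack_seg.
- exact: stack_side.
- exact: stack_bef.
- exact: stack_aft.
- exact: stack_inj.
- exact: stack_mate.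
- exact: stack_connected.
- exact: stack_euler.
Qed.

Definition stack : tangle stack_color (n, s) := Tangle stack_planar.

End Stack.

Lemma no_ord0 (j : 'I_0) : False.
Proof. by case: j. Qed.

(** ** Closings

  [closing n s left] joins the top points to the bottom points of the inner disc
  by n nested arcs, which go around the right of the disc, or around its left if
  [left] holds. *)

Section Closing.
Variables (n : nat) (s left : bool).

Definition closing_color : unit -> color := fun _ => (n, s).
Definition closing_outer : color := (0%N, s (+) (left && odd n)).

Definition closing_data : pretangle closing_color closing_outer :=
  @Pretangle _ closing_color closing_outer 'I_n 'I_n.+1
    (fun _ j => column j)
    (fun j : 'I_0 => match no_ord0 j with end)
    (fun _ j => pos n j)
    (fun _ => if left then ord_max else ord0)
    (fun i b => col_side s i b)
    (fun r => s (+) odd r).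

Let T := closing_data.

Lemma closing_seg : forall x, shade (seg T x) = shade_seg x.
Proof.
case=> [[i j]|j] /=.
  by rewrite pos_shade //; have /= := ltn_ord j; lia.
by rewrite (ord1 j) /seg_shade /= addbF; case: left => /=; rewrite ?andbT.
Qed.

Lemma closing_bef p : seg T (before p) = side (pt T p) (shade_before p).
Proof.
case: p => [[i j]|j]; last by case: (no_ord0 j).
by have := pos_before s j; rewrite -{1}(@seg_beforeE (n, s) j).
Qed.

Lemma closing_aft p : seg T (after p) = side (pt T p) (~~ shade_before p).
Proof.
case: p => [[i j]|j]; last by case: (no_ord0 j).
by have := pos_after s j; rewrite -{1}(@seg_afterE (n, s) j).
Qed.

Lemma closing_inj p q : pt T p = pt T q -> sign p = sign q -> p = q.
Proof.
case: p => [[[] j]|j]; last by case: (no_ord0 j).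
case: q => [[[] j']|j']; last by case: (no_ord0 j').
by rewrite /= /seg_shade /= => H /addbI /(col_inj H) ->.
Qed.

Lemma closing_mate p : exists q, pt T q = pt T p /\ sign q = ~~ sign p.
Proof.
case: p => [[[] j]|j]; last by case: (no_ord0 j).
exists (inl (Tagged (fun i => 'I_(npts (closing_color i))) (rev_ord j))).
by rewrite /= col_rev /seg_shade odd_rev /= addbN.
Qed.

Lemma closing_connected (r r' : reg T) : connect (symrel (reg_edge T)) r r'.
Proof.
suff H (r1 : 'I_n.+1) : connect (symrel (reg_edge T)) (ord0 : 'I_n.+1) r1.
  by apply: (connect_trans _ (H r')); rewrite connect_symrel_sym.
case: r1 => p; elim: p => [|p IHp] pn.
  by rewrite (_ : Ordinal pn = ord0) ?connect0 //; apply/val_inj.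
apply: connect_trans (IHp (ltnW pn)) (connect1 _).
have pn' : (p < n)%N by [].
have F q (Hq : (q < n.+1)%N) : inord q = Ordinal Hq :> 'I_n.+1.
  by apply/val_inj; rewrite /= inordK.
rewrite /symrel; case H : (s (+) odd p); apply/orP; [right|left];
  apply/existsP; exists (Ordinal pn'); rewrite /= /col_side /= H /=;
  rewrite (F _ pn) (F _ (ltnW pn)) ?eqxx /=; exact: isT.
Qed.

Let node : finType :=
  (segment closing_color closing_outer + str T * bool)%type.
Let node_reg (x : node) : option 'I_n.+1 :=
  match x with
  | inl (inl q) => Some (pos n (tagged q))
  | inl (inr _) => None
  | inr lb => Some (col_side s lb.1 lb.2)
  end.
Let inner_seg (j : 'I_(n.*2).-1.+1) : node :=
  inl (inl (@Tagged _ tt (fun i => 'I_(nsegs (closing_color i))) j)).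
Let inner_pt (j : 'I_n.*2) : point closing_color closing_outer :=
  inl (@Tagged _ tt (fun i => 'I_(npts (closing_color i))) j).
Let sd (i : 'I_n) (b : bool) : node := inr (i, b).
Let conn (x y : node) := connect (symrel (boundary_edge T)) x y.

Lemma closing_conn_sym x y : conn x y -> conn y x.
Proof. by rewrite /conn connect_symrel_sym. Qed.

Lemma closing_conn_trans y x z : conn x y -> conn y z -> conn x z.
Proof. exact: connect_trans. Qed.

Lemma closing_conn_before j :
  conn (inl (before (inner_pt j))) (sd (column j) (s (+) odd j)).
Proof.
by apply/connect1/orP; left; apply/existsP; exists (inner_pt j); rewrite !eqxx.
Qed.

Lemma closing_conn_after j :
  conn (inl (after (inner_pt j))) (sd (column j) (~~ (s (+) odd j))).
Proof.
apply/connect1/orP; left; apply/existsP; exists (inner_pt j).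
by rewrite !eqxx orbT.
Qed.

Let canon (p : 'I_n.+1) : node := inner_seg (inord p).

Lemma closing_conn_side i b : conn (sd i b) (canon (col_side s i b)).
Proof.
have ilt := ltn_ord i.
have tlt : (i < n.*2)%N by lia.
have colt : column (Ordinal tlt) = i.
  by apply/val_inj; rewrite /= /col_nat ilt.
rewrite /canon col_sideE; apply: closing_conn_sym; case: eqP => [<-|/eqP ib].
  have := closing_conn_before (Ordinal tlt); rewrite colt /=.
  by congr (conn (inl (inl _)) _).
have aux (x y : bool) : x != y -> y = ~~ x by case: x y => [] [].
rewrite (aux _ _ ib); have := closing_conn_after (Ordinal tlt); rewrite colt /=.
congr (conn (inl (inl _)) _); rewrite /inner_seg /=; congr Tagged.
apply/val_inj; rewrite [LHS](@seg_afterE (n, s)) /= inordK; last by rewrite /=; lia.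
by case: eqP; lia.
Qed.

Lemma closing_conn_seg (j : 'I_(n.*2).-1.+1) :
  conn (inner_seg j) (canon (pos n j)).
Proof.
case: (leqP j n) => jn.
  rewrite /canon posE /pos_nat jn (_ : inord j = j) ?/conn ?connect0 //.
  by apply/val_inj; rewrite /= inordK.
have jlt : (j < n.*2)%N by have /= := ltn_ord j; lia.
have := pos_before s (Ordinal jlt); rewrite /= => ->.
apply: closing_conn_trans (closing_conn_side _ _).
have := closing_conn_before (Ordinal jlt).
congr (conn (inl (inl _)) _); rewrite /inner_seg /=; congr Tagged.
by apply/val_inj; rewrite [LHS](@seg_beforeE (n, s)).
Qed.

Lemma closing_circles : boundary_circles T = n.+2.
Proof.
rewrite /boundary_circles (@n_comp_card _ _ (boundary_edge T) node_reg).
- by rewrite card_option card_ord.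
- move=> x y /existsP[[[[] j]|j]]; last by case: (no_ord0 j).
  have /= bef := closing_bef (inner_pt j).
  have /= aft := closing_aft (inner_pt j).
  move=> /orP[] /andP[/eqP -> /eqP ->] /=; congr Some.
    exact: bef.
  exact: aft.
- have H x p : node_reg x = Some p -> conn x (canon p).
    case: x => [[[[] j]|j]|[i b]] //= [<-]; first exact: closing_conn_seg.
    exact: closing_conn_side.
  move=> x y; case E : (node_reg x) => [p|].
    move=> /esym /H yp; apply: closing_conn_trans (H _ _ E) _.
    exact: closing_conn_sym.
  case: x E => [[q|j]|lb] // _; case: y => [[q|j']|lb] // _.
  by rewrite (ord1 j) (ord1 j') connect0.
- case=> [p|]; last by exists (inl (inr ord0)).
  exists (canon p); congr Some; apply/val_inj; have plt := ltn_ord p.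
  rewrite /= posE /pos_nat inordK; first by case: leqP; lia.
  by rewrite /=; lia.
Qed.

Lemma closing_planar : planar T.
Proof.
split.
- exact: closing_seg.
- by move=> l b; apply: col_side_shade.
- exact: closing_bef.
- exact: closing_aft.
- exact: closing_inj.
- exact: closing_mate.
- exact: closing_connected.
- by rewrite closing_circles card_unit card_ord sum_nat_const card_unit /=; lia.
Qed.

Definition closing : tangle closing_color closing_outer :=
  Tangle closing_planar.

End Closing.

(** ** A closed string, with a region of shading s around it *)

Section Loop.
Variable s : bool.

Definition no_color : void -> color := fun=> (0%N, s).

Definition loop_data : pretangle no_color (0%N, s) :=
  @Pretangle _ no_color (0%N, s) unit bool
    (fun v => match v with end)
    (fun j : 'I_0 => match no_ord0 j with end)
    (fun v => match v with end)
    (fun _ => s)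
    (fun _ b => b)
    id.

Let T := loop_data.

Lemma loop_circles : boundary_circles T = 3.
Proof.
rewrite /boundary_circles.
pose f (x : segment no_color (0%N, s) + str T * bool) : option bool :=
  match x with inl _ => None | inr lb => Some lb.2 end.
rewrite (@n_comp_card _ _ (boundary_edge T) f).
- by rewrite card_option card_bool.
- by move=> x y /existsP[[[[] j]|j]]; case: (no_ord0 j).
- case=> [[[[] ?]|j]|[[] b]] [[[[] ?]|j']|[[] b']] //=.
  + by rewrite (ord1 j) (ord1 j') connect0.
  + by move=> [->]; rewrite connect0.
- by case=> [b|]; [exists (inr (tt, b)) | exists (inl (inr ord0))].
Qed.

Lemma loop_planar : planar T.
Proof.
split.
- by case=> [[[] ?]|j] //=; rewrite (ord1 j) /seg_shade addbF.
- by [].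
- by case=> [[[] ?]|j]; case: (no_ord0 j).
- by case=> [[[] ?]|j]; case: (no_ord0 j).
- by case=> [[[] ?]|j]; case: (no_ord0 j).
- by case=> [[[] ?]|j]; case: (no_ord0 j).
- move=> r r'; have [->|rr'] := eqVneq r r'; first exact: connect0.
  apply/connect1; rewrite /symrel; apply/orP.
  by case: r r' rr' => [] [] // _; [right|left]; apply/existsP; exists tt.
- by rewrite loop_circles card_void card_bool big1 // => -[].
Qed.

Definition loop : tangle no_color (0%N, s) := Tangle loop_planar.

End Loop.

(** ** The one-click rotation of 2-boxes *)

Section Rotation.
Variable s : bool.

Definition rotation_color : unit -> color := fun _ => (2, s).

Definition rotation_data : pretangle rotation_color (2, ~~ s) :=
  @Pretangle _ rotation_color (2, ~~ s) 'I_4 'I_4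
    (fun _ (j : 'I_4) => j)
    (fun j : 'I_4 => ordS j)
    (fun _ (j : 'I_4) => j)
    (fun j : 'I_4 => ordS j)
    (fun j b => if s (+) odd j == b then j else ordS j)
    (fun r => s (+) odd r).

Let T := rotation_data.

Lemma ordS4_odd (j : 'I_4) : odd (ordS j) = ~~ odd j.
Proof. by case: j => [[|[|[|[|]]]]]. Qed.

Lemma rotation_bef p : seg T (before p) = side (pt T p) (shade_before p).
Proof.
have H (j : 'I_4) : (inord j : 'I_4) = j by apply: inord_val.
case: p => [[i j]|j] /=; rewrite /seg_before H // /seg_shade.
  by rewrite eqxx.
by rewrite ordS4_odd addbN -addNb eqxx.
Qed.

Lemma rotation_aft p : seg T (after p) = side (pt T p) (~~ shade_before p).
Proof.
have H (j : 'I_4) : (inord (j.+1 %% 4) : 'I_4) = ordS j.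
  by apply/val_inj; rewrite /= inordK // ltn_mod.
have F b : (b == ~~ b) = false by case: b.
case: p => [[i j]|j] /=; rewrite /seg_after H /seg_shade ?F //.
by rewrite ordS4_odd addbN -addNb F.
Qed.

Let node : finType :=
  (segment rotation_color (2, ~~ s) + str T * bool)%type.
Let node_reg (x : node) : reg T :=
  match x with inl x => seg T x | inr lb => side lb.1 lb.2 end.

Lemma rotation_circles : boundary_circles T = 4.
Proof.
rewrite /boundary_circles (@n_comp_card _ _ (boundary_edge T) node_reg).
- exact: card_ord.
- move=> x y /existsP[p /orP[] /andP[/eqP -> /eqP ->]] /=.
    exact: rotation_bef.
  exact: rotation_aft.
- pose canon (r : 'I_4) : node := inr (r, s (+) odd r).
  have cs := connect_symrel_sym (boundary_edge T).
  have C p : connect (symrel (boundary_edge T))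
      (inl (before p)) (inr (pt T p, shade_before p)).
    by apply/connect1/orP; left; apply/existsP; exists p; rewrite !eqxx.
  have C' p : connect (symrel (boundary_edge T))
      (inl (after p)) (inr (pt T p, ~~ shade_before p)).
    by apply/connect1/orP; left; apply/existsP; exists p; rewrite !eqxx orbT.
  have inp (j : 'I_4) : before (inl (@Tagged _ tt
      (fun i => 'I_(npts (rotation_color i))) j) : point _ (2, ~~ s))
      = inl (@Tagged _ tt (fun i => 'I_(nsegs (rotation_color i))) j).
    by rewrite /= /seg_before inord_val.
  have outp (j : 'I_4) : before (inr j : point rotation_color (2, ~~ s)) = inr j.
    by rewrite /= /seg_before inord_val.
  have Hin (j : 'I_4) : connect (symrel (boundary_edge T))
     (inl (inl (@Tagged _ tt (fun i => 'I_(nsegs (rotation_color i))) j)))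
     (canon j).
    by rewrite -inp; apply: C.
  have H x : connect (symrel (boundary_edge T)) x (canon (node_reg x)).
    case: x => [[[[] j]|j]|[j b]]; first exact: Hin.
      rewrite -outp; apply: connect_trans (C _) _ => /=.
      rewrite /seg_shade /seg_before inord_val /canon ordS4_odd addbN -addNb.
      exact: connect0.
    rewrite /node_reg /=; case: eqP => [<-|/eqP jb]; first exact: connect0.
    have aux (x y : bool) : x != y -> y = ~~ x by case: x y => [] [].
    rewrite (aux _ _ jb); apply: connect_trans (Hin _).
    rewrite cs; have := C' (inl (@Tagged _ tt
      (fun i => 'I_(npts (rotation_color i))) j)).
    rewrite /= /seg_after (_ : inord _ = ordS j) //.
    by apply/val_inj; rewrite /= inordK // ltn_mod.
  move=> x y xy; apply: connect_trans (H x) _.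
  by rewrite xy cs; apply: H.
- move=> j; exists (inr (j, s (+) odd j)).
  by rewrite /= eqxx.
Qed.

Lemma rotation_planar : planar T.
Proof.
have inj4 : injective (@ordS 4) by apply: can_inj (@ordSK 4).
split.
- case=> [[i j]|j] //=; rewrite /seg_shade /= ordS4_odd addbN -addNb //.
- move=> l b /=; case: ifP => [/eqP //|/eqP/eqP].
  by rewrite ordS4_odd; case: s (odd l) b => [] [] [].
- exact: rotation_bef.
- exact: rotation_aft.
- case=> [[[] j]|j] [[[] j']|j'] /=; rewrite /seg_shade /=.
  + by move=> ->.
  + by move=> ->; rewrite ordS4_odd; case: s (odd j') => [] [].
  + by move=> <-; rewrite ordS4_odd; case: s (odd j) => [] [].
  + by move=> /inj4 ->.
- case=> [[[] j]|j] /=.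
    rewrite -(ord_predK j); move: (ord_pred j) => i; exists (inr i).
    split=> //=; rewrite /seg_shade ordS4_odd /=.
    by case: s (odd i) => [] [].
  exists (inl (@Tagged _ tt (fun i => 'I_(npts (rotation_color i))) (ordS j))).
  split=> //=; rewrite /seg_shade ordS4_odd /=.
  by case: s (odd j) => [] [].
- have cs := connect_symrel_sym (reg_edge T).
  have step (r : 'I_4) : connect (symrel (reg_edge T)) r (ordS r).
    apply/connect1; rewrite /symrel; apply/orP.
    case H : (s (+) odd r); [right|left]; apply/existsP; exists r;
    by rewrite /= H /= !eqxx.
  have it m : connect (symrel (reg_edge T)) (ord0 : 'I_4) (iter m (@ordS 4) ord0).
    elim: m => [|m IHm]; first exact: connect0.
    exact: connect_trans IHm (step _).
  have all0 (r : 'I_4) : connect (symrel (reg_edge T)) (ord0 : 'I_4) r.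
    rewrite (_ : r = iter r (@ordS 4) ord0) //.
    by case: r => [[|[|[|[|//]]]] ?]; apply/val_inj.
  by move=> r r'; apply: connect_trans (all0 r'); rewrite cs.
- by rewrite rotation_circles card_unit card_ord sum_nat_const card_unit.
Qed.

Definition rotation : tangle rotation_color (2, ~~ s) := Tangle rotation_planar.

End Rotation.

(** * Planar algebras *)

Local Open Scope ring_scope.

Record planar_algebra (R : realType) := PlanarAlgebra {
  box : color -> vectType (complex R);
  tangle_act : forall (I : finType) (c : I -> color) (c0 : color),
        tangle c c0 -> (forall i, box (c i)) -> box c0;
  act_multilinear : forall (I : finType) (c : I -> color) (c0 : color)
      (T : tangle c c0) (x : forall i, box (c i)) (i : I)
      (a : complex R) (u v : box (c i)),
    tangle_act T (dfwith x (a *: u + v))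
    = a *: tangle_act T (dfwith x u) + tangle_act T (dfwith x v);
  act_relabelling : forall (I I' : finType) (c : I -> color) (c0 : color)
      (f : I' -> I) (T : tangle c c0) (T' : tangle (c \o f) c0)
      (x : forall i, box (c i)),
    bijective f -> relabelling T T' ->
    tangle_act T' (fun i => x (f i)) = tangle_act T x;
  act_gluing : forall (I : finType) (J : I -> finType) (c : I -> color)
      (c0 : color) (c' : forall i, J i -> color)
      (T : tangle c c0) (S : forall i, tangle (@c' i) (c i))
      (U : tangle (glued_color c') c0)
      (x : forall p : {i : I & J i}, box (glued_color c' p)),
    gluing T S U ->
    tangle_act U x
    = tangle_act T (fun i => tangle_act (S i) (fun j => x (Tagged J j)));
  act_identity : forall (n : nat) (s : bool) (a : box (n, s)),
    tangle_act (stack 1 n s) (fun=> a) = a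
}.

Record planar_star_algebra (R : realType) := PlanarStarAlgebra {
  underlying_pa :> planar_algebra R;
  star_box : forall c, box underlying_pa c -> box underlying_pa c;
  star_antilinear : forall c (a : complex R) (x y : box underlying_pa c),
    star_box (a *: x + y) = Num.conj a *: star_box x + star_box y;
  starK : forall c (x : box underlying_pa c), star_box (star_box x) = x;
  star_act : forall (I : finType) (c : I -> color) (c0 : color)
      (T T' : tangle c c0) (x : forall i, box underlying_pa (c i)),
    reflection T T' ->
    star_box (tangle_act T x) = tangle_act T' (fun i => star_box (x i))
}.

Section BoxAlgebra.
Variables (R : realType) (P : planar_star_algebra R).

Definition mul_box (n : nat) (s : bool) (a b : box P (n, s)) : box P (n, s) :=
  tangle_act (stack 2 n s) (fun i : 'I_2 => if i == ord0 then a else b).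

Definition one_box (n : nat) (s : bool) : box P (n, s) :=
  tangle_act (stack 0 n s) (fun=> 0).

(** When P_{0,+} and P_{0,-} are one-dimensional, they are identified with C by
  sending the empty diagram [one_box 0 s] to 1. *)
Definition scalar_of (s : bool) (x : box P (0%N, s)) : complex R :=
  coord [tuple one_box 0 s] ord0 x.

(** The trace normalized by the value d of a closed string, closing on the left
  or on the right. *)
Definition trace_box (d : complex R) (left : bool) (n : nat) (s : bool)
    (a : box P (n, s)) : complex R :=
  d ^- n * scalar_of (tangle_act (closing n s left) (fun=> a)).

Definition fourier (s : bool) (a : box P (2, s)) : box P (2, ~~ s) :=
  tangle_act (rotation s) (fun=> a).

End BoxAlgebra.

Record subfactor_planar_algebra (R : realType) := SubfactorPlanarAlgebra {
  underlying_psa :> planar_star_algebra R;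
  (* in the order of C, [0 < delta] says that delta is a positive real *)
  delta : complex R;
  delta_gt0 : 0 < delta;
  dim_box0 : forall s, \dim {:box underlying_psa (0%N, s)} = 1%N;
  closed_string : forall s (x : forall v, box underlying_psa (no_color s v)),
    tangle_act (loop s) x = delta *: one_box underlying_psa 0 s;
  spherical : forall n s (a : box underlying_psa (n, s)),
    trace_box delta true a = trace_box delta false a;
  inner_product_sym : forall n s (a b : box underlying_psa (n, s)),
    trace_box delta false (mul_box (star_box b) a)
    = Num.conj (trace_box delta false (mul_box (star_box a) b));
  inner_product_gt0 : forall n s (a : box underlying_psa (n, s)),
    a != 0 -> 0 < trace_box delta false (mul_box (star_box a) a)
}.

Section Biprojections.
Variables (R : realType) (P : subfactor_planar_algebra R).

Definition irreducible_pa : Prop := forall s, \dim {:box P (1%N, s)} = 1%N.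

Section Order.
Variables (n : nat) (s : bool).
Implicit Types a b p : box P (n, s).

Definition central_box a : Prop := forall x, mul_box a x = mul_box x a.

Definition projection p : Prop := mul_box p p = p /\ star_box p = p.

Definition positive_box a : Prop := exists x, a = mul_box (star_box x) x.

Definition le_box a b : Prop := positive_box (b - a).

Definition minimal_projection p : Prop :=
  [/\ projection p, p <> 0
    & forall q, projection q -> le_box q p -> q = 0 \/ q = p].

Definition range_projection a p : Prop :=
  [/\ projection p, mul_box p a = a
    & forall q, projection q -> mul_box q a = a -> le_box p q].

End Order.

Definition biprojection (b : box P (2, false)) : Prop :=
  [/\ b <> 0, projection b
    & exists (l : complex R) (q : box P (2, true)),
        [/\ 0 < l, projection q & fourier b = l *: q]].

Definition normal_biprojection (b : box P (2, false)) : Prop :=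
  central_box b /\ central_box (fourier b).

(** [generates a b] says that <a> = b, for a positive. *)
Definition generates (a b : box P (2, false)) : Prop :=
  exists r, [/\ range_projection a r, biprojection b, le_box r b
    & forall b', biprojection b' -> le_box r b' -> le_box b b'].

End Biprojections.

Section Lattice.
Variables (T : Type) (L : T -> Prop) (le : T -> T -> Prop).

Definition is_meet (a b m : T) : Prop :=
  [/\ L m, le m a, le m b & forall x, L x -> le x a -> le x b -> le x m].
Definition is_join (a b j : T) : Prop :=
  [/\ L j, le a j, le b j & forall x, L x -> le a x -> le b x -> le j x].

(** The elements of L, ordered by le, form a distributive lattice. *)
Definition distributive_lattice : Prop :=
  [/\ forall a b, L a -> L b -> exists m, is_meet a b m,
      forall a b, L a -> L b -> exists j, is_join a b j
    & forall a b c, L a -> L b -> L c ->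
      forall bc a_bc ab ac,
        is_join b c bc -> is_meet a bc a_bc ->
        is_meet a b ab -> is_meet a c ac -> is_join ab ac a_bc].

End Lattice.

(* Main.v *)
From HB Require Import structures.
Require Import Defs.
From mathcomp Require Import all_boot all_order all_algebra.
From mathcomp Require Import boolp reals complex zify ring.

Set Implicit Arguments.
Unset Strict Implicit.
Unset Printing Implicit Defensive.

Import Order.TTheory GRing.Theory Num.Theory.

(** Subgroups of a cyclic group are the model: a finite group whose lattice of
  subgroups is distributive is cyclic, because some element lies in no maximal
  subgroup.  For biprojections the role of such an element is played by a minimal
  projection u below the complement of all coatoms (the maximal biprojections
  other than 1).  Indeed biprojections are central by hypothesis, so if u lies
  below a biprojection b <> 1 it lies below a coatom, to which it is orthogonal;
  hence <u> = 1.  It remains to see that the product of the 1 - c over any finite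
  list of distinct coatoms c is nonzero ([avoid_all_neq0]), and its trace is
  computed: it is the product of the 1 - tr c, up to normalization, because the
  coatoms are independent for the trace ([ntau_avoid_all]).

  Independence rests on two facts.  By distributivity coatoms are prime
  ([coatom_prime]), so a coatom c and the meet m of finitely many other coatoms
  have join 1.  And tr b tr c = tr (b c) tr 1 as soon as every biprojection above
  both b and c is 1 ([tau_mul_biproj]).  The latter is proved with the convolution
  b o c, the product of the Fourier transforms carried back: its transform is a
  multiple of a projection since biprojections are normal, it is positive by the
  Schur product theorem ([schur_product_trace]), and a positive 2-box whose
  transform is a multiple of a projection is itself a multiple of a projection
  ([projection_from_transform]).  So b o c is a multiple of a biprojection above b
  and c, that is, of 1, and the factor is found by taking traces.  The same two
  results, for the other shading, show that a product of biprojections is again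
  one ([biprojM]), so that products are meets.

  All this takes place in the two *-algebras of 2-boxes with their traces, linked
  by the Fourier transform.  Their relations are equalities between composites of
  tangles.  Since the theory of tangles is stated with arbitrary finite types,
  tangles are first replaced by tables of natural numbers, on which planarity,
  gluing and reflection are decidable by evaluation; [drawing_planar],
  [drawing_gluing] and [drawing_reflection] say that these tests are sound. *)

(** * Connected components of a graph with numbered vertices *)

(** One step of union-find: vertices carry labels, and the label of the second
  end of the edge is replaced by that of the first one wherever it occurs. *)
Definition link (lab : seq nat) (e : nat * nat) : seq nat :=
  [seq if l == nth 0 lab e.2 then nth 0 lab e.1 else l | l <- lab].

Definition classes (n : nat) (es : seq (nat * nat)) : seq nat :=
  foldl link (iota 0 n) es.

Definition class_of (n : nat) (es : seq (nat * nat)) : nat -> nat :=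
  nth 0 (classes n es).

Lemma nth_link lab e i : i < size lab ->
  nth 0 (link lab e) i
  = if nth 0 lab i == nth 0 lab e.2 then nth 0 lab e.1 else nth 0 lab i.
Proof. by move=> il; rewrite (nth_map 0). Qed.

Lemma size_foldl_link lab es : size (foldl link lab es) = size lab.
Proof. by elim: es lab => //= e es IHes lab; rewrite IHes size_map. Qed.

Lemma size_classes n es : size (classes n es) = n.
Proof. by rewrite size_foldl_link size_iota. Qed.

Lemma foldl_link_eq lab es i j : i < size lab -> j < size lab ->
  nth 0 lab i = nth 0 lab j ->
  nth 0 (foldl link lab es) i = nth 0 (foldl link lab es) j.
Proof.
elim: es lab => //= e es IHes lab il jl ij.
by apply: IHes; rewrite ?size_map // !nth_link // ij.
Qed.

Lemma foldl_link_edge lab es e : {in es, forall e, e.1 < size lab /\ e.2 < size lab} ->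
  e \in es ->
  nth 0 (foldl link lab es) e.1 = nth 0 (foldl link lab es) e.2.
Proof.
elim: es lab => //= e' es IHes lab esP.
have [e1 e2] := esP e' (mem_head _ _).
rewrite inE => /predU1P[->|ees].
  apply: foldl_link_eq; rewrite ?size_map // !nth_link // eqxx.
  by case: ifP.
apply: IHes => // e'' e''es; rewrite size_map.
by apply: esP; rewrite inE e''es orbT.
Qed.

(** The vertices of a finite graph are numbered so that its connected components
  can be evaluated: neither [connect] nor [n_comp] computes. *)
Section ClassesConnect.
Variables (V : finType) (r : rel V) (enc : V -> nat).
Variables (n : nat) (es : seq (nat * nat)).
Hypothesis enc_inj : injective enc.
Hypothesis enc_lt : forall x, enc x < n.
Hypothesis es_r : {in es, forall e, exists x y, [/\ enc x = e.1, enc y = e.2 & r x y]}.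
Hypothesis r_es : forall x y, r x y -> (enc x, enc y) \in es.

Lemma connect_classes x y :
  connect (symrel r) x y = (class_of n es (enc x) == class_of n es (enc y)).
Proof.
have es_lt : {in es, forall e, e.1 < size (iota 0 n) /\ e.2 < size (iota 0 n)}.
  by move=> e /es_r[x' [y' [<- <- _]]]; rewrite size_iota !enc_lt.
apply/idP/eqP => [|].
  apply: (@connect_symrelP _ _ _ (fun x => class_of n es (enc x))) => x' y' /r_es.
  exact: (foldl_link_edge es_lt).
rewrite /class_of /classes.
have : forall x y, nth 0 (iota 0 n) (enc x) = nth 0 (iota 0 n) (enc y) ->
    connect (symrel r) x y.
  by move=> x' y'; rewrite !nth_iota // => /enc_inj ->; exact: connect0.
have : size (iota 0 n) = n by rewrite size_iota.
elim: es (iota 0 n) es_r => [|e es' IHes] lab; first by move=> _ _; apply.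
move=> /= esP labn labP; apply: IHes; rewrite ?size_map //.
  by move=> e' e'es; apply: esP; rewrite inE e'es orbT.
have [x0 [y0 [ex ey xy0]]] := esP e (mem_head _ _).
have xyc : connect (symrel r) x0 y0 by apply/connect1/orP; left.
have yxc : connect (symrel r) y0 x0 by rewrite connect_symrel_sym.
move=> x' y'; rewrite !nth_link ?labn // -ex -ey.
case: eqP => [/labP x'y0|_]; case: eqP => [/labP y'y0|_].
- move=> _; apply: connect_trans x'y0 _; rewrite connect_symrel_sym //.
- by move/labP; apply: connect_trans; apply: connect_trans yxc.
- move/labP => x'x0; apply: connect_trans x'x0 _; apply: connect_trans xyc _.
  by rewrite connect_symrel_sym.
- exact: labP.
Qed.

End ClassesConnect.

(** * Drawings: tangles given by finite tables *)

(** All inner discs of a drawing have the same colour c.  Boundary points are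
  numbered disc after disc, the points of the outer disc coming last, so that
  the point j of the inner disc i has the number i * npts c + j; the boundary
  segments are numbered in the same way.  [strings] lists the two ends of every
  string and [regions] gives the number of the region next to every segment.
  Only the colours involve the shading, so one drawing serves for both. *)
Record drawing := Drawing {
  discs : nat; strings : seq (nat * nat); regions : seq nat }.

Section Shape.
Variables (c c0 : color) (D : drawing).

Definition base := discs D * npts c.
Definition npoints := base + npts c0.
Definition nsegments := base + nsegs c0.
(** The number of the segment after the point p, which is also that of the next
  point around the same disc. *)
Definition next_point p :=
  if p < base then p %/ npts c * npts c + (p %% npts c).+1 %% npts c
  else base + (p - base).+1 %% npts c0.
Definition shade_of p := (if p < base then c.2 else c0.2) (+) odd p.
Definition sign_of p := if p < base then shade_of p else ~~ shade_of p.

Definition nstrings := size (strings D).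
Definition nregions := size (undup (regions D)).
Definition string_at p :=
  find (fun l => (p == l.1) || (p == l.2)) (strings D).
Definition region_at p := nth 0 (regions D) p.
(** A string borders the same two regions all along, so its sides can be read off
  at its first end. *)
Definition side_at l b :=
  let p := (nth (0, 0) (strings D) l).1 in
  region_at (if shade_of p == b then p else next_point p).
Definition region_shade r := shade_of (index r (regions D)).

Definition side_edges :=
  [seq (side_at l false, side_at l true) | l <- iota 0 nstrings].
Definition circle_edge (p : nat) (b : bool) :=
  (if b then next_point p else p,
   nsegments + (string_at p).*2 + (shade_of p (+) b)).
Definition circle_edges :=
  [seq circle_edge p false | p <- iota 0 npoints]
  ++ [seq circle_edge p true | p <- iota 0 npoints].
Definition ncircles :=
  size (undup (classes (nsegments + nstrings.*2) circle_edges)).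

(** The clauses are those of [planar], in the same order, after the bounds that
  make the tables meaningful. *)
Definition planar_drawing : bool :=
  let pts := iota 0 npoints in
  let strs := iota 0 nstrings in
  [&& [&& 0 < c.1, 0 < nstrings, 0 < nregions, size (regions D) == nsegments
        & all (fun r => r < nregions) (regions D)],
      all (fun p => region_shade (region_at p) == shade_of p) (iota 0 nsegments),
      all (fun l => all (fun b => region_shade (side_at l b) == b)
                        [:: false; true]) strs,
      all (fun p => [&& string_at p < nstrings,
        region_at p == side_at (string_at p) (shade_of p)
        & region_at (next_point p) == side_at (string_at p) (~~ shade_of p)]) pts,
      all (fun p => all (fun q => (string_at p == string_at q) ==>
                    (sign_of p == sign_of q) ==> (p == q)) pts) pts,
      all (fun p => has (fun q => (string_at q == string_at p)
                               && (sign_of q == ~~ sign_of p)) pts) pts,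
      (let cl := classes nregions side_edges in
       all (fun l => l == nth 0 cl 0) cl)
    & (discs D).+1 + nregions.*2 == 2 + (discs D * c.1 + c0.1) + ncircles].

(** The inner discs may be indexed by any finite type in bijection with their
  numbers: gluing produces tangles whose discs are indexed by pairs. *)
Section Tangle.
Variables (I : finType) (num : I -> 'I_(discs D)).
Hypothesis num_bij : bijective num.
Hypothesis D_planar : planar_drawing.

Definition drawing_data : pretangle (fun _ : I => c) c0 :=
  @Pretangle I (fun=> c) c0 'I_(nstrings.-1.+1) 'I_(nregions.-1.+1)
    (fun i j => inord (string_at (num i * npts c + j)))
    (fun j => inord (string_at (base + j)))
    (fun i j => inord (region_at (num i * npts c + j)))
    (fun j => inord (region_at (base + j)))
    (fun l b => inord (side_at l b))
    (fun r => region_shade r).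

Let T := drawing_data.

Lemma npts_gt0 : 0 < npts c.
Proof. by case/andP: D_planar => /and5P[c1 _ _ _ _] _; rewrite double_gt0. Qed.

Lemma nstrings_gt0 : 0 < nstrings.
Proof. by case/andP: D_planar => /and5P[]. Qed.

Lemma nregions_gt0 : 0 < nregions.
Proof. by case/andP: D_planar => /and5P[]. Qed.

Lemma region_at_lt p : region_at p < nregions.
Proof.
case/andP: D_planar => /and5P[_ _ r0 _ /allP rlt] _; rewrite /region_at.
case: (ltnP p (size (regions D))) => pr; last by rewrite nth_default.
exact/rlt/mem_nth.
Qed.

Lemma side_at_lt l b : side_at l b < nregions.
Proof. exact: region_at_lt. Qed.

Lemma mem_points p : p < npoints -> p \in iota 0 npoints.
Proof. by rewrite mem_iota. Qed.

Lemma point_facts p : p < npoints ->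
  [/\ string_at p < nstrings,
      region_at p = side_at (string_at p) (shade_of p)
    & region_at (next_point p) = side_at (string_at p) (~~ shade_of p)].
Proof.
case/andP: D_planar => _ /andP[_ /andP[_ /andP[/allP H _]]] /mem_points/H.
by case/and3P => ? /eqP ? /eqP ?.
Qed.

Lemma nsegs_inner : nsegs c = npts c.
Proof. by rewrite prednK ?npts_gt0. Qed.

Definition point_code (p : point (fun _ : I => c) c0) : nat :=
  match p with
  | inl q => num (tag q) * npts c + tagged q
  | inr j => base + j
  end.

Definition segment_code (x : segment (fun _ : I => c) c0) : nat :=
  match x with
  | inl q => num (tag q) * npts c + tagged q
  | inr j => base + j
  end.

Lemma inner_lt (i : 'I_(discs D)) j : j < npts c -> i * npts c + j < base.
Proof.
move=> jm; apply: (@leq_trans (i.+1 * npts c)).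
  by rewrite mulSn addnC ltn_add2r.
by rewrite leq_mul2r ltn_ord orbT.
Qed.

Lemma inner_eq (i i' : 'I_(discs D)) j j' : j < npts c -> j' < npts c ->
  i * npts c + j = i' * npts c + j' -> i = i' /\ j = j'.
Proof.
move=> jm jm' E; have m0 := npts_gt0.
have := congr1 (divn^~ (npts c)) E; have := congr1 (modn^~ (npts c)) E.
rewrite /= !modnMDl !modn_small // !divnMDl // !divn_small // !addn0.
by move=> -> /val_inj.
Qed.

Lemma point_code_lt p : point_code p < npoints.
Proof.
case: p => [[i j]|j] /=; last by rewrite /npoints ltn_add2l.
by rewrite /npoints ltn_addr // inner_lt.
Qed.

Lemma inner_seg_lt (j : 'I_(nsegs c)) : j < npts c.
Proof. by apply: leq_trans (ltn_ord j) _; rewrite nsegs_inner. Qed.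

Lemma segment_code_lt p : segment_code p < nsegments.
Proof.
case: p => [[i j]|j] /=; last by rewrite /nsegments ltn_add2l.
by rewrite /nsegments ltn_addr // inner_lt // inner_seg_lt.
Qed.

Lemma num_inj : injective num.
Proof. exact: bij_inj. Qed.

Lemma inner_lt_base (i : 'I_(discs D)) (j : 'I_(npts c)) : (i * npts c + j < base) = true.
Proof. exact: inner_lt. Qed.

Lemma outer_lt_base j : (base + j < base) = false.
Proof. by rewrite ltnNge leq_addr. Qed.

Lemma point_code_inj : injective point_code.
Proof.
case=> [[i j]|j] [[i' j']|j'] /=.
- move=> /inner_eq[] // /num_inj ii'; move: j'; rewrite -ii' => j' jj'.
  by congr inl; congr Tagged; apply/val_inj.
- by move=> E; have := inner_lt_base (num i) j; rewrite E outer_lt_base.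
- by move=> E; have := inner_lt_base (num i') j'; rewrite -E outer_lt_base.
- by move=> /addnI/val_inj ->.
Qed.

Lemma segment_code_inj : injective segment_code.
Proof.
have lt := inner_seg_lt.
case=> [[i j]|j] [[i' j']|j'] /=.
- move=> /inner_eq[] // /num_inj ii'; move: j'; rewrite -ii' => j' jj'.
  by congr inl; congr Tagged; apply/val_inj.
- by move=> E; have := inner_lt (num i) (lt j); rewrite E outer_lt_base.
- by move=> E; have := inner_lt (num i') (lt j'); rewrite -E outer_lt_base.
- by move=> /addnI/val_inj ->.
Qed.

Lemma point_code_surj n : n < npoints -> exists p, point_code p = n.
Proof.
rewrite /npoints; case: (ltnP n base) => [nb _|bn].
  have m0 := npts_gt0.
  have id : n %/ npts c < discs D by rewrite ltn_divLR.
  have jm : n %% npts c < npts c by rewrite ltn_mod.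
  have [num' _ numK] := num_bij.
  exists (inl (@Tagged _ (num' (Ordinal id)) (fun=> 'I_(npts c)) (Ordinal jm))).
  by rewrite /= numK /= -divn_eq.
move=> nlt; have jm : n - base < npts c0 by rewrite ltn_subLR.
by exists (inr (Ordinal jm)); rewrite /= subnKC.
Qed.

Lemma odd_base : odd base = false.
Proof. by rewrite /base oddM odd_double andbF. Qed.

Lemma odd_inner i j : odd (i * npts c + j) = odd j.
Proof. by rewrite oddD oddM odd_double andbF. Qed.

Lemma shade_of_segment x : shade_seg x = shade_of (segment_code x).
Proof.
case: x => [[i j]|j] /=; rewrite /seg_shade /shade_of.
  by rewrite inner_lt ?odd_inner // inner_seg_lt.
by rewrite outer_lt_base oddD odd_base.
Qed.

Lemma shade_of_point p : shade_before p = shade_of (point_code p).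
Proof.
case: p => [[i j]|j] /=; rewrite /seg_shade /shade_of.
  by rewrite inner_lt ?odd_inner.
by rewrite outer_lt_base oddD odd_base.
Qed.

Lemma sign_of_point p : sign p = sign_of (point_code p).
Proof.
rewrite /sign_of -shade_of_point; case: p => [[i j]|j] /=.
  by rewrite inner_lt_base.
by rewrite outer_lt_base.
Qed.

Lemma segment_before p : segment_code (before p) = point_code p.
Proof. by case: p => [[i j]|j] /=; rewrite ?(@seg_beforeE c) ?seg_beforeE. Qed.

Lemma segment_after p : segment_code (after p) = next_point (point_code p).
Proof.
have succ_mod n j : j < n -> (if j.+1 == n then 0 else j.+1) = j.+1 %% n.
  by move=> jn; case: eqP => [->|?]; rewrite ?modnn // modn_small //; lia.
case: p => [[i j]|j] /=; rewrite /next_point ?inner_lt_base ?outer_lt_base.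
  have jm : j < npts c := ltn_ord j.
  rewrite (@seg_afterE c) succ_mod // divnMDl ?npts_gt0 // divn_small //.
  by rewrite addn0 modnMDl (modn_small jm).
by rewrite seg_afterE succ_mod // addKn.
Qed.

Lemma val_str n : n < nstrings -> (inord n : 'I_(nstrings.-1.+1)) = n :> nat.
Proof. by move=> lt; rewrite inordK // prednK // nstrings_gt0. Qed.

Lemma val_reg n : n < nregions -> (inord n : 'I_(nregions.-1.+1)) = n :> nat.
Proof. by move=> lt; rewrite inordK // prednK // nregions_gt0. Qed.

Lemma val_pt p : pt T p = string_at (point_code p) :> nat.
Proof.
have [lt _ _] := point_facts (point_code_lt p).
by case: p lt => [[i j]|j] lt; apply: val_str.
Qed.

Lemma val_seg x : seg T x = region_at (segment_code x) :> nat.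
Proof. by case: x => [[i j]|j]; apply/val_reg/region_at_lt. Qed.

Lemma val_side (l : str T) b : side l b = side_at l b :> nat.
Proof. exact/val_reg/side_at_lt. Qed.

Lemma str_lt (l : str T) : l < nstrings.
Proof. by apply: leq_trans (ltn_ord l) _; rewrite prednK ?nstrings_gt0. Qed.

Lemma reg_lt (r : reg T) : r < nregions.
Proof. by apply: leq_trans (ltn_ord r) _; rewrite prednK ?nregions_gt0. Qed.

Lemma drawing_seg x : shade (seg T x) = shade_seg x.
Proof.
rewrite /= val_seg shade_of_segment.
case/andP: D_planar => _ /andP[/allP H _]; apply/eqP/H.
by rewrite mem_iota segment_code_lt.
Qed.

Lemma drawing_side l b : shade (side l b : reg T) = b.
Proof.
rewrite /= val_side.
case/andP: D_planar => _ /andP[_ /andP[/allP H _]]; apply/eqP.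
have lm : (l : nat) \in iota 0 nstrings by rewrite mem_iota str_lt.
by have /allP := H _ lm; apply; rewrite !inE; case: b.
Qed.

Lemma drawing_before p : seg T (before p) = side (pt T p) (shade_before p).
Proof.
apply/val_inj; rewrite [LHS]val_seg [RHS]val_side val_pt segment_before.
by rewrite shade_of_point; have [_ ->] := point_facts (point_code_lt p).
Qed.

Lemma drawing_after p : seg T (after p) = side (pt T p) (~~ shade_before p).
Proof.
apply/val_inj; rewrite [LHS]val_seg [RHS]val_side val_pt segment_after.
by rewrite shade_of_point; have [_ _ ->] := point_facts (point_code_lt p).
Qed.

Lemma drawing_inj p q : pt T p = pt T q -> sign p = sign q -> p = q.
Proof.
move=> /(congr1 val); rewrite /= !val_pt !sign_of_point => pq spq.
apply: point_code_inj; apply/eqP; move: pq spq.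
case/andP: D_planar => _ /andP[_ /andP[_ /andP[_ /andP[/allP H _]]]].
have /allP/(_ _ (mem_points (point_code_lt q))) := H _ (mem_points (point_code_lt p)).
by move=> /implyP H1 /eqP /H1 /implyP H2 /eqP /H2.
Qed.

Lemma drawing_mate p : exists q, pt T q = pt T p /\ sign q = ~~ sign p.
Proof.
case/andP: D_planar => _ /andP[_ /andP[_ /andP[_ /andP[_ /andP[/allP H _]]]]].
have /hasP[n] := H _ (mem_points (point_code_lt p)).
rewrite mem_iota => /point_code_surj[q <-] /andP[/eqP pq /eqP spq].
exists q; rewrite !sign_of_point; split=> //.
by apply/val_inj; rewrite [LHS]val_pt [RHS]val_pt.
Qed.

Lemma drawing_connected (r r' : reg T) : connect (symrel (reg_edge T)) r r'.
Proof.
rewrite (@connect_classes _ _ (fun r : reg T => r : nat) nregions side_edges).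
- case/andP: D_planar => _ /andP[_ /andP[_ /andP[_ /andP[_ /andP[_ /andP[/allP H _]]]]]].
  have Hr (x : reg T) : class_of nregions side_edges x = class_of nregions side_edges 0.
    by apply/eqP/H/mem_nth; rewrite size_classes reg_lt.
  by rewrite !Hr.
- exact: val_inj.
- exact: reg_lt.
- move=> e /mapP[l]; rewrite mem_iota => ll ->.
  have ll' : l < nstrings.-1.+1 by rewrite prednK ?nstrings_gt0.
  exists (side (Ordinal ll' : str T) false), (side (Ordinal ll' : str T) true).
  by rewrite !val_side; split=> //; apply/existsP; exists (Ordinal ll'); rewrite !eqxx.
- move=> x y /existsP[l /andP[/eqP -> /eqP ->]].
  rewrite !val_side; apply: (map_f (fun l => (side_at l false, side_at l true))).
  by rewrite mem_iota str_lt.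
Qed.

Let node : finType := (segment (fun _ : I => c) c0 + str T * bool)%type.

Definition node_code (x : node) : nat :=
  match x with
  | inl x => segment_code x
  | inr lb => nsegments + (lb.1 : nat).*2 + lb.2
  end.

Lemma node_code_lt x : node_code x < nsegments + nstrings.*2.
Proof.
case: x => [x|[l b]] /=; first by rewrite ltn_addr // segment_code_lt.
by have := str_lt l; case: b => /=; lia.
Qed.

Lemma node_code_inj : injective node_code.
Proof.
case=> [x|[l b]] [y|[l' b']] /=.
- by move=> /segment_code_inj ->.
- by have := segment_code_lt x; lia.
- by have := segment_code_lt y; lia.
- move=> E; have bb : b = b' by case: b b' E => [] []; lia.
  by rewrite bb in E *; have -> : l = l' by apply/val_inj => /=; lia.
Qed.

Lemma circle_edge_before p :
  circle_edge (point_code p) false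
  = (node_code (inl (before p)), node_code (inr (pt T p, shade_before p))).
Proof. by rewrite /= segment_before val_pt shade_of_point /circle_edge addbF. Qed.

Lemma circle_edge_after p :
  circle_edge (point_code p) true
  = (node_code (inl (after p)), node_code (inr (pt T p, ~~ shade_before p))).
Proof. by rewrite /= segment_after val_pt shade_of_point /circle_edge addbT. Qed.

Lemma drawing_circles : boundary_circles T = ncircles.
Proof.
pose cl := classes (nsegments + nstrings.*2) circle_edges.
pose code (x : node) := class_of (nsegments + nstrings.*2) circle_edges (node_code x).
have codeP x : index (code x) (undup cl) < size (undup cl).
  by rewrite index_mem mem_undup mem_nth // size_classes node_code_lt.
pose f x : 'I_(size (undup cl)) := Ordinal (codeP x).
have fP x y : (f x = f y) <-> (code x = code y).
  split=> [/(congr1 val) /= xy|xy]; last by apply/val_inj; rewrite /= xy.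
  have mem z : code z \in undup cl by rewrite mem_undup mem_nth // size_classes node_code_lt.
  by rewrite -(nth_index 0 (mem x)) xy nth_index.
have es_ok x y : boundary_edge T x y -> (node_code x, node_code y) \in circle_edges.
  move=> /existsP[p /orP[] /andP[/eqP -> /eqP ->]]; rewrite mem_cat.
    apply/orP; left; rewrite -circle_edge_before.
    by apply: (map_f (circle_edge^~ false)); rewrite mem_iota point_code_lt.
  apply/orP; right; rewrite -circle_edge_after.
  by apply: (map_f (circle_edge^~ true)); rewrite mem_iota point_code_lt.
have conn x y : connect (symrel (boundary_edge T)) x y = (code x == code y).
  apply: connect_classes => //; [exact: node_code_inj|exact: node_code_lt|].
  move=> e; rewrite mem_cat => /orP[] /mapP[n]; rewrite mem_iota;
    move=> /point_code_surj[p <-] ->.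
    rewrite circle_edge_before; exists (inl (before p)), (inr (pt T p, shade_before p)).
    by split=> //; apply/existsP; exists p; rewrite !eqxx.
  rewrite circle_edge_after; exists (inl (after p)), (inr (pt T p, ~~ shade_before p)).
  by split=> //; apply/existsP; exists p; rewrite !eqxx orbT.
rewrite /boundary_circles (@n_comp_card _ _ _ f) ?card_ord //.
- by move=> x y xy; apply/fP/eqP; rewrite -conn; apply/connect1/orP; left.
- by move=> x y /fP xy; rewrite conn xy.
- move=> b.
  have /(nthP 0)[n] : nth 0 (undup cl) b \in cl by rewrite -mem_undup mem_nth.
  rewrite size_classes => nlt nE.
  suff [x xE] : exists x : node, node_code x = n.
    exists x; apply/val_inj; rewrite /= /code xE /class_of -/cl nE.
    by rewrite index_uniq ?undup_uniq.
  case: (ltnP n nsegments) => nseg.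
    case: (ltnP n base) => nb.
      have [|p pE] := @point_code_surj n; first by rewrite /npoints ltn_addr.
      by exists (inl (before p)); rewrite /= segment_before.
    have jm : n - base < nsegs c0 by rewrite ltn_subLR.
    by exists (inl (inr (Ordinal jm))); rewrite /= subnKC.
  have lm : (n - nsegments)./2 < nstrings.-1.+1.
    by rewrite prednK ?nstrings_gt0 // ltn_half_double ltn_subLR.
  exists (inr (Ordinal lm, odd (n - nsegments))) => /=.
  have := odd_double_half (n - nsegments); lia.
Qed.

Lemma drawing_planar : planar T.
Proof.
split.
- exact: drawing_seg.
- exact: drawing_side.
- exact: drawing_before.
- exact: drawing_after.
- exact: drawing_inj.
- exact: drawing_mate.
- exact: drawing_connected.
- rewrite drawing_circles sum_nat_const card_ord (bij_eq_card num_bij) card_ord.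
  rewrite (prednK nregions_gt0) mul2n.
  by case/andP: D_planar => _ /andP[_ /andP[_ /andP[_ /andP[_ /andP[_ /andP[_ /eqP]]]]]].
Qed.

Definition drawing_tangle : tangle (fun _ : I => c) c0 := Tangle drawing_planar.

End Tangle.
End Shape.

(** * Gluing of drawings *)

Record diagram (c c0 : color) := Diagram {
  picture :> drawing;
  pictureP : planar_drawing c c0 picture
}.

Definition tangle_of (c c0 : color) (D : diagram c c0) (I : finType)
    (num : I -> 'I_(discs D)) (num_bij : bijective num) :
    tangle (fun _ : I => c) c0 :=
  drawing_tangle num_bij (pictureP D).

Arguments tangle_of {c c0} D {I num} num_bij.

Lemma id_bij (T : Type) : bijective (@id T).
Proof. by exists id. Qed.

Lemma inj_surj_bij (A B : finType) (f : A -> B) :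
  injective f -> (forall b, exists a, f a = b) -> bijective f.
Proof.
move=> f_inj f_surj; apply: inj_card_bij => //.
rewrite -(card_codom f_inj); apply/subset_leq_card/subsetP => b _.
by have [a <-] := f_surj b; apply: codom_f.
Qed.

(** The discs of T are filled with the drawings Ss and the outcome is compared
  with U; the entry number a of the list number i of [dss] is the disc of U in
  which the disc a of the drawing number i ends up.  The strings of T and of the
  drawings Ss are numbered consecutively, with a constant stride for the latter,
  and the classes of glued strings are computed.  Every boundary point of U comes
  from a point of one of these drawings ([string_origin]), which tells the string
  of U that belongs to each class; likewise for regions. *)
Section GlueCheck.
Variables (c' c c0 : color) (T : drawing) (Ss : seq drawing) (dss : seq (seq nat)).
Variables (U : drawing).

Let S i := nth U Ss i.
Let disc_in i a := nth 0 (nth [::] dss i) a.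

Definition pre_string i l :=
  nstrings T + i * foldr maxn 0 (map nstrings Ss) + l.
Definition pre_region i r :=
  nregions T + i * foldr maxn 0 (map nregions Ss) + r.

Definition location d :=
  let i := find (fun ds => d \in ds) dss in (i, index d (nth [::] dss i)).
Definition string_origin p :=
  if p < base c' U then
    let: (i, a) := location (p %/ npts c') in
    pre_string i (string_at (S i) (a * npts c' + p %% npts c'))
  else string_at T (base c T + (p - base c' U)).
Definition region_origin p :=
  if p < base c' U then
    let: (i, a) := location (p %/ npts c') in
    pre_region i (region_at (S i) (a * npts c' + p %% npts c'))
  else region_at T (base c T + (p - base c' U)).

Definition glued_strings :=
  [seq (string_at T (i * npts c + j),
        pre_string i (string_at (S i) (base c' (S i) + j)))
     | i <- iota 0 (discs T), j <- iota 0 (npts c)].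
Definition glued_regions :=
  [seq (region_at T (i * npts c + j),
        pre_region i (region_at (S i) (base c' (S i) + j)))
     | i <- iota 0 (discs T), j <- iota 0 (npts c)].
Definition string_classes :=
  classes (pre_string (discs T) 0) glued_strings.
Definition region_classes :=
  classes (pre_region (discs T) 0) glued_regions.

Definition pre_strings :=
  iota 0 (nstrings T)
  ++ [seq pre_string i l | i <- iota 0 (discs T), l <- iota 0 (nstrings (S i))].
Definition pre_regions :=
  iota 0 (nregions T)
  ++ [seq pre_region i r | i <- iota 0 (discs T), r <- iota 0 (nregions (S i))].

Definition string_names (cl : seq nat) :=
  [seq nth 0 cl (string_origin l.1) | l <- strings U].
Definition region_names (cl : seq nat) :=
  [seq nth 0 cl (region_origin (index r (regions U))) | r <- iota 0 (nregions U)].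

Definition discs_check : bool :=
  [&& (size Ss == discs T) && (map size dss == map discs Ss),
      all (fun i => all (fun a =>
        (disc_in i a < discs U) && (location (disc_in i a) == (i, a)))
        (iota 0 (discs (S i)))) (iota 0 (discs T))
    & all (fun d => let: (i, a) := location d in
        [&& i < discs T, a < discs (S i) & disc_in i a == d]) (iota 0 (discs U))].

Definition names_check (cl names pre : seq nat) : bool :=
  [&& uniq names, all (fun x => nth 0 cl x \in names) pre
    & all (fun n => n \in [seq nth 0 cl x | x <- pre]) names].

Definition glue_check_with (clS clR nmS nmR : seq nat) : bool :=
  [&& discs_check, names_check clS nmS pre_strings, names_check clR nmR pre_regions,
      all (fun p => nth 0 clS (string_origin p) == nth 0 nmS (string_at U p))
          (iota 0 (npoints c' c0 U)),
      all (fun p => nth 0 clR (region_origin p) == nth 0 nmR (region_at U p))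
          (iota 0 (nsegments c' c0 U)),
      all (fun l => all (fun b =>
             index (nth 0 clR (side_at c c0 T l b)) nmR
             == side_at c' c0 U (index (nth 0 clS l) nmS) b) [:: false; true])
          (iota 0 (nstrings T))
    & all (fun i => all (fun l => all (fun b =>
             index (nth 0 clR (pre_region i (side_at c' c (S i) l b))) nmR
             == side_at c' c0 U (index (nth 0 clS (pre_string i l)) nmS) b)
             [:: false; true]) (iota 0 (nstrings (S i)))) (iota 0 (discs T))].

Definition glue_check : bool :=
  let clS := string_classes in let clR := region_classes in
  glue_check_with clS clR (string_names clS) (region_names clR).

End GlueCheck.

Section Gluing.
Variables (c' c c0 : color) (T : diagram c c0) (D0 : diagram c' c).
Variables (Ss : seq (diagram c' c)) (dss : seq (seq nat)) (U : diagram c' c0).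
Hypothesis TSU : glue_check c' c c0 T (map (@picture _ _) Ss) dss U.

Let pics := map (@picture c' c) Ss.
Let clS := string_classes c' c T pics U.
Let clR := region_classes c' c T pics U.
Let nmS := string_names c' c T pics dss U clS.
Let nmR := region_names c' c T pics dss U clR.
Let S (i : 'I_(discs T)) := nth D0 Ss i.
Let disc_in i a := nth 0 (nth [::] dss i) a.

Let TSU' : glue_check_with c' c c0 T pics dss U clS clR nmS nmR := TSU.

Let picsE (i : 'I_(discs T)) : nth (picture U) pics i = S i.
Proof.
case/and3P: TSU' => /and3P[/andP[/eqP szS _] _ _] _ _; rewrite (nth_map D0) //.
by rewrite -(size_map (@picture c' c)) szS.
Qed.

Definition glued_disc_subproof (x : {i : 'I_(discs T) & 'I_(discs (S i))}) :
  disc_in (tag x) (tagged x) < discs U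
  /\ location dss (disc_in (tag x) (tagged x)) = (tag x : nat, tagged x : nat).
Proof.
case/and3P: TSU' => /and3P[_ /allP H _] _ _; case: x => i a /=.
have im : (i : nat) \in iota 0 (discs T) by rewrite mem_iota ltn_ord.
have /allP/(_ a) := H _ im.
rewrite mem_iota picsE ltn_ord => /(_ isT) /andP[? /eqP ?]; split=> //.
Qed.

Definition glued_disc (x : {i : 'I_(discs T) & 'I_(discs (S i))}) : 'I_(discs U) :=
  Ordinal (glued_disc_subproof x).1.

Lemma glued_disc_bij : bijective glued_disc.
Proof.
apply: inj_surj_bij => [x y /(congr1 val) /= xy|d].
  have := (glued_disc_subproof x).2; rewrite xy (glued_disc_subproof y).2.
  case: x y {xy} => i a [i' a'] /= [/val_inj ii]; move: a; rewrite -ii => a /val_inj ->.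
  by [].
case/and3P: TSU' => /and3P[_ _ /allP H] _ _.
have := H d; rewrite mem_iota ltn_ord => /(_ isT).
case: location => i a /and3P[iT aS /eqP dE].
have {aS}aS : a < discs (S (Ordinal iT)) by rewrite -picsE.
exists (Tagged (fun i => 'I_(discs (S i))) (Ordinal aS)).
by apply/val_inj; rewrite /= -[RHS]dE.
Qed.

Let S' (i : 'I_(discs T)) := tangle_of (S i) (id_bij _).
Let T' := tangle_of T (id_bij _).
Let U' := tangle_of U glued_disc_bij.

Let prestr := pre_str T' S'.
Let prereg := pre_reg T' S'.

Let pstr i l := pre_string T pics i l.
Let preg i r := pre_region T pics i r.

Definition pre_str_code (x : prestr) : nat :=
  match x with inl l => l | inr q => pstr (tag q) (tagged q : str (S' (tag q))) end.
Definition pre_reg_code (x : prereg) : nat :=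
  match x with inl l => l | inr q => preg (tag q) (tagged q : reg (S' (tag q))) end.

Let in_strS i (l : str (S' i)) : prestr := inr (Tagged (fun i => str (S' i)) l).
Let in_regS i (l : reg (S' i)) : prereg := inr (Tagged (fun i => reg (S' i)) l).
Let strT_code (l : str T') : pre_str_code (inl l) = l.
Proof. by []. Qed.
Let strS_code i (l : str (S' i)) : pre_str_code (in_strS l) = pstr i l.
Proof. by []. Qed.
Let regT_code (l : reg T') : pre_reg_code (inl l) = l.
Proof. by []. Qed.
Let regS_code i (l : reg (S' i)) : pre_reg_code (in_regS l) = preg i l.
Proof. by []. Qed.

Let strT_lt (l : str T') : l < nstrings T.
Proof. exact: str_lt (pictureP T) l. Qed.
Let strS_lt i (l : str (S' i)) : l < nstrings (S i).
Proof. exact: str_lt (pictureP (S i)) l. Qed.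
Let regT_lt (l : reg T') : l < nregions T.
Proof. exact: reg_lt (pictureP T) l. Qed.
Let regS_lt i (l : reg (S' i)) : l < nregions (S i).
Proof. exact: reg_lt (pictureP (S i)) l. Qed.

Let foldr_max (f : drawing -> nat) i : f (S i) <= foldr maxn 0 (map f pics).
Proof.
rewrite -picsE; have : i < size pics by case/and3P: TSU' => /and3P[/andP[/eqP -> _] _ _] _ _.
elim: pics (i : nat) => //= D Ds IH [|k] //= kn; first exact: leq_maxl.
by apply: leq_trans (IH k kn) _; exact: leq_maxr.
Qed.

Let code_inj (f : drawing -> nat) (B n : nat) (i i' l l' : nat) :
  l < B -> l' < B -> n + i * B + l = n + i' * B + l' -> i = i' /\ l = l'.
Proof.
move=> lB l'B; rewrite -!addnA => /addnI E; have B0 : 0 < B by lia.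
have := congr1 (divn^~ B) E; have := congr1 (modn^~ B) E.
by rewrite /= !modnMDl !modn_small // !divnMDl // !divn_small // !addn0.
Qed.

Lemma pre_str_code_inj : injective pre_str_code.
Proof.
have lt i (l : str (S' i)) : l < foldr maxn 0 (map nstrings pics).
  exact: leq_trans (strS_lt l) (foldr_max nstrings i).
case=> [l|[i l]] [l'|[i' l']] /=; rewrite /pstr /pre_string.
- by move=> /val_inj ->.
- by have := strT_lt l; lia.
- by have := strT_lt l'; lia.
- move=> /(code_inj nstrings (lt _ _) (lt _ _))[/val_inj ii].
  by move: l'; rewrite -ii => l' /val_inj ->.
Qed.

Lemma pre_reg_code_inj : injective pre_reg_code.
Proof.
have lt i (l : reg (S' i)) : l < foldr maxn 0 (map nregions pics).
  exact: leq_trans (regS_lt l) (foldr_max nregions i).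
case=> [l|[i l]] [l'|[i' l']] /=; rewrite /preg /pre_region.
- by move=> /val_inj ->.
- by have := regT_lt l; lia.
- by have := regT_lt l'; lia.
- move=> /(code_inj nregions (lt _ _) (lt _ _))[/val_inj ii].
  by move: l'; rewrite -ii => l' /val_inj ->.
Qed.

Let code_lt (B n k i l : nat) : i < k -> l < B -> n + i * B + l < n + k * B + 0.
Proof.
move=> ik lB; rewrite addn0 -addnA ltn_add2l.
apply: (@leq_trans (i.+1 * B)); first by rewrite mulSn addnC ltn_add2r.
by rewrite leq_mul2r ik orbT.
Qed.

Lemma pre_str_code_lt x : pre_str_code x < pre_string T pics (discs T) 0.
Proof.
case: x => [l|[i l]] /=; rewrite /pstr /pre_string; first by have := strT_lt l; lia.
by apply: code_lt => //; apply: leq_trans (strS_lt l) (foldr_max nstrings i).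
Qed.

Lemma pre_reg_code_lt x : pre_reg_code x < pre_region T pics (discs T) 0.
Proof.
case: x => [l|[i l]] /=; rewrite /preg /pre_region; first by have := regT_lt l; lia.
by apply: code_lt => //; apply: leq_trans (regS_lt l) (foldr_max nregions i).
Qed.

Lemma mem_pre_strings n :
  n \in pre_strings T pics U -> exists x, pre_str_code x = n.
Proof.
rewrite mem_cat mem_iota /= => /orP[nT|/allpairsPdep[i [l []]]].
  by exists (inl (inord n : str T')); rewrite /= (val_str (pictureP T)).
rewrite !mem_iota => /= iT lS ->.
rewrite (picsE (Ordinal iT)) in lS.
exists (inr (Tagged (fun i => str (S' i)) (inord l : str (S' (Ordinal iT))))).
by rewrite /= /pstr (val_str (pictureP (S (Ordinal iT)))).
Qed.

Lemma mem_pre_regions n :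
  n \in pre_regions T pics U -> exists x, pre_reg_code x = n.
Proof.
rewrite mem_cat mem_iota /= => /orP[nT|/allpairsPdep[i [l []]]].
  by exists (inl (inord n : reg T')); rewrite /= (val_reg (pictureP T)).
rewrite !mem_iota => /= iT lS ->.
rewrite (picsE (Ordinal iT)) in lS.
exists (inr (Tagged (fun i => reg (S' i)) (inord l : reg (S' (Ordinal iT))))).
by rewrite /= /preg (val_reg (pictureP (S (Ordinal iT)))).
Qed.

Lemma pre_strings_mem x : pre_str_code x \in pre_strings T pics U.
Proof.
rewrite mem_cat; case: x => [l|[i l]] /=; first by rewrite mem_iota strT_lt.
apply/orP; right; apply/allpairsPdep; exists (i : nat), (l : nat).
by rewrite picsE !mem_iota ltn_ord strS_lt.
Qed.

Lemma pre_regions_mem x : pre_reg_code x \in pre_regions T pics U.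
Proof.
rewrite mem_cat; case: x => [l|[i l]] /=; first by rewrite mem_iota regT_lt.
apply/orP; right; apply/allpairsPdep; exists (i : nat), (l : nat).
by rewrite picsE !mem_iota ltn_ord regS_lt.
Qed.

Let iptT i (j : 'I_(npts c)) : ipt T' (i := i) j = string_at T (i * npts c + j) :> nat.
Proof.
exact: (val_pt id (pictureP T)
  (inl (@Tagged _ i (fun=> 'I_(npts c)) j))).
Qed.
Let optS i (j : 'I_(npts c)) : opt (S' i) j = string_at (S i) (base c' (S i) + j) :> nat.
Proof. exact: (val_pt id (pictureP (S i)) (inr j)). Qed.
Let isegT i (j : 'I_(nsegs c)) : iseg T' (i := i) j = region_at T (i * npts c + j) :> nat.
Proof.
exact: (val_seg id (pictureP T)
  (inl (@Tagged _ i (fun=> 'I_(nsegs c)) j))).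
Qed.
Let osegS i (j : 'I_(nsegs c)) : oseg (S' i) j = region_at (S i) (base c' (S i) + j) :> nat.
Proof. exact: (val_seg id (pictureP (S i)) (inr j)). Qed.

Lemma glue_str_connect x y :
  connect (symrel (@glue_str_edge _ _ _ _ (fun _ _ => c') T' S')) x y
  = (nth 0 clS (pre_str_code x) == nth 0 clS (pre_str_code y)).
Proof.
apply: (@connect_classes _ _ pre_str_code) => {x y}.
- exact: pre_str_code_inj.
- exact: pre_str_code_lt.
- move=> e /allpairsP[[i j]] [/=]; rewrite !mem_iota /= => iT jm ->.
  exists (inl (ipt T' (i := Ordinal iT) (Ordinal jm))).
  exists (in_strS (opt (S' (Ordinal iT)) (Ordinal jm))).
  rewrite strT_code strS_code iptT optS; split=> //.
    by rewrite -(picsE (Ordinal iT)).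
  apply/existsP; exists (Ordinal iT); apply/existsP; exists (Ordinal jm).
  by rewrite !eqxx.
- move=> x y /existsP[i /existsP[j /andP[/eqP -> /eqP ->]]].
  rewrite strT_code [pre_str_code _]strS_code iptT optS -picsE.
  apply/allpairsP; exists (i : nat, j : nat); split=> //=; rewrite mem_iota //=.
Qed.

Lemma glue_reg_connect x y :
  connect (symrel (@glue_reg_edge _ _ _ _ (fun _ _ => c') T' S')) x y
  = (nth 0 clR (pre_reg_code x) == nth 0 clR (pre_reg_code y)).
Proof.
have segs := nsegs_inner (pictureP T).
apply: (@connect_classes _ _ pre_reg_code) => {x y}.
- exact: pre_reg_code_inj.
- exact: pre_reg_code_lt.
- move=> e /allpairsP[[i j]] [/=]; rewrite !mem_iota /= => iT jm ->.
  have {}jm : j < nsegs c by rewrite segs.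
  exists (inl (iseg T' (i := Ordinal iT) (Ordinal jm))).
  exists (in_regS (oseg (S' (Ordinal iT)) (Ordinal jm))).
  rewrite regT_code regS_code isegT osegS; split=> //.
    by rewrite -(picsE (Ordinal iT)).
  apply/existsP; exists (Ordinal iT); apply/existsP; exists (Ordinal jm).
  by rewrite !eqxx.
- move=> x y /existsP[i /existsP[j /andP[/eqP -> /eqP ->]]].
  rewrite regT_code [pre_reg_code _]regS_code isegT osegS -picsE.
  apply/allpairsP; exists (i : nat, j : nat); split=> //=; rewrite mem_iota //=.
  exact: (inner_seg_lt (pictureP T)).
Qed.

Let checkS : names_check clS nmS (pre_strings T pics U).
Proof. by case/and3P: TSU'. Qed.
Let checkR : names_check clR nmR (pre_regions T pics U).
Proof. by case/andP: TSU' => _ /and3P[]. Qed.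

Let size_nmS : size nmS = nstrings U. Proof. by rewrite size_map. Qed.
Let size_nmR : size nmR = nregions U. Proof. by rewrite size_map size_iota. Qed.

Definition glue_str (x : prestr) : str U' :=
  inord (index (nth 0 clS (pre_str_code x)) nmS).
Definition glue_reg (x : prereg) : reg U' :=
  inord (index (nth 0 clR (pre_reg_code x)) nmR).

Let str_name x : nth 0 clS (pre_str_code x) \in nmS.
Proof. by case/and3P: checkS => _ /allP H _; apply/H/pre_strings_mem. Qed.
Let reg_name x : nth 0 clR (pre_reg_code x) \in nmR.
Proof. by case/and3P: checkR => _ /allP H _; apply/H/pre_regions_mem. Qed.

Lemma val_glue_str x : glue_str x = index (nth 0 clS (pre_str_code x)) nmS :> nat.
Proof. by rewrite (val_str (pictureP U)) // -size_nmS index_mem. Qed.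
Lemma val_glue_reg x : glue_reg x = index (nth 0 clR (pre_reg_code x)) nmR :> nat.
Proof. by rewrite (val_reg (pictureP U)) // -size_nmR index_mem. Qed.

Lemma glue_strE x y :
  (glue_str x == glue_str y)
  = connect (symrel (@glue_str_edge _ _ _ _ (fun _ _ => c') T' S')) x y.
Proof.
rewrite glue_str_connect -(inj_eq val_inj) [val _]val_glue_str [X in _ == X]val_glue_str.
apply/eqP/eqP => [xy|-> //]; rewrite -(nth_index 0 (str_name x)) xy nth_index //.
Qed.
Lemma glue_regE x y :
  (glue_reg x == glue_reg y)
  = connect (symrel (@glue_reg_edge _ _ _ _ (fun _ _ => c') T' S')) x y.
Proof.
rewrite glue_reg_connect -(inj_eq val_inj) [val _]val_glue_reg [X in _ == X]val_glue_reg.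
apply/eqP/eqP => [xy|-> //]; rewrite -(nth_index 0 (reg_name x)) xy nth_index //.
Qed.

Lemma glue_str_surj l : exists x, glue_str x = l.
Proof.
have lU : l < size nmS by rewrite size_nmS; apply: str_lt (pictureP U) l.
case/and3P: checkS => uniqS _ /allP/(_ _ (mem_nth 0 lU)) /mapP[n].
move=> /mem_pre_strings[x <-] lE; exists x; apply/val_inj.
by rewrite [LHS]val_glue_str -lE index_uniq.
Qed.
Lemma glue_reg_surj l : exists x, glue_reg x = l.
Proof.
have lU : l < size nmR by rewrite size_nmR; apply: reg_lt (pictureP U) l.
case/and3P: checkR => uniqR _ /allP/(_ _ (mem_nth 0 lU)) /mapP[n].
move=> /mem_pre_regions[x <-] lE; exists x; apply/val_inj.
by rewrite [LHS]val_glue_reg -lE index_uniq.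
Qed.

Let point_ok p x : p < npoints c' c0 U ->
  pre_str_code x = string_origin c' c T pics dss U p ->
  glue_str x = string_at U p :> nat.
Proof.
move=> pU xE; rewrite val_glue_str xE.
case/andP: TSU' => _ /and3P[_ _ /andP[/allP H _]].
have [lt _ _] := point_facts (pictureP U) pU.
rewrite (eqP (H _ (mem_points pU))) index_uniq ?size_nmS //.
by case/and3P: checkS.
Qed.

Let segment_ok p x : p < nsegments c' c0 U ->
  pre_reg_code x = region_origin c' c T pics dss U p ->
  glue_reg x = region_at U p :> nat.
Proof.
move=> pU xE; rewrite val_glue_reg xE.
case/andP: TSU' => _ /and3P[_ _ /andP[_ /andP[/allP H _]]].
rewrite (eqP (H p _)) ?mem_iota // index_uniq ?size_nmR //.
  exact: region_at_lt (pictureP U) p.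
by case/and3P: checkR.
Qed.

Let side_ok_T (l : str T') b :
  side (glue_str (inl l)) b = glue_reg (inl (side l b)).
Proof.
apply/val_inj; rewrite [LHS](val_side (pictureP U)) [RHS]val_glue_reg val_glue_str.
rewrite strT_code regT_code (val_side (pictureP T)).
case/andP: TSU' => _ /and3P[_ _ /and4P[_ _ /allP H _]].
have lm : (l : nat) \in iota 0 (nstrings T) by rewrite mem_iota strT_lt.
by have /allP/(_ b) := H _ lm; rewrite !inE; case: b => /(_ isT) /eqP ->.
Qed.

Let side_ok_S i (l : str (S' i)) b :
  side (glue_str (in_strS l)) b = glue_reg (in_regS (side l b)).
Proof.
apply/val_inj; rewrite [LHS](val_side (pictureP U)) [RHS]val_glue_reg val_glue_str.
rewrite strS_code regS_code (val_side (pictureP (S i))).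
case/andP: TSU' => _ /and3P[_ _ /and4P[_ _ _ /allP H]].
have im : (i : nat) \in iota 0 (discs T) by rewrite mem_iota ltn_ord.
have /allP := H _ im; rewrite picsE => {}H.
have lm : (l : nat) \in iota 0 (nstrings (S i)) by rewrite mem_iota strS_lt.
by have /allP/(_ b) := H _ lm; rewrite !inE; case: b => /(_ isT) /eqP ->.
Qed.

Let string_origin_inner q j : j < npts c' ->
  string_origin c' c T pics dss U (glued_disc q * npts c' + j)
  = pstr (tag q) (string_at (S (tag q)) (tagged q * npts c' + j)).
Proof.
move=> jm; have mU := npts_gt0 (pictureP U); rewrite /string_origin.
rewrite inner_lt // divnMDl // divn_small // addn0 modnMDl modn_small //.
by rewrite (glued_disc_subproof q).2 picsE.
Qed.

Let region_origin_inner q j : j < npts c' ->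
  region_origin c' c T pics dss U (glued_disc q * npts c' + j)
  = preg (tag q) (region_at (S (tag q)) (tagged q * npts c' + j)).
Proof.
move=> jm; have mU := npts_gt0 (pictureP U); rewrite /region_origin.
rewrite inner_lt // divnMDl // divn_small // addn0 modnMDl modn_small //.
by rewrite (glued_disc_subproof q).2 picsE.
Qed.

Lemma drawing_gluing : @gluing _ _ _ c0 (fun _ _ => c') T' S' U'.
Proof.
exists glue_str, glue_reg; split.
- by split; [exact: glue_str_surj|exact: glue_reg_surj].
- by split; [exact: glue_strE|exact: glue_regE].
- split=> [q j|j]; apply/val_inj/esym.
    pose p := inl (@Tagged _ q (fun=> 'I_(npts c')) j) : point (fun=> c') c0.
    rewrite [RHS](val_pt glued_disc (pictureP U) p); apply: point_ok.
      exact: (point_code_lt glued_disc p).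
    rewrite strS_code string_origin_inner //.
    by rewrite (val_pt id (pictureP (S (tag q)))
      (inl (@Tagged _ (tagged q) (fun=> 'I_(npts c')) j))).
  pose p : point (fun _ : {i : 'I_(discs T) & 'I_(discs (S i))} => c') c0 := inr j.
  rewrite [RHS](val_pt glued_disc (pictureP U) p); apply: point_ok.
    exact: (point_code_lt glued_disc p).
  rewrite strT_code (val_pt id (pictureP T) (inr j)) /string_origin.
  by rewrite outer_lt_base addKn.
- split=> [q j|j]; apply/val_inj/esym.
    pose p := inl (@Tagged _ q (fun=> 'I_(nsegs c')) j) : segment (fun=> c') c0.
    rewrite [RHS](val_seg glued_disc (pictureP U) p); apply: segment_ok.
      exact: (segment_code_lt glued_disc (pictureP U) p).
    rewrite regS_code region_origin_inner; last exact: inner_seg_lt (pictureP U) j.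
    by rewrite (val_seg id (pictureP (S (tag q)))
      (inl (@Tagged _ (tagged q) (fun=> 'I_(nsegs c')) j))).
  pose p : segment (fun _ : {i : 'I_(discs T) & 'I_(discs (S i))} => c') c0 := inr j.
  rewrite [RHS](val_seg glued_disc (pictureP U) p); apply: segment_ok.
    exact: (segment_code_lt glued_disc (pictureP U) p).
  rewrite regT_code (val_seg id (pictureP T) (inr j)) /region_origin.
  by rewrite outer_lt_base addKn.
- by split; [exact: side_ok_T|exact: side_ok_S].
Qed.

End Gluing.

(** * Reflection and evaluation of drawings *)

Section Reflection.
Variables (c c0 : color) (D D' : drawing).

Definition rev_point p :=
  if p < base c D then p %/ npts c * npts c + (npts c - (p %% npts c).+1)
  else base c D + (npts c0 - (p - base c D).+1).
Definition rev_segment p :=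
  if p < base c D then p %/ npts c * npts c + (npts c - p %% npts c) %% npts c
  else base c D + (npts c0 - (p - base c D)) %% npts c0.

Definition reflected_string l :=
  string_at D' (rev_point (nth (0, 0) (strings D) l).1).
Definition reflected_region r :=
  region_at D' (rev_segment (index r (regions D))).

Definition reflect_check : bool :=
  [&& discs D == discs D',
      (nstrings D == nstrings D') && (nregions D == nregions D'),
      uniq [seq reflected_string l | l <- iota 0 (nstrings D)]
      && all (fun l => reflected_string l < nstrings D) (iota 0 (nstrings D)),
      uniq [seq reflected_region r | r <- iota 0 (nregions D)],
      all (fun p => string_at D' p == reflected_string (string_at D (rev_point p)))
          (iota 0 (npoints c c0 D)),
      all (fun p => region_at D' p == reflected_region (region_at D (rev_segment p)))
          (iota 0 (nsegments c c0 D))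
    & all (fun l => all (fun b => side_at c c0 D' (reflected_string l) b
                               == reflected_region (side_at c c0 D l b))
                        [:: false; true]) (iota 0 (nstrings D))].
End Reflection.

Section ReflectionSound.
Variables (c c0 : color) (D D' : diagram c c0).
Hypothesis DD' : reflect_check c c0 D D'.

Lemma reflect_discs : discs D = discs D'.
Proof. by apply/eqP; case/andP: DD'. Qed.

Lemma cast_bij : bijective (cast_ord reflect_discs).
Proof. by exists (cast_ord (esym reflect_discs)); [exact: cast_ordK|exact: cast_ordKV]. Qed.

Let T := tangle_of D (id_bij _).
Let T' := tangle_of D' cast_bij.

Definition reflect_str (l : str T) : str T' := inord (reflected_string c c0 D D' l).
Definition reflect_reg (r : reg T) : reg T' := inord (reflected_region c c0 D D' r).

Lemma val_reflect_str l : reflect_str l = reflected_string c c0 D D' l :> nat.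
Proof.
apply: (val_str (pictureP D')).
case/and5P: DD' => _ /andP[/eqP <- _] /andP[_ /allP H] _ _; apply: H.
by rewrite mem_iota (str_lt (pictureP D)).
Qed.

Lemma val_reflect_reg l : reflect_reg l = reflected_region c c0 D D' l :> nat.
Proof. exact: (val_reg (pictureP D')) (region_at_lt (pictureP D') _). Qed.

Let uniq_inj (f : nat -> nat) n : uniq [seq f l | l <- iota 0 n] ->
  {in gtn n &, injective f}.
Proof.
move=> un x y xn yn /eqP.
have fE z : z < n -> f z = nth 0 [seq f l | l <- iota 0 n] z.
  by move=> zn; rewrite (nth_map 0) ?size_iota // nth_iota.
by rewrite !fE // nth_uniq ?size_map ?size_iota // => /eqP.
Qed.

Lemma reflect_str_bij : bijective reflect_str.
Proof.
case/and5P: DD' => _ /andP[/eqP szE _] /andP[/uniq_inj inj _] _ _.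
apply: inj_card_bij; last by rewrite !card_ord szE.
move=> x y /(congr1 val); rewrite /= !val_reflect_str => /inj H.
by apply/val_inj/H; exact: (str_lt (pictureP D)).
Qed.

Lemma reflect_reg_bij : bijective reflect_reg.
Proof.
case/and5P: DD' => _ /andP[_ /eqP szE] _ /uniq_inj inj _.
apply: inj_card_bij; last by rewrite !card_ord szE.
move=> x y /(congr1 val); rewrite /= !val_reflect_reg => /inj H.
by apply/val_inj/H; exact: (reg_lt (pictureP D)).
Qed.

Let baseE : base c D = base c D'. Proof. by rewrite /base reflect_discs. Qed.

Let m0 := npts_gt0 (pictureP D).

Let rev_inner (i : 'I_(discs D)) (j : 'I_(npts c)) :
  rev_point c c0 D (i * npts c + j) = i * npts c + rev_pt j.
Proof.
by rewrite /rev_point inner_lt // divnMDl // divn_small // addn0 modnMDl modn_small.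
Qed.
Let rev_outer (j : 'I_(npts c0)) :
  rev_point c c0 D (base c D + j) = base c D + rev_pt j.
Proof. by rewrite /rev_point outer_lt_base addKn. Qed.
Let rev_segE (cc : color) (j : 'I_(nsegs cc)) : rev_seg j = (npts cc - j) %% npts cc :> nat.
Proof.
apply: inordK; move: (nat_of_ord j) => {}j.
case: (npts cc) => [|n] //=; by rewrite ?modn0 ?sub0n ?ltn_mod.
Qed.
Let rev_inner_seg (i : 'I_(discs D)) (j : 'I_(nsegs c)) :
  rev_segment c c0 D (i * npts c + j) = i * npts c + rev_seg j.
Proof.
have jm := inner_seg_lt (pictureP D) j.
by rewrite /rev_segment inner_lt // divnMDl // divn_small // addn0 modnMDl (modn_small jm) rev_segE.
Qed.
Let rev_outer_seg (j : 'I_(nsegs c0)) :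
  rev_segment c c0 D (base c D + j) = base c D + rev_seg j.
Proof. by rewrite /rev_segment outer_lt_base addKn rev_segE. Qed.

Lemma drawing_reflection : reflection T T'.
Proof.
case/and5P: DD' => _ _ _ _ /and3P[/allP pts /allP segs /allP sides].
exists reflect_str, reflect_reg; split.
- exact: reflect_str_bij.
- exact: reflect_reg_bij.
- split=> [i j|j]; apply/val_inj; rewrite [RHS]val_reflect_str.
    rewrite [LHS](val_pt (cast_ord reflect_discs) (pictureP D')
      (inl (@Tagged _ i (fun=> 'I_(npts c)) j))).
    rewrite (val_pt id (pictureP D) (inl (@Tagged _ i (fun=> 'I_(npts c)) (rev_pt j)))).
    rewrite /= -rev_inner; apply/eqP/pts; rewrite mem_iota.
    exact: (point_code_lt id (inl (@Tagged _ i (fun=> 'I_(npts c)) j))).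
  rewrite [LHS](val_pt (cast_ord reflect_discs) (pictureP D') (inr j)).
  rewrite (val_pt id (pictureP D) (inr (rev_pt j))) /= -baseE -rev_outer.
  apply/eqP/pts; rewrite mem_iota.
  exact: (point_code_lt id (inr j)).
- split=> [i j|j]; apply/val_inj; rewrite [RHS]val_reflect_reg.
    rewrite [LHS](val_seg (cast_ord reflect_discs) (pictureP D')
      (inl (@Tagged _ i (fun=> 'I_(nsegs c)) j))).
    rewrite (val_seg id (pictureP D) (inl (@Tagged _ i (fun=> 'I_(nsegs c)) (rev_seg j)))).
    rewrite /= -rev_inner_seg; apply/eqP/segs; rewrite mem_iota.
    exact: (segment_code_lt id (pictureP D) (inl (@Tagged _ i (fun=> 'I_(nsegs c)) j))).
  rewrite [LHS](val_seg (cast_ord reflect_discs) (pictureP D') (inr j)).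
  rewrite (val_seg id (pictureP D) (inr (rev_seg j))) /= -baseE -rev_outer_seg.
  apply/eqP/segs; rewrite mem_iota.
  exact: (segment_code_lt id (pictureP D) (inr j)).
- move=> l b; apply/val_inj; rewrite [RHS]val_reflect_reg (val_side (pictureP D)).
  rewrite [LHS](val_side (pictureP D')) val_reflect_str.
  have lm : (l : nat) \in iota 0 (nstrings D) by rewrite mem_iota (str_lt (pictureP D)).
  by have /allP/(_ b) := sides _ lm; rewrite !inE; case: b => /(_ isT) /eqP.
Qed.
End ReflectionSound.

Section Eval.
Variables (R : realType) (P : planar_algebra R).
Local Open Scope ring_scope.

Definition eval (c c0 : color) (D : diagram c c0) (xs : seq (box P c)) : box P c0 :=
  tangle_act (tangle_of D (id_bij _)) (fun i : 'I_(discs D) => nth 0 xs i).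

Lemma act_drawing (c c0 : color) (D : diagram c c0) (I : finType)
    (num : I -> 'I_(discs D)) (num_bij : bijective num) (x : 'I_(discs D) -> box P c) :
  tangle_act (tangle_of D num_bij) (fun i => x (num i))
  = tangle_act (tangle_of D (id_bij _)) x.
Proof.
apply: (act_relabelling (T := tangle_of D (id_bij _)) (f := num)) => //.
by exists id, id; split=> //; exact: id_bij.
Qed.

(** A drawing that is a gluing in two ways can be evaluated in two ways: all
  identities between composites below come from this. *)
Lemma eval_glue (c' c c0 : color) (T : diagram c c0) (D0 : diagram c' c)
    (Ss : seq (diagram c' c)) (dss : seq (seq nat)) (U : diagram c' c0)
    (xs : seq (box P c')) :
  glue_check c' c c0 T (map (@picture _ _) Ss) dss U ->
  eval U xs
  = eval T [seq eval p.1 [seq nth 0 xs d | d <- p.2] | p <- zip Ss dss].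
Proof.
move=> TSU; have [/andP[/andP[/eqP szS /eqP szds] _] _] := andP TSU.
rewrite size_map in szS.
have szd : size dss = size Ss by rewrite -(size_map size) szds !size_map.
rewrite /eval -(act_drawing (glued_disc_bij D0 TSU)).
have -> := @act_gluing _ P _ _ _ _ (fun _ _ => c') _ _ _
  (fun q : {i : 'I_(discs T) & 'I_(discs (nth D0 Ss i))} => nth 0 xs (glued_disc TSU q))
  (drawing_gluing D0 TSU).
congr tangle_act; apply: funext => i.
have iS : (i < size Ss)%N by rewrite szS.
rewrite (nth_map (D0, [::])) ?size_zip ?szd ?minnn //.
rewrite nth_zip //=; congr tangle_act; apply: funext => a.
rewrite (nth_map 0%N) //.
have : nth 0%N (map size dss) i = nth 0%N (map discs (map (@picture _ _) Ss)) i.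
  by rewrite szds.
by rewrite (nth_map [::]) ?szd // -map_comp (nth_map D0) // => ->.
Qed.

(** A tangle given by arbitrary finite types acts as a drawing does as soon as
  its strings and regions can be numbered compatibly. *)
Lemma eval_link (c c0 : color) (D : diagram c c0) (I : finType)
    (num : I -> 'I_(discs D)) (T : tangle (fun _ : I => c) c0)
    (es : str T -> nat) (er : reg T -> nat) (xs : seq (box P c)) :
  bijective num -> injective es -> injective er ->
  (forall l, es l < nstrings D)%N -> (forall r, er r < nregions D)%N ->
  #|str T| = nstrings D -> #|reg T| = nregions D ->
  (forall i j, es (ipt T (i := i) j) = string_at D (num i * npts c + j)%N) ->
  (forall j, es (opt T j) = string_at D (base c D + j)%N) ->
  (forall i j, er (iseg T (i := i) j) = region_at D (num i * npts c + j)%N) ->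
  (forall j, er (oseg T j) = region_at D (base c D + j)%N) ->
  (forall l b, er (side l b) = side_at c c0 D (es l) b) ->
  tangle_act T (fun i => nth 0 xs (num i)) = eval D xs.
Proof.
move=> num_bij es_inj er_inj es_lt er_lt cs cr ipE opE isE osE sdE.
pose D' := tangle_of D (id_bij _).
have vs n : (n < nstrings D)%N -> (inord n : str D') = n :> nat.
  by move=> lt; rewrite [LHS](val_str (pictureP D)).
have vr n : (n < nregions D)%N -> (inord n : reg D') = n :> nat.
  by move=> lt; rewrite [LHS](val_reg (pictureP D)).
pose fs (l : str T) : str D' := inord (es l).
pose fr (r : reg T) : reg D' := inord (er r).
apply: (act_relabelling (T := D') (f := num) (fun i => nth 0 xs i) num_bij).
exists fs, fr; split.
- apply: inj_card_bij.
    by move=> x y /(congr1 val); rewrite /= !vs // => /es_inj.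
  by rewrite cs card_ord prednK ?(nstrings_gt0 (pictureP D)).
- apply: inj_card_bij.
    by move=> x y /(congr1 val); rewrite /= !vr // => /er_inj.
  by rewrite cr card_ord prednK ?(nregions_gt0 (pictureP D)).
- by split=> [i j|j]; rewrite /fs ?ipE ?opE.
- by split=> [i j|j]; rewrite /fr ?isE ?osE.
- by move=> l b; rewrite /fr sdE /fs /= vs.
Qed.
End Eval.

Lemma eval_reflect (R : realType) (P : planar_star_algebra R) (c c0 : color)
    (D D' : diagram c c0) (xs : seq (box P c)) :
  reflect_check c c0 D D' ->
  star_box (eval D xs) = eval D' (map (@star_box _ P c) xs).
Proof.
move=> DD'; rewrite /eval (star_act _ (drawing_reflection DD')).
have star0 : @star_box _ P c 0%R = 0%R.
  have := @star_antilinear _ P c 1%R 0%R 0%R.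
  rewrite scaler0 addr0 rmorph1 scale1r => /eqP.
  by rewrite addrC -subr_eq subrr => /eqP.
rewrite -(act_drawing (cast_bij DD')); congr tangle_act; apply: funext => i /=.
case: (ltnP i (size xs)) => ixs; first by rewrite (nth_map 0%R).
by rewrite !nth_default ?size_map // star0.
Qed.

(** The strings are numbered layer after layer; the leftmost region is 0, the
  rightmost one is 1, and the others follow, again layer after layer. *)
Definition stack_drawing k n : drawing :=
  let m := n.*2 in
  let middle l p := 2 + l * n.-1 + p.-1 in
  let region l p := if 0 < p < n then middle l p else p %/ n in
  Drawing k
   [seq (if l is l'.+1 then l' * m + (m - i.+1) else k * m + i,
         l * m + (if l == k then m - i.+1 else i)) | l <- iota 0 k.+1, i <- iota 0 n]
   ([seq region (if j < n then i else i.+1) (pos_nat n j)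
        | i <- iota 0 k, j <- iota 0 m]
    ++ [seq region (if j < n then 0 else k) (pos_nat n j) | j <- iota 0 m]).

Section StackLink.
Variables (k n : nat) (s : bool).
Let D := stack_drawing k n.
Let region l p := if 0 < p < n then 2 + l * n.-1 + p.-1 else p %/ n.

Definition stack_check : bool :=
  let ds := iota 0 k in
  let js := iota 0 n.*2 in
  [&& 0 < n, nstrings D == k.+1 * n, nregions D == 2 + k.+1 * n.-1,
      all (fun i => all (fun j =>
        (string_at D (i * n.*2 + j) == (if j < n then i else i.+1) * n + col_nat n j)
        && (region_at D (i * n.*2 + j) == region (if j < n then i else i.+1) (pos_nat n j)))
        js) ds,
      all (fun j =>
        (string_at D (k * n.*2 + j) == (if j < n then 0 else k) * n + col_nat n j)
        && (region_at D (k * n.*2 + j) == region (if j < n then 0 else k) (pos_nat n j))) js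
    & all (fun l => all (fun i => all (fun b =>
        side_at (n, s) (n, s) D (l * n + i) b
        == region l (if s (+) odd i == b then i else i.+1)) [:: false; true])
        (iota 0 n)) (iota 0 k.+1)].

Lemma eval_stack (R : realType) (P : planar_algebra R)
    (H : planar_drawing (n, s) (n, s) D) (xs : seq (box P (n, s))) :
  stack_check ->
  tangle_act (stack k n s) (fun i => nth 0%R xs i) = eval (Diagram H) xs.
Proof.
move=> /and5P[n0 /eqP szs /eqP szr /allP inn /andP[/allP out /allP sid]].
pose es (x : str (stack k n s)) := (x.1 : nat) * n + x.2.
pose er (x : reg (stack k n s)) := region (val x).1 (val x).2.
have codeE a b a' b' m : b < m -> b' < m -> a * m + b = a' * m + b' -> a = a' /\ b = b'.
  move=> bm b'm E; have m0 : 0 < m by lia.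
  have := congr1 (divn^~ m) E; have := congr1 (modn^~ m) E.
  by rewrite /= !modnMDl !modn_small // !divnMDl // !divn_small // !addn0.
have stack_regE l p : er (stack_reg l p) = region l p.
  by rewrite /er /region /stack_reg SubK /stack_norm /=; case: (0 < p < n).
have im (i : 'I_k) : (i : nat) \in iota 0 k by rewrite mem_iota ltn_ord.
have jm (j : 'I_n.*2) : (j : nat) \in iota 0 n.*2 by rewrite mem_iota ltn_ord.
have jsm (j : 'I_(nsegs (n, s))) : (j : nat) \in iota 0 n.*2.
  by rewrite mem_iota /=; have /= := ltn_ord j; lia.
have layerE (u v : 'I_k.+1) (j : nat) :
    stack_layer n u v j = (if j < n then u : nat else v) :> nat.
  by rewrite /stack_layer; case: ifP.
apply: (@eval_link _ P _ _ (Diagram H) _ id _ es er).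
- exact: id_bij.
- case=> [l i] [l' i']; rewrite /es /= => /codeE E.
  by have [/val_inj -> /val_inj ->] := E (ltn_ord i) (ltn_ord i').
- move=> x y; rewrite /er /region => xy; apply/val_inj.
  have := valP x; have := valP y; rewrite /stack_reg_pred.
  case: (val x) (val y) xy => [l p] [l' p'] /=.
  have pn := ltn_ord p; have pn' := ltn_ord p'.
  have dn (q : 'I_n.+1) : ~~ (0 < q < n) -> q = (q %/ n) * n :> nat.
    rewrite negb_and -!leqNgt leqn0 => /orP[/eqP ->|nq]; first by rewrite div0n.
    have -> : q = n :> nat by have := ltn_ord q; lia.
    by rewrite divnn n0 mul1n.
  have d1 (q : 'I_n.+1) : q %/ n <= 1.
    by rewrite -ltnS ltn_divLR //; have := ltn_ord q; lia.
  case: ifP => [pm|/negbT pm]; case: ifP => [pm'|/negbT pm'].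
  + rewrite -!addnA => /addnI/codeE[]; try by clear -pm pm'; lia.
    by move=> /val_inj -> pp _ _; congr (_, _); apply/val_inj => /=; clear -pp pm pm'; lia.
  + by move=> E; have := d1 p'; rewrite -E -addnA.
  + by move=> E; have := d1 p; rewrite E -addnA.
  + move=> /= pp /eqP -> /eqP ->; congr (_, _).
    by apply/val_inj; rewrite /= (dn p pm) pp -dn.
- by case=> l i; rewrite szs /es /= mulSn; have := ltn_ord i; have := ltn_ord l; nia.
- move=> r; rewrite szr /er /region; have := ltn_ord (val r).1; have := ltn_ord (val r).2.
  case: ifP => [rm rn rk|_ rn rk]; first by nia.
  by apply: leq_trans (leq_addr _ _); rewrite ltn_divLR //; lia.
- by rewrite card_prod !card_ord szs.
- by rewrite (@card_stack_region k n n.-1) ?prednK // szr.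
- move=> i j; have /allP/(_ _ (jm j))/andP[/eqP -> _] := inn _ (im i).
  by rewrite /es /= layerE.
- by move=> j; have /andP[/eqP -> _] := out _ (jm j); rewrite /es /= layerE.
- move=> i j; have /allP/(_ _ (jsm j))/andP[_ /eqP ->] := inn _ (im i).
  by rewrite /= stack_regE posE layerE.
- by move=> j; have /andP[_ /eqP ->] := out _ (jsm j); rewrite /= stack_regE posE layerE.
- case=> l i b; rewrite /= stack_regE col_sideE /es /=.
  have lm : (l : nat) \in iota 0 k.+1 by rewrite mem_iota ltn_ord.
  have /allP/(_ (i : nat)) := sid _ lm; rewrite mem_iota ltn_ord => /(_ isT) /allP/(_ b).
  by rewrite !inE; case: b => /(_ isT) /eqP.
Qed.
End StackLink.

Definition closing_drawing n (left : bool) : drawing :=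
  Drawing 1 [seq (i, n.*2 - i.+1) | i <- iota 0 n]
    (rcons [seq pos_nat n j | j <- iota 0 n.*2] (if left then n else 0)).

Section ClosingLink.
Variables (n : nat) (s left : bool).
Let D := closing_drawing n left.
Let c0 := closing_outer n s left.

Definition closing_check : bool :=
  [&& nstrings D == n, nregions D == n.+1,
      all (fun j => (string_at D j == col_nat n j) && (region_at D j == pos_nat n j))
          (iota 0 n.*2),
      region_at D n.*2 == (if left then n else 0)
    & all (fun i => all (fun b => side_at (n, s) c0 D i b
           == if s (+) odd i == b then i else i.+1) [:: false; true]) (iota 0 n)].

Lemma eval_closing (R : realType) (P : planar_algebra R)
    (H : planar_drawing (n, s) c0 D) (x : box P (n, s)) :
  closing_check ->
  tangle_act (closing n s left) (fun=> x) = eval (Diagram H) [:: x].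
Proof.
move=> /and5P[/eqP szs /eqP szr /allP inn /eqP out /allP sid].
have m0 : 0 < n.*2 := npts_gt0 H.
have jm (j : 'I_n.*2) : (j : nat) \in iota 0 n.*2 by rewrite mem_iota ltn_ord.
have jsm (j : 'I_(nsegs (n, s))) : (j : nat) \in iota 0 n.*2.
  by rewrite mem_iota /=; have /= := ltn_ord j; lia.
apply: (@eval_link _ P _ _ (Diagram H) _ (fun=> ord0) (closing n s left) (fun l => l : nat)
  (fun r => r : nat) [:: x]).
- by exists (fun=> tt) => [[]|i] //; rewrite (ord1 i).
- exact: val_inj.
- exact: val_inj.
- by move=> l; rewrite szs; have /= := ltn_ord l.
- by move=> r; rewrite szr; have /= := ltn_ord r.
- by rewrite card_ord szs.
- by rewrite card_ord szr.
- by move=> [] j; have /andP[/eqP -> _] := inn _ (jm j).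
- by case.
- by move=> [] j; have /andP[_ /eqP ->] := inn _ (jsm j); rewrite /= posE.
- by move=> j; rewrite (ord1 j) /base /= mul1n addn0 out; case: (left).
- move=> i b; have im : (i : nat) \in iota 0 n by rewrite mem_iota; have /= := ltn_ord i.
  have /allP/(_ b) := sid _ im; rewrite /= col_sideE !inE.
  by case: b => /(_ isT) /eqP.
Qed.
End ClosingLink.

Definition rotation_drawing : drawing :=
  Drawing 1 [:: (0, 7); (1, 4); (2, 5); (3, 6)] [:: 0; 1; 2; 3; 1; 2; 3; 0].

Lemma eval_rotation (s : bool) (R : realType) (P : planar_algebra R)
    (H : planar_drawing (2, s) (2, ~~ s) rotation_drawing) (x : box P (2, s)) :
  tangle_act (rotation s) (fun=> x) = eval (Diagram H) [:: x].
Proof.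
apply: (@eval_link _ P _ _ (Diagram H) _ (fun=> ord0) (rotation s) (fun l => l : nat)
  (fun r => r : nat) [:: x]).
- by exists (fun=> tt) => [[]|i] //; rewrite (ord1 i).
- exact: val_inj.
- exact: val_inj.
- by case.
- by case.
- by rewrite card_ord.
- by rewrite card_ord.
- by case=> -[[|[|[|[|]]]]].
- by case=> -[|[|[|[|]]]].
- by case=> -[[|[|[|[|]]]]].
- by case=> -[|[|[|[|]]]].
- by move=> [[|[|[|[|//]]]] il] b; rewrite /= /side_at /shade_of /=; case: (s) b => [] [].
Qed.

(** * The diagrams of the proof and their relations *)

Section EvalLinear.
Variables (R : realType) (P : planar_algebra R).
Local Open Scope ring_scope.

Lemma eval_linear (c c0 : color) (D : diagram c c0) (k : nat)
    (a : complex R) (xs ys zs : seq (box P c)) :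
  (k < discs D)%N ->
  nth 0 xs k = a *: nth 0 ys k + nth 0 zs k ->
  (forall j, j != k -> nth 0 ys j = nth 0 xs j /\ nth 0 zs j = nth 0 xs j) ->
  eval D xs = a *: eval D ys + eval D zs.
Proof.
move=> kD kE jE; pose i := Ordinal kD.
pose x (j : 'I_(discs D)) := nth 0 xs j.
have dfE ws : (forall j, j != k -> nth 0 ws j = nth 0 xs j) ->
    (fun j : 'I_(discs D) => nth 0 ws j) = @dfwith _ (fun=> box P c) x i (nth 0 ws k).
  move=> wE; apply: funext => j; case: dfwithP => [//|j' ij].
  by rewrite wE //; apply: contra ij => /eqP jk; apply/eqP/val_inj.
rewrite /eval (dfE xs) // kE act_multilinear.
by rewrite (dfE ys) ?(dfE zs) // => j /jE[].
Qed.

Lemma eval_eq0 (c c0 : color) (D : diagram c c0) (k : nat) (xs : seq (box P c)) :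
  (k < discs D)%N -> nth 0 xs k = 0 -> eval D xs = 0.
Proof.
move=> kD xk; have : eval D xs = 1 *: eval D xs + eval D xs.
  by apply: (eval_linear kD) => //; rewrite xk scaler0 addr0.
by rewrite scale1r => /eqP; rewrite -subr_eq subrr eq_sym => /eqP.
Qed.

Lemma eval_picture (c c0 : color) (D D' : diagram c c0) (xs : seq (box P c)) :
  picture D = picture D' -> eval D xs = eval D' xs.
Proof.
case: D D' => [D HD] [D' HD'] /= E; case: _ / E in HD' *.
by rewrite (bool_irrelevance HD HD').
Qed.

End EvalLinear.

(** Completes a list of strings into a drawing: its regions are the classes of
  boundary segments connected along the sides of strings.  Two points of inner
  discs, or two outer points, are joined by a string that reverses the
  orientation of the boundary; it preserves it between an inner and an outer
  point.  An outer disc without points has to be placed in a region, that of the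
  segment [anchor]. *)
Definition draw (n n0 k anchor : nat) (st : seq (nat * nat)) : drawing :=
  let c := (n, false) in let c0 := (n0, false) in
  let D := Drawing k st [::] in
  let next := next_point c c0 D in
  let inner p := p < base c D in
  let es := flatten [seq if inner l.1 == inner l.2
                         then [:: (l.1, next l.2); (next l.1, l.2)]
                         else [:: l; (next l.1, next l.2)] | l <- st] in
  let cl := classes (nsegments c c0 D)
              (if n0 == 0 then (anchor, base c D) :: es else es) in
  Drawing k st [seq index l (undup cl) | l <- cl].

(* the numerical checks are evaluated for each of the two shadings *)
Ltac by_shade s := by generalize s; case; vm_compute.

Section Diagrams.
Variable s : bool.

Lemma mul_planar : planar_drawing (2, s) (2, s) (stack_drawing 2 2).
Proof. by_shade s. Qed.
Definition mulD := Diagram mul_planar.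

Lemma id_planar : planar_drawing (2, s) (2, s) (stack_drawing 1 2).
Proof. by_shade s. Qed.
Definition idD := Diagram id_planar.

Lemma one_planar t : planar_drawing (2, t) (2, s) (stack_drawing 0 2).
Proof. by case: t; by_shade s. Qed.
Definition oneD t := Diagram (one_planar t).

Lemma mul3_planar : planar_drawing (2, s) (2, s) (stack_drawing 3 2).
Proof. by_shade s. Qed.
Definition mul3D := Diagram mul3_planar.

Lemma id1_planar : planar_drawing (1, s) (1, s) (stack_drawing 1 1).
Proof. by_shade s. Qed.
Definition id1D := Diagram id1_planar.

Lemma box3_mul_planar : planar_drawing (3, s) (3, s) (stack_drawing 2 3).
Proof. by_shade s. Qed.
Definition box3_mulD := Diagram box3_mul_planar.

Lemma rot_planar : planar_drawing (2, s) (2, ~~ s) rotation_drawing.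
Proof. by_shade s. Qed.
Definition rotationD := Diagram rot_planar.

Lemma unrot_planar t : t = ~~ s ->
  planar_drawing (2, s) (2, t) (draw 2 2 1 0 [:: (3, 4); (0, 5); (1, 6); (2, 7)]).
Proof. by move=> ->; by_shade s. Qed.
Definition unrotD t (ts : t = ~~ s) := Diagram (unrot_planar ts).

Lemma closing_planar_drawing :
  planar_drawing (2, s) (closing_outer 2 s false) (closing_drawing 2 false).
Proof. by_shade s. Qed.
Definition closeD := Diagram closing_planar_drawing.

Lemma box3_closing_planar :
  planar_drawing (3, s) (closing_outer 3 s false) (closing_drawing 3 false).
Proof. by_shade s. Qed.
Definition box3_closeD := Diagram box3_closing_planar.

Lemma box1_closing_planar left :
  planar_drawing (1, s) (closing_outer 1 s left) (closing_drawing 1 left).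
Proof. by case: left; by_shade s. Qed.
Definition box1_closeD left := Diagram (box1_closing_planar left).

(** The closure of the product of two 2-boxes: on the sphere, two discs joined by
  four parallel strings. *)
Lemma pairing_planar :
  planar_drawing (2, s) (closing_outer 2 s false)
    (draw 2 0 2 0 [:: (0, 7); (1, 6); (2, 5); (3, 4)]).
Proof. by_shade s. Qed.
Definition pairingD := Diagram pairing_planar.

(** The same picture with the outer disc moved across a string. *)
Lemma pairing_moved_planar :
  planar_drawing (2, s) (closing_outer 1 s true)
    (draw 2 0 2 1 [:: (0, 7); (1, 6); (2, 5); (3, 4)]).
Proof. by_shade s. Qed.
Definition pairing_movedD := Diagram pairing_moved_planar.

(** The same picture with that string cut open.  Both positions of the outer disc
  are obtained by closing it, on the right and on the left. *)
Lemma open_pairing_planar :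
  planar_drawing (2, s) (1, s)
    (draw 2 1 2 0 [:: (0, 8); (7, 9); (1, 6); (2, 5); (3, 4)]).
Proof. by_shade s. Qed.
Definition open_pairingD := Diagram open_pairing_planar.

(** The two upper points are joined, which leaves a 1-box. *)
Lemma cap_planar : planar_drawing (2, s) (1, s) (draw 2 1 1 0 [:: (0, 1); (2, 4); (3, 5)]).
Proof. by_shade s. Qed.
Definition capD := Diagram cap_planar.

(** A cup on top of a 1-box drawn at the bottom. *)
Lemma cup_planar : planar_drawing (1, s) (2, s) (draw 1 2 1 0 [:: (2, 3); (0, 4); (1, 5)]).
Proof. by_shade s. Qed.
Definition cupD := Diagram cup_planar.

(** A 1-box, upside down, on the right of a vertical strand. *)
Lemma strand_planar : planar_drawing (1, s) (2, s) (draw 1 2 1 0 [:: (4, 0); (1, 3); (2, 5)]).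
Proof. by_shade s. Qed.
Definition strandD := Diagram strand_planar.

(** The diagram of the Jones projection, up to a factor.  Having no inner disc it
  may carry any inner colour. *)
Lemma cupcap_planar t : planar_drawing (2, t) (2, s) (draw 2 2 0 0 [:: (0, 1); (2, 3)]).
Proof. by case: t; by_shade s. Qed.
Definition cupcapD t := Diagram (cupcap_planar t).

Lemma cupcap_over_planar :
  planar_drawing (2, s) (2, s) (draw 2 2 1 0 [:: (4, 5); (0, 1); (2, 6); (3, 7)]).
Proof. by_shade s. Qed.
Definition cupcap_overD := Diagram cupcap_over_planar.

Lemma mul_rot_planar :
  planar_drawing (2, s) (2, ~~ s)
    (draw 2 2 2 0 [:: (1, 8); (2, 9); (3, 6); (0, 5); (7, 10); (4, 11)]).
Proof. by_shade s. Qed.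
Definition mul_rotD := Diagram mul_rot_planar.

(** Two discs side by side, joined by two strings: the first one is on the right. *)
Lemma coproduct_planar :
  planar_drawing (2, s) (2, s)
    (draw 2 2 2 0 [:: (4, 8); (1, 9); (2, 10); (7, 11); (3, 6); (0, 5)]).
Proof. by_shade s. Qed.
Definition coproductD := Diagram coproduct_planar.

(** The trace of a product a (b o c), where o is the coproduct: three discs, any
  two of them joined by two strings. *)
Lemma triangle_planar :
  planar_drawing (2, s) (closing_outer 2 s false)
    (draw 2 0 3 0 [:: (0, 11); (1, 6); (2, 5); (3, 8); (7, 10); (4, 9)]).
Proof. by_shade s. Qed.
Definition triangleD := Diagram triangle_planar.

(** In the triangle each disc is split into two discs joined by two strings.  The
  picture becomes a triangular prism, which the plane through the middle of these
  six strings cuts into two mirror images. *)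
Lemma prism_planar :
  planar_drawing (2, s) (closing_outer 2 s false)
    (draw 2 0 6 0 [:: (0, 23); (1, 14); (6, 9); (7, 16); (15, 22); (8, 17);
                      (2, 5); (3, 4); (10, 13); (11, 12); (18, 21); (19, 20)]).
Proof. by_shade s. Qed.
Definition prismD := Diagram prism_planar.

Lemma half_prism_planar :
  planar_drawing (2, s) (3, s)
    (draw 2 3 3 0 [:: (0, 11); (1, 6); (7, 10);
                      (12, 8); (13, 9); (14, 4); (15, 5); (16, 2); (17, 3)]).
Proof. by_shade s. Qed.
Definition half_prismD := Diagram half_prism_planar.

Lemma mirror_half_prism_planar :
  planar_drawing (2, s) (3, s)
    (draw 2 3 3 0 [:: (2, 5); (3, 8); (4, 9);
                      (12, 0); (13, 1); (14, 6); (15, 7); (16, 10); (17, 11)]).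
Proof. by_shade s. Qed.
Definition mirror_half_prismD := Diagram mirror_half_prism_planar.

Lemma box3_pairing_planar :
  planar_drawing (3, s) (closing_outer 2 s false)
    (draw 3 0 2 0 [:: (0, 11); (1, 10); (2, 9); (3, 8); (4, 7); (5, 6)]).
Proof. by_shade s. Qed.
Definition box3_pairingD := Diagram box3_pairing_planar.

Lemma opmul_planar : planar_drawing (2, s) (2, s)
  (draw 2 2 2 0 [:: (4, 8); (5, 9); (6, 1); (7, 0); (2, 10); (3, 11)]).
Proof. by_shade s. Qed.
Definition opmulD := Diagram opmul_planar.

End Diagrams.

Section NoDisc.
Variables (R : realType) (P : planar_algebra R).

(** The colour function of an empty family of discs can be changed. *)
Lemma act_no_disc (I : finType) (c c' : I -> color) (c0 : color)
    (T : tangle c c0) (T' : tangle c' c0) x x' (fs : str T' -> str T) (fr : reg T' -> reg T) :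
  (I -> False) -> bijective fs -> bijective fr ->
  (forall j, opt T j = fs (opt T' j)) -> (forall j, oseg T j = fr (oseg T' j)) ->
  (forall l b, side (fs l) b = fr (side l b)) ->
  @tangle_act R P I c c0 T x = @tangle_act R P I c' c0 T' x'.
Proof.
move=> noI; have E : c = c' by apply: funext => i; case: (noI i).
case: _ / E in T' x' fs fr * => fs_bij fr_bij opE osE sdE.
have -> : x = x' by apply: functional_extensionality_dep => i; case: (noI i).
apply: esym; apply: (act_relabelling (f := id)); first exact: id_bij.
by exists fs, fr; split=> //; split=> // i; case: (noI i).
Qed.

Lemma eval_no_disc (c c' c0 : color) (D : diagram c c0) (D' : diagram c' c0) :
  picture D = picture D' -> discs D = 0 ->
  eval (P := P) D [::] = eval (P := P) D' [::].
Proof.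
case: D D' => [D HD] [D' HD'] /= E; case: _ / E in HD' * => D0.
rewrite /eval; pose T := tangle_of (Diagram HD) (id_bij _).
pose T' := tangle_of (Diagram HD') (id_bij _).
apply: (@act_no_disc _ _ _ _ T T' _ _ id id) => //=.
- by rewrite D0 => -[].
- exact: id_bij.
- exact: id_bij.
- by move=> j; rewrite /base D0.
- by move=> j; rewrite /base D0.
- by move=> l b; congr inord; rewrite /side_at /shade_of /next_point /base D0.
Qed.

End NoDisc.

Section StarRelations.
Variables (R : realType) (P : planar_star_algebra R).
Notation "a ** b" := (mul_box a b) (at level 40).

Section Shade.
Variables (s : bool).
Notation A := (box P (2, s)).
Implicit Types a b : A.
Notation one := (one_box P 2 s).

Lemma eval_id a : eval (idD s) [:: a] = a.
Proof.
have H : stack_check 1 2 s by by_shade s.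
rewrite -(eval_stack (P := P) (id_planar s) [:: a] H) -[RHS]act_identity.
by congr tangle_act; apply: functional_extensionality_dep => i; rewrite (ord1 i).
Qed.

Lemma eval_id1 (x : box P (1, s)) : eval (id1D s) [:: x] = x.
Proof.
have H : stack_check 1 1 s by by_shade s.
rewrite -(eval_stack (P := P) (id1_planar s) [:: x] H) -[RHS]act_identity.
by congr tangle_act; apply: functional_extensionality_dep => i; rewrite (ord1 i).
Qed.

Lemma eval_mul a b : a ** b = eval (mulD s) [:: a; b].
Proof.
have H : stack_check 2 2 s by by_shade s.
rewrite -(eval_stack (P := P) (mul_planar s) [:: a; b] H).
by congr tangle_act; apply: functional_extensionality_dep => -[[|[|]]].
Qed.

Lemma eval_one t : one = eval (oneD s t) [::].
Proof.
have H : stack_check 0 2 s by by_shade s.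
rewrite -(@eval_no_disc _ _ _ _ _ (oneD s s)) //.
rewrite -(eval_stack (P := P) (one_planar s s) [::] H).
by congr tangle_act; apply: functional_extensionality_dep => -[].
Qed.

Lemma eval_box3_mul (a b : box P (3, s)) : a ** b = eval (box3_mulD s) [:: a; b].
Proof.
have H : stack_check 2 3 s by by_shade s.
rewrite -(eval_stack (P := P) (box3_mul_planar s) [:: a; b] H).
by congr tangle_act; apply: functional_extensionality_dep => -[[|[|]]].
Qed.

Lemma eval_fourier a : fourier a = eval (rotationD s) [:: a].
Proof. exact: eval_rotation. Qed.

Definition unrotate a : box P (2, ~~ s) := eval (unrotD (erefl (~~ s))) [:: a].

Definition inv_fourier (y : box P (2, ~~ s)) : A :=
  eval (unrotD (esym (negbK s))) [:: y].

Definition cupcap : A := eval (cupcapD s s) [::].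

Definition close a : box P (closing_outer 2 s false) := eval (closeD s) [:: a].

Lemma mul_boxA a b c : a ** (b ** c) = (a ** b) ** c.
Proof.
rewrite !eval_mul.
have Hl : glue_check (2, s) (2, s) (2, s) (mulD s) [:: picture (mulD s); picture (idD s)]
    [:: [:: 0; 1]; [:: 2]] (mul3D s) by by_shade s.
have Hr : glue_check (2, s) (2, s) (2, s) (mulD s) [:: picture (idD s); picture (mulD s)]
    [:: [:: 0]; [:: 1; 2]] (mul3D s) by by_shade s.
have := eval_glue (idD s) (Ss := [:: mulD s; idD s]) [:: a; b; c] Hl.
have := eval_glue (idD s) (Ss := [:: idD s; mulD s]) [:: a; b; c] Hr.
by rewrite /= !eval_id => <- <-.
Qed.

Lemma mul_box1 a : a ** one = a.
Proof.
rewrite (eval_one s) eval_mul.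
have H : glue_check (2, s) (2, s) (2, s) (mulD s) [:: picture (idD s); picture (oneD s s)]
    [:: [:: 0]; [::]] (idD s) by by_shade s.
have := eval_glue (idD s) (Ss := [:: idD s; oneD s s]) [:: a] H.
by rewrite /= !eval_id => <-.
Qed.

Lemma mul_1box a : one ** a = a.
Proof.
rewrite (eval_one s) eval_mul.
have H : glue_check (2, s) (2, s) (2, s) (mulD s) [:: picture (oneD s s); picture (idD s)]
    [:: [::]; [:: 0]] (idD s) by by_shade s.
have := eval_glue (idD s) (Ss := [:: oneD s s; idD s]) [:: a] H.
by rewrite /= !eval_id => <-.
Qed.

Lemma star_mul_box a b : star_box (a ** b) = star_box b ** star_box a.
Proof.
have H : reflect_check (2, s) (2, s) (mulD s) (opmulD s) by by_shade s.
rewrite !eval_mul (eval_reflect _ H) /=.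
have H' : glue_check (2, s) (2, s) (2, s) (idD s) [:: picture (mulD s)]
    [:: [:: 1; 0]] (opmulD s) by by_shade s.
have := eval_glue (idD s) (Ss := [:: mulD s]) [:: star_box a; star_box b] H'.
by rewrite /= eval_id.
Qed.

Lemma close_mul a b : close (a ** b) = eval (pairingD s) [:: a; b].
Proof.
rewrite eval_mul.
have H : glue_check (2, s) (2, s) (closing_outer 2 s false) (closeD s)
    [:: picture (mulD s)] [:: [:: 0; 1]] (pairingD s) by by_shade s.
by have /= -> := eval_glue (idD s) (Ss := [:: mulD s]) [:: a; b] H.
Qed.

Lemma pairingC a b : eval (pairingD s) [:: a; b] = eval (pairingD s) [:: b; a].
Proof.
have H : glue_check (2, s) (2, s) (closing_outer 2 s false) (closeD s)
    [:: picture (mulD s)] [:: [:: 1; 0]] (pairingD s) by by_shade s.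
have /= -> := eval_glue (idD s) (Ss := [:: mulD s]) [:: a; b] H.
by rewrite -eval_mul -close_mul.
Qed.

Lemma star_fourier a : star_box (fourier a) = unrotate (star_box a).
Proof.
have H : reflect_check (2, s) (2, ~~ s) (rotationD s) (unrotD (erefl (~~ s))) by by_shade s.
by rewrite eval_fourier (eval_reflect _ H).
Qed.

Lemma fourierK a : inv_fourier (fourier a) = a.
Proof.
rewrite eval_fourier.
have H : glue_check (2, s) (2, ~~ s) (2, s) (unrotD (esym (negbK s)))
    [:: picture (rotationD s)] [:: [:: 0]] (idD s) by by_shade s.
by have /= := eval_glue (rotationD s) (Ss := [:: rotationD s]) [:: a] H; rewrite eval_id.
Qed.

Lemma cupcap_mul a :
  cupcap ** a = eval (cupD s) [:: eval (capD s) [:: a]].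
Proof.
rewrite eval_mul.
have H : glue_check (2, s) (2, s) (2, s) (mulD s) [:: picture (cupcapD s s); picture (idD s)]
    [:: [::]; [:: 0]] (cupcap_overD s) by by_shade s.
have /= := eval_glue (idD s) (Ss := [:: cupcapD s s; idD s]) [:: a] H; rewrite eval_id => <-.
have H' : glue_check (2, s) (1, s) (2, s) (cupD s) [:: picture (capD s)]
    [:: [:: 0]] (cupcap_overD s) by by_shade s.
exact: (eval_glue (capD s) (Ss := [:: capD s]) [:: a] H').
Qed.

Lemma cap_strand (x : box P (1, s)) :
  eval (capD s) [:: eval (strandD s) [:: x]] = x.
Proof.
have H : glue_check (1, s) (2, s) (1, s) (capD s) [:: picture (strandD s)]
    [:: [:: 0]] (id1D s) by by_shade s.
by have /= := eval_glue (strandD s) (Ss := [:: strandD s]) [:: x] H; rewrite eval_id1.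
Qed.

End Shade.

Lemma inv_fourierK s (y : box P (2, ~~ s)) : fourier (inv_fourier y) = y.
Proof.
rewrite eval_fourier.
have H : glue_check (2, ~~ s) (2, s) (2, ~~ s) (rotationD s)
    [:: picture (unrotD (esym (negbK s)))] [:: [:: 0]] (idD (~~ s)) by by_shade s.
have /= := eval_glue (unrotD (esym (negbK s))) (Ss := [:: unrotD (esym (negbK s))]) [:: y] H.
by rewrite eval_id => <-.
Qed.

Lemma fourier_cupcap s : fourier (cupcap s) = one_box P 2 (~~ s).
Proof.
rewrite eval_fourier (@eval_one (~~ s) s).
have H : glue_check (2, s) (2, s) (2, ~~ s) (rotationD s)
    [:: picture (cupcapD s s)] [:: [::]] (oneD (~~ s) s) by by_shade s.
by have /= -> := eval_glue (idD s) (Ss := [:: cupcapD s s]) [::] H.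
Qed.

Lemma fourier_one s : fourier (one_box P 2 s) = cupcap (~~ s).
Proof.
rewrite eval_fourier (eval_one s s) /cupcap -(@eval_no_disc _ _ _ _ _ (cupcapD (~~ s) s)) //.
have H : glue_check (2, s) (2, s) (2, ~~ s) (rotationD s)
    [:: picture (oneD s s)] [:: [::]] (cupcapD (~~ s) s) by by_shade s.
by have /= -> := eval_glue (idD s) (Ss := [:: oneD s s]) [::] H.
Qed.

Lemma star_fourier_true (y : box P (2, true)) :
  star_box (fourier y) = @inv_fourier false (star_box y).
Proof. by rewrite star_fourier; apply: eval_picture. Qed.

End StarRelations.

Section TraceRelations.
Variables (R : realType) (P : subfactor_planar_algebra R).
Notation "a ** b" := (mul_box a b) (at level 40).
Notation d := (delta P).
Local Open Scope ring_scope.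

Definition tr (s : bool) (a : box P (2, s)) : complex R := trace_box d false a.

Lemma scalar_of_linear s (k : complex R) (x y : box P (0%N, s)) :
  scalar_of (k *: x + y) = k * scalar_of x + scalar_of y.
Proof. exact: linearP. Qed.

Section Shade.
Variable s : bool.
Notation A := (box P (2, s)).
Implicit Types a b : A.

Lemma trE a : tr a = d ^- 2 * scalar_of (close a).
Proof.
have H : closing_check 2 s false by by_shade s.
by rewrite /tr /trace_box (eval_closing (closing_planar_drawing s) a H).
Qed.

Lemma tr_linear (k : complex R) a b : tr (k *: a + b) = k * tr a + tr b.
Proof.
rewrite !trE mulrCA -mulrDr -scalar_of_linear; congr (_ * scalar_of _).
by apply: (eval_linear (k := 0)) => // -[].
Qed.

Lemma tr_mulC a b : tr (a ** b) = tr (b ** a).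
Proof. by rewrite !trE !close_mul pairingC. Qed.

Lemma mul_box_linear_l (k : complex R) a b c :
  (k *: a + b) ** c = k *: (a ** c) + b ** c.
Proof. by rewrite !eval_mul; apply: (eval_linear (k := 0)) => // -[|[]]. Qed.

Lemma mul_box_linear_r (k : complex R) a b c :
  c ** (k *: a + b) = k *: (c ** a) + c ** b.
Proof. by rewrite !eval_mul; apply: (eval_linear (k := 1)) => // -[|[]]. Qed.

Lemma fourier_linear (k : complex R) a b :
  fourier (k *: a + b) = k *: fourier a + fourier b.
Proof. by rewrite !eval_fourier; apply: (eval_linear (k := 0)) => // -[]. Qed.

Lemma trace3E (x : box P (3, s)) :
  trace_box d false x = d ^- 3 * scalar_of (eval (box3_closeD s) [:: x]).
Proof.
have H : closing_check 3 s false by by_shade s.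
by rewrite /trace_box (eval_closing (box3_closing_planar s) x H).
Qed.

(** Both sides evaluate the prism: on the left each pair of opposite discs is a
  product, on the right the prism is cut into its two halves. *)
Lemma close_half_prism (v x y : A) :
  close ((v ** star_box v) **
         inv_fourier (fourier (star_box x ** x) ** fourier (star_box y ** y)))
  = eval (box3_closeD s) [:: star_box (eval (half_prismD s) [:: v; x; y])
                              ** eval (half_prismD s) [:: v; x; y]].
Proof.
have H : reflect_check (2, s) (3, s) (half_prismD s) (mirror_half_prismD s) by by_shade s.
rewrite (eval_reflect _ H) /= eval_box3_mul; 
set w := eval (half_prismD s) _; set w' := eval (mirror_half_prismD s) _.
have H1 : glue_check (3, s) (3, s) (closing_outer 2 s false) (box3_closeD s)
    [:: picture (box3_mulD s)] [:: [:: 0; 1]]%N (box3_pairingD s) by by_shade s.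
have /= <- := eval_glue (box3_mulD s) (Ss := [:: box3_mulD s]) [:: w'; w] H1.
have H2 : glue_check (2, s) (3, s) (closing_outer 2 s false) (box3_pairingD s)
    [:: picture (mirror_half_prismD s); picture (half_prismD s)]
    [:: [:: 1; 2; 4]; [:: 0; 3; 5]]%N (prismD s) by by_shade s.
have /= <- := eval_glue (half_prismD s) (Ss := [:: mirror_half_prismD s; half_prismD s])
  [:: v; star_box v; star_box x; x; star_box y; y] H2.
have H3 : glue_check (2, s) (2, s) (closing_outer 2 s false) (triangleD s)
    [:: picture (mulD s); picture (mulD s); picture (mulD s)]
    [:: [:: 0; 1]; [:: 2; 3]; [:: 4; 5]]%N (prismD s) by by_shade s.
have /= -> := eval_glue (mulD s) (Ss := [:: mulD s; mulD s; mulD s])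
  [:: v; star_box v; star_box x; x; star_box y; y] H3.
rewrite -!eval_mul close_mul.
move: (v ** _) (star_box x ** x) (star_box y ** y) => {w w' v x y} a b c.
have H4 : glue_check (2, s) (2, s) (closing_outer 2 s false) (pairingD s)
    [:: picture (idD s); picture (coproductD s)] [:: [:: 0]; [:: 1; 2]]%N (triangleD s).
  by by_shade s.
have /= -> := eval_glue (mulD s) (Ss := [:: idD s; coproductD s]) [:: a; b; c] H4.
rewrite eval_id.
have H5 : glue_check (2, s) (2, ~~ s) (2, s) (unrotD (esym (negbK s)))
    [:: picture (mul_rotD s)] [:: [:: 0; 1]]%N (coproductD s) by by_shade s.
have /= -> := eval_glue (mul_rotD s) (Ss := [:: mul_rotD s]) [:: b; c] H5.
have H6 : glue_check (2, s) (2, ~~ s) (2, ~~ s) (mulD (~~ s))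
    [:: picture (rotationD s); picture (rotationD s)] [:: [:: 0]; [:: 1]]%N (mul_rotD s).
  by by_shade s.
have /= -> := eval_glue (rotationD s) (Ss := [:: rotationD s; rotationD s]) [:: b; c] H6.
by rewrite -!eval_fourier -eval_mul.
Qed.

(** The Schur product theorem: the prism is the closure of w* w, where the 3-box w
  is half of the prism. *)
Lemma schur_product_trace (v x y : A) :
  0 <= tr ((v ** star_box v) **
         inv_fourier (fourier (star_box x ** x) ** fourier (star_box y ** y))).
Proof.
rewrite trE close_half_prism; set w := eval (half_prismD s) _.
have d0 : 0 < d := delta_gt0 P.
rewrite mulr_ge0 ?invr_ge0 ?exprn_ge0 ?(ltW d0) //.
have [->|w0] := eqVneq w 0.
  rewrite eval_box3_mul (@eval_eq0 _ _ _ _ (box3_mulD s) 1) //.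
  rewrite (@eval_eq0 _ _ _ _ (box3_closeD s) 0) //.
  by rewrite /scalar_of linear0.
have := inner_product_gt0 w0; rewrite trace3E => /ltW.
by rewrite pmulr_rge0 // invr_gt0 exprn_gt0.
Qed.

End Shade.

(** The two traces live on boxes of opposite shadings.  Cutting a string of the
  closed picture gives a 1-box, whose closures on the two sides are the two
  traces, so that sphericality identifies them. *)
Lemma tr_fourier s (a b : box P (2, s)) :
  tr (fourier a ** unrotate b) = tr (a ** b).
Proof.
rewrite !trE !close_mul.
have sph t (x : box P (1%N, t)) : scalar_of (eval (box1_closeD t true) [:: x])
    = scalar_of (eval (box1_closeD t false) [:: x]).
  have d0 : d ^- 1 != 0 by rewrite expr1 invr_eq0 (gt_eqF (delta_gt0 P)).
  have H left : closing_check 1 t left by case: left; by_shade t.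
  have := spherical x; rewrite /trace_box.
  rewrite (eval_closing (box1_closing_planar t true) x (H true)).
  by rewrite (eval_closing (box1_closing_planar t false) x (H false)) => /(mulfI d0).
have Hr : glue_check (2, s) (1, s) (closing_outer 2 s false) (box1_closeD s false)
    [:: picture (open_pairingD s)] [:: [:: 0; 1]]%N (pairingD s) by by_shade s.
have Hl : glue_check (2, s) (1, s) (closing_outer 1 s true) (box1_closeD s true)
    [:: picture (open_pairingD s)] [:: [:: 0; 1]]%N (pairing_movedD s) by by_shade s.
have /= er := eval_glue (open_pairingD s) (Ss := [:: open_pairingD s]) [:: a; b] Hr.
have /= el := eval_glue (open_pairingD s) (Ss := [:: open_pairingD s]) [:: a; b] Hl.
congr (_ * _); have {er el Hl Hr sph} E : scalar_of (eval (pairingD s) [:: a; b])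
    = scalar_of (eval (pairing_movedD s) [:: a; b]).
  by rewrite el sph; congr scalar_of.
rewrite E {E}.
case: s a b => a b.
all: rewrite eval_fourier.

- have H : glue_check (2, true) (2, false) (0%N, false) (pairingD false)
    [:: picture (rotationD true); picture (unrotD (erefl (~~ true)))]
    [:: [:: 0]; [:: 1]]%N (pairing_movedD true) by vm_compute.
  have := eval_glue (U := pairing_movedD true) (rotationD true)
    (Ss := [:: rotationD true; unrotD (erefl (~~ true))]) [:: a; b] H.
  by move=> ->.
- have H : glue_check (2, false) (2, true) (0%N, true) (pairingD true)
    [:: picture (rotationD false); picture (unrotD (erefl (~~ false)))]
    [:: [:: 0]; [:: 1]]%N (pairing_movedD false) by vm_compute.
  have := eval_glue (U := pairing_movedD false) (rotationD false)
    (Ss := [:: rotationD false; unrotD (erefl (~~ false))]) [:: a; b] H.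
  by move=> ->.
Qed.

Lemma fourier_isometry s (a b : box P (2, s)) :
  tr (star_box (fourier b) ** fourier a) = tr (star_box b ** a).
Proof. by rewrite star_fourier tr_mulC tr_fourier tr_mulC. Qed.

End TraceRelations.

Local Open Scope ring_scope.

(** * The algebra of 2-boxes *)

Lemma dim1_line (K : fieldType) (V : vectType K) :
  \dim {:V} = 1%N -> exists2 v : V, v != 0 & forall x, exists k, x = k *: v.
Proof.
move=> dV; have v0 : vpick {:V} != 0 by rewrite vpick0 -dimv_eq0 dV.
exists (vpick {:V}) => // x; apply/vlineP.
suff -> : <[vpick {:V}]>%VS = {:V}%VS by rewrite memvf.
by apply/eqP; rewrite eqEdim subvf dim_vline v0 dV.
Qed.

Section Irreducible.
Variables (R : realType) (P : subfactor_planar_algebra R).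
Hypothesis irr : irreducible_pa P.

Lemma one_box_neq0 s : one_box P 2 s != 0.
Proof.
have [x x0 _] := dim1_line (irr s); apply: contraNneq x0 => one0.
rewrite -(cap_strand x); set y := eval (strandD s) [:: x].
have -> : y = 0.
  rewrite -(mul_1box y) one0; have := @mul_box_linear_l _ P s 1 0 0 y.
  by rewrite scaler0 addr0 scale1r => /eqP; rewrite -subr_eq subrr eq_sym => /eqP.
by rewrite (@eval_eq0 _ P _ _ (capD s) 0%N).
Qed.

Lemma cupcap_neq0 s : cupcap P s != 0.
Proof.
apply: contraNneq (one_box_neq0 (~~ s)) => u0.
by rewrite -fourier_cupcap u0 eval_fourier (@eval_eq0 _ P _ _ (rotationD s) 0%N).
Qed.

(** In the product of the cup-cap diagram and y, the disc y is capped off and so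
  becomes a 1-box, that is, a scalar by irreducibility. *)
Lemma cupcap_mul_scalar s (y : box P (2, s)) :
  exists k, mul_box (cupcap P s) y = k *: cupcap P s.
Proof.
have [v v0 line] := dim1_line (irr s).
have cupE k : eval (cupD s) [:: k *: v] = k *: eval (cupD s) [:: v] :> box P _.
  rewrite -[RHS]addr0 -(@eval_eq0 _ P _ _ (cupD s) 0%N [:: 0]) //.
  by apply: (eval_linear (k := 0%N)) => [//||[]//]; rewrite /= addr0.
have [k yE] := line (eval (capD s) [:: y]).
have [k1 oneE] := line (eval (capD s) [:: one_box P 2 s]).
have uE : cupcap P s = k1 *: eval (cupD s) [:: v].
  by rewrite -(mul_box1 (cupcap P s)) cupcap_mul oneE cupE.
have k10 : k1 != 0.
  by apply: contraNneq (cupcap_neq0 s) => k10; rewrite uE k10 scale0r.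
by exists (k / k1); rewrite cupcap_mul yE cupE uE scalerA divfK.
Qed.

End Irreducible.

(** The type of 2-boxes, renamed so as to carry an algebra structure; the unit is
  nonzero by irreducibility. *)
Definition two_box (R : realType) (P : subfactor_planar_algebra R)
  (irr : irreducible_pa P) (s : bool) : Type := box P (2%N, s).

Section RingStructure.
Variables (R : realType) (P : subfactor_planar_algebra R) (irr : irreducible_pa P) (s : bool).
Notation A := (two_box irr s).

HB.instance Definition _ := Vector.copy A (box P (2%N, s)).

Definition box_mul (a b : A) : A := mul_box a b.

Fact box_mulDl : left_distributive box_mul +%R.
Proof.
move=> a b c; have := @mul_box_linear_l _ P s 1 a b c.
by rewrite !scale1r.
Qed.

Fact box_mulDr : right_distributive box_mul +%R.
Proof.
move=> c a b; have := @mul_box_linear_r _ P s 1 a b c.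
by rewrite !scale1r.
Qed.

HB.instance Definition _ := GRing.Zmodule_isNzRing.Build A
  (@mul_boxA _ P s) (@mul_1box _ P s) (@mul_box1 _ P s) box_mulDl box_mulDr
  (one_box_neq0 irr s).

Fact box_scalerAl (k : complex R) (a b : A) : k *: (a * b) = k *: a * b.
Proof.
have := @mul_box_linear_l _ P s k a 0 b.
rewrite addr0 => E; rewrite [RHS]E.
by rewrite (_ : mul_box 0 b = 0 :> A) ?addr0 //; exact: (mul0r (b : A)).
Qed.

HB.instance Definition _ := GRing.Lmodule_isLalgebra.Build (complex R) A box_scalerAl.

Fact box_scalerAr (k : complex R) (a b : A) : k *: (a * b) = a * (k *: b).
Proof.
have := @mul_box_linear_r _ P s k b 0 a.
rewrite addr0 => E; rewrite [RHS]E.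
by rewrite (_ : mul_box a 0 = 0 :> A) ?addr0 //; exact: (mulr0 (a : A)).
Qed.

HB.instance Definition _ := GRing.Lalgebra_isAlgebra.Build (complex R) A box_scalerAr.

End RingStructure.

(** * Finite-dimensional algebras with a faithful positive trace *)

Section TracialAlgebra.
Variables (R : realType) (P : subfactor_planar_algebra R).
Variables (irr : irreducible_pa P) (s : bool).
Notation C := (complex R).
Notation A := (two_box irr s).
Implicit Types (a b x y z w p q : A) (k : C).

Definition star a : A := star_box a.
Definition tau a : C := tr a.

Lemma star_linear k a b : star (k *: a + b) = Num.conj k *: star a + star b.
Proof. exact: star_antilinear. Qed.

Lemma starbK : involutive star. Proof. exact: starK. Qed.

Lemma star0 : star 0 = 0.
Proof.
have := star_linear 1 0 0; rewrite scaler0 addr0 rmorph1 scale1r => /eqP.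
by rewrite -subr_eq subrr eq_sym => /eqP.
Qed.

Lemma starD : {morph star : a b / a + b}.
Proof. by move=> a b; have := star_linear 1 a b; rewrite rmorph1 !scale1r. Qed.

Lemma starZ k a : star (k *: a) = Num.conj k *: star a.
Proof. by have := star_linear k a 0; rewrite star0 !addr0. Qed.

Lemma starN : {morph star : a / - a}.
Proof. by move=> a; rewrite -scaleN1r starZ rmorphN1 scaleN1r. Qed.

Lemma starB : {morph star : a b / a - b}.
Proof. by move=> a b; rewrite starD starN. Qed.

Lemma starM a b : star (a * b) = star b * star a.
Proof. exact: star_mul_box. Qed.

Lemma star1 : star 1 = 1.
Proof. by rewrite -[LHS]mulr1 -[X in _ * X]starbK -starM mulr1 starbK. Qed.

Lemma tau_linear k a b : tau (k *: a + b) = k * tau a + tau b.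
Proof. exact: tr_linear. Qed.

Lemma tau0 : tau 0 = 0.
Proof.
have := tau_linear 1 0 0; rewrite scaler0 addr0 mul1r => /eqP.
by rewrite -subr_eq subrr eq_sym => /eqP.
Qed.

Lemma tauD : {morph tau : a b / a + b}.
Proof. by move=> a b; have := tau_linear 1 a b; rewrite mul1r scale1r. Qed.

Lemma tauZ k a : tau (k *: a) = k * tau a.
Proof. by have := tau_linear k a 0; rewrite tau0 !addr0. Qed.

Lemma tauN : {morph tau : a / - a}.
Proof. by move=> a; rewrite -scaleN1r tauZ mulN1r. Qed.

Lemma tauB : {morph tau : a b / a - b}.
Proof. by move=> a b; rewrite tauD tauN. Qed.

Lemma tauC a b : tau (a * b) = tau (b * a).
Proof. exact: tr_mulC. Qed.

Lemma tau_star a : tau (star a) = Num.conj (tau a).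
Proof.
have : tau (star a * 1) = Num.conj (tau (star 1 * a)).
  exact: (@inner_product_sym _ P 2 s (1 : A) a).
by rewrite star1 mulr1 mul1r.
Qed.

Lemma tau_gt0 a : a != 0 -> 0 < tau (star a * a).
Proof. exact: inner_product_gt0. Qed.

Lemma tau_ge0 a : 0 <= tau (star a * a).
Proof.
by have [->|/tau_gt0/ltW //] := eqVneq a 0; rewrite mulr0 tau0.
Qed.

Lemma tau_eq0 a : tau (star a * a) = 0 -> a = 0.
Proof. by move=> a0; apply: contra_eq a0 => /tau_gt0; rewrite lt0r => /andP[]. Qed.

Lemma tau1_gt0 : 0 < tau 1.
Proof. by have := tau_gt0 (oner_neq0 A); rewrite star1 mulr1. Qed.

(** ** Positivity

  [psd a] is positivity as an operator by left multiplication, which is what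
  traces give; [positive a] is a factorization, which is what they require.  The
  two are equivalent by spectral theory. *)

Definition psd a : Prop := forall w, 0 <= tau (star w * a * w).
Definition positive a : Prop := exists x, a = star x * x.

Lemma positive_psd a : positive a -> psd a.
Proof.
move=> [x ->] w; have := tau_ge0 (x * w).
by rewrite starM !mulrA.
Qed.

Lemma psdZ k a : 0 <= k -> psd a -> psd (k *: a).
Proof. by move=> k0 Ha w; rewrite -scalerAr -scalerAl tauZ mulr_ge0. Qed.

Lemma psd_conj a w : psd a -> psd (star w * a * w).
Proof. by move=> Ha v; have := Ha (w * v); rewrite starM !mulrA. Qed.

Lemma psd_tau a : psd a -> 0 <= tau a.
Proof. by move=> /(_ 1); rewrite star1 mul1r mulr1. Qed.

(** Polarization, applied to the vectors h and 1. *)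
Lemma tau_form_eq0 h : (forall w, tau (star w * h * w) = 0) -> h = 0.
Proof.
move=> h0; have h1 : tau h = 0 by have := h0 1; rewrite star1 mul1r mulr1.
have hD : tau (star h * h) + tau (h * h) = 0.
  have := h0 (h + 1); rewrite starD star1 !(mulrDl, mulrDr, mul1r, mulr1) !tauD.
  by rewrite h0 h1 addr0 add0r addrC.
have hB : tau (h * h) = tau (star h * h).
  have := h0 (h + 'i *: 1); rewrite starD starZ star1 conjCi.
  rewrite !(mulrDl, mulrDr) -!(scalerAl, scalerAr) !(mul1r, mulr1) !(tauD, tauZ).
  rewrite h0 h1 !mulr0 addr0 add0r mulNr addrC => /eqP.
  by rewrite subr_eq0 (inj_eq (mulfI (neq0Ci _))) eq_sym => /eqP.
apply/tau_eq0/eqP; move/eqP: hD.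
by rewrite hB -mulr2n mulrn_eq0.
Qed.

Lemma psd_star a : psd a -> star a = a.
Proof.
move=> Ha; apply/eqP; rewrite -subr_eq0; apply/eqP/tau_form_eq0 => w.
rewrite mulrBr mulrBl tauB.
have -> : tau (star w * star a * w) = Num.conj (tau (star w * a * w)).
  by rewrite -tau_star !starM starbK mulrA.
by rewrite (CrealP _) ?subrr // ger0_real.
Qed.

Lemma star_positive a : positive a -> star a = a.
Proof. by move=> /positive_psd/psd_star. Qed.

(** ** Polynomials in a self-adjoint element *)

Section Spectrum.
Variable x : A.
Hypothesis x_star : star x = x.
Notation ev := (horner_alg x).
Implicit Types (f g : {poly C}) (rs : seq C).

(** The roots of the minimal polynomial of x, which are real and simple; the
  eigenvectors are the values at x of the cofactors. *)
Definition spectral rs : Prop :=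
  [/\ uniq rs, {in rs, forall r, r \is Num.real},
      ev (\prod_(r <- rs) ('X - r%:P)) = 0
    & forall r, r \in rs -> exists2 y, y != 0 & x * y = r *: y
        /\ y = ev (\prod_(r' <- rem r rs) ('X - r'%:P))].

Lemma ev_comm f g : ev f * ev g = ev g * ev f.
Proof. by rewrite -!rmorphM mulrC. Qed.

Lemma evXsubC r : ev ('X - r%:P) = x - r *: 1.
Proof. by rewrite rmorphB /= horner_algX horner_algC. Qed.

Lemma annihilating_poly : exists2 f, f != 0 & ev f = 0.
Proof.
apply: contrapT => no_f; pose n := \dim {:A}.
pose X := [tuple x ^+ i | i < n.+1].
have : (size X <= n)%N.
  suff /eqP <- : free X by apply: dimvS; apply: subvf.
  apply/freeP => k k0; pose f := \poly_(i < n.+1) k (inord i).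
  have fi (i : 'I_n.+1) : f`_i = k i.
    by rewrite coef_poly ltn_ord inord_val.
  have f0 : f = 0.
    apply/eqP/negPn/negP => f0; apply: no_f; exists f => //.
    rewrite -k0 /f poly_def rmorph_sum /=; apply: eq_bigr => i _.
    rewrite -mul_polyC rmorphM /= horner_algC rmorphXn /= horner_algX -scalerAl mul1r.
    by rewrite inord_val /X nth_mktuple.
  by move=> i; rewrite -fi f0 coef0.
by rewrite size_tuple ltnn.
Qed.

(** The spectrum is taken as a shortest list of scalars r such that the product of
  the x - r vanishes, so that no cofactor does.  It is real since x is
  self-adjoint, and a repeated scalar r could be dropped because (x - r)^2 y = 0
  implies (x - r) y = 0. *)
Lemma spectral_exists : exists rs, spectral rs.
Proof.
have [rs0 rs0_ev] : exists rs, ev (\prod_(r <- rs) ('X - r%:P)) = 0.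
  have [f f0 evf] := annihilating_poly.
  have [rs fE] := closed_field_poly_normal f; exists rs.
  move: evf; rewrite {1}fE -mul_polyC rmorphM /= horner_algC -scalerAl mul1r => /eqP.
  by rewrite scaler_eq0 lead_coef_eq0 (negbTE f0) => /eqP.
pose ann n := `[< exists2 rs, size rs = n & ev (\prod_(r <- rs) ('X - r%:P)) = 0 >].
have ex_ann : exists n, ann n by exists (size rs0); apply/asboolP; exists rs0.
case: (ex_minnP ex_ann) => n /asboolP[rs sz rs_ev] min_n.
have cofactor r : r \in rs -> ev (\prod_(r' <- rem r rs) ('X - r'%:P)) != 0.
  move=> rrs; apply/eqP => evr.
  have /min_n : ann (size (rem r rs)) by apply/asboolP; exists (rem r rs).
  rewrite size_rem // -sz; case: rs rrs {sz rs_ev evr} => //= ? ? _; lia.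
have eig r : r \in rs -> x * ev (\prod_(r' <- rem r rs) ('X - r'%:P))
    = r *: ev (\prod_(r' <- rem r rs) ('X - r'%:P)).
  move=> rrs; apply/eqP; rewrite -subr_eq0 -[X in _ - r *: X]mul1r scalerAl -mulrBl.
  rewrite -evXsubC -rmorphM /=; apply/eqP.
  by rewrite -[RHS]rs_ev (perm_big _ (perm_to_rem rrs)) big_cons.
have real r : r \in rs -> r \is Num.real.
  move=> rrs; set y := ev (\prod_(r' <- rem r rs) ('X - r'%:P)).
  have y0 := tau_gt0 (cofactor r rrs); rewrite -/y in y0.
  have E : tau (star y * x * y) = r * tau (star y * y).
    by rewrite -mulrA eig // -scalerAr tauZ.
  have : Num.conj (tau (star y * x * y)) = tau (star y * x * y).
    by rewrite -tau_star !starM starbK x_star mulrA.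
  rewrite E rmorphM /= (CrealP (gtr0_real y0)) => /(mulIf (lt0r_neq0 y0)) rr.
  exact/CrealP.
exists rs; split=> //; last first.
  by move=> r rrs; exists (ev (\prod_(r' <- rem r rs) ('X - r'%:P))); rewrite ?cofactor ?eig.
apply/negPn/negP => nuniq.
have [r rrs rrem] : exists2 r, r \in rs & r \in rem r rs.
  apply: contrapT => no_r; move/negP: nuniq; apply; apply: count_mem_uniq => r.
  case: (boolP (r \in rs)) => [rrs|/count_memPn //].
  rewrite (permP (perm_to_rem rrs)) /= eqxx; congr _.+1; apply/count_memPn.
  by apply/negP => rrem; apply: no_r; exists r.
set y := ev (\prod_(r' <- rem r (rem r rs)) ('X - r'%:P)).
have yE : (x - r *: 1) * y = ev (\prod_(r' <- rem r rs) ('X - r'%:P)).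
  by rewrite -evXsubC -rmorphM /= (perm_big _ (perm_to_rem rrem)) big_cons.
have : ev (\prod_(r' <- rem r rs) ('X - r'%:P)) = 0; last by apply/eqP/cofactor.
apply: tau_eq0; rewrite -{1}yE starM starB starZ star1 x_star (CrealP (real r rrs)).
by rewrite -mulrA mulrBl eig // -scalerAl mul1r subrr mulr0 tau0.
Qed.

Lemma interpolation rs (h : C -> C) : uniq rs ->
  exists f : {poly C}, {in rs, forall r, f.[r] = h r}.
Proof.
elim: rs => [|r rs IHrs] /=; first by exists 0.
case/andP=> r_rs /IHrs[f fE]; pose p := \prod_(r' <- rs) ('X - r'%:P).
have pr : p.[r] != 0 by rewrite -rootE root_prod_XsubC.
exists (f + ((h r - f.[r]) / p.[r]) *: p) => r'.
rewrite inE hornerD hornerZ => /predU1P[->|r'rs]; first by rewrite divfK // addrC subrK.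
have -> : p.[r'] = 0 by apply/eqP; rewrite -rootE root_prod_XsubC.
by rewrite mulr0 addr0 fE.
Qed.

Section Calculus.
Variable rs : seq C.
Hypothesis rs_x : spectral rs.

(** Functional calculus: an element f(x) only depends on f on the spectrum. *)
Lemma ev_eq f g : {in rs, forall r, f.[r] = g.[r]} -> ev f = ev g.
Proof.
case: rs_x => rs_uniq _ ev0 _ fg; apply/eqP; rewrite -subr_eq0 -rmorphB.
have : \prod_(r <- rs) ('X - r%:P) %| (f - g).
  apply: uniq_roots_dvdp; last by rewrite uniq_rootsE.
  by apply/allP => r rrs; rewrite rootE hornerD hornerN fg ?subrr.
by case/dvdpP => q ->; rewrite rmorphM /= ev0 mulr0.
Qed.

Lemma star_ev f : star (ev f) = ev (map_poly Num.conj f).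
Proof.
elim/poly_ind: f => [|f c IHf]; first by rewrite map_poly0 !rmorph0 star0.
rewrite !(rmorphD, rmorphM) /= map_polyX map_polyC !horner_algX !horner_algC.
rewrite starD starM starZ star1 IHf x_star; congr (_ + _).
by have := ev_comm 'X (map_poly Num.conj f); rewrite horner_algX.
Qed.

Lemma ev_real f : {in rs, forall r, f.[r] \is Num.real} -> star (ev f) = ev f.
Proof.
case: (rs_x) => _ rs_real _ _ f_real; rewrite star_ev; apply: ev_eq => r rrs.
rewrite -{1}(CrealP (rs_real r rrs)) horner_map.
exact/CrealP/f_real.
Qed.

Lemma ev_id : ev 'X = x. Proof. exact: horner_algX. Qed.

Lemma spectrum_ge0 : psd x -> {in rs, forall r, 0 <= r}.
Proof.
case: (rs_x) => _ _ _ eig psd_x r /eig[y y0 [xy _]].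
have := psd_x y; rewrite -mulrA xy -scalerAr tauZ.
by rewrite pmulr_lge0 // tau_gt0.
Qed.

(** The square root is a polynomial interpolating the square roots of the values
  on the spectrum. *)
Lemma ev_positive f : {in rs, forall r, 0 <= f.[r]} -> positive (ev f).
Proof.
case: (rs_x) => rs_uniq _ _ _ f0.
have [g gE] := interpolation (fun r => sqrtC f.[r]) rs_uniq.
exists (ev g); rewrite (@ev_real g) => [|r rrs].
  rewrite -rmorphM /=; apply: ev_eq => r rrs.
  by rewrite hornerM gE // -expr2 sqrtCK.
by rewrite gE // ger0_real // sqrtC_ge0 f0.
Qed.

End Calculus.

Lemma psd_positive_sa : psd x -> positive x.
Proof.
have [rs rs_x] := spectral_exists; move=> psd_x.
rewrite -ev_id; apply: (ev_positive rs_x) => r rrs.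
by rewrite hornerX; apply: spectrum_ge0 rs_x psd_x _ rrs.
Qed.

Lemma max_spectrum (rs : seq C) : {in rs, forall r, 0 <= r} -> rs != [::] ->
  exists2 m, m \in rs & {in rs, forall r, r <= m}.
Proof.
elim: rs => // r [_ _ _|r' rs IHrs rs0 _].
  by exists r; rewrite ?inE // => r'; rewrite inE => /eqP ->.
have [|//|m mrs mP] := IHrs; first by move=> t trs; apply: rs0; rewrite inE trs orbT.
have mge : 0 <= m by apply: rs0; rewrite inE mrs orbT.
have rge : 0 <= r by apply: rs0; rewrite mem_head.
have /orP[rm|mr] : (r <= m) || (m <= r) by apply: real_leVge; apply: ger0_real.
  exists m; first by rewrite inE mrs orbT.
  by move=> t; rewrite inE => /predU1P[-> //|/mP].
exists r; first exact: mem_head.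
by move=> t; rewrite inE => /predU1P[-> //|/mP /le_trans ->].
Qed.

(** The spectral projection of the greatest eigenvalue. *)
Lemma top_projection : psd x -> x != 0 ->
  exists m p, [/\ 0 < m, p != 0, p * p = p /\ star p = p,
    x * p = m *: p /\ positive (m *: 1 - x)
    & positive (x - m *: p) /\ forall z, (m *: 1 - x) * z = 0 -> p * z = z].
Proof.
move=> psd_x x0; have [rs rs_x] := spectral_exists.
have rs0 := spectrum_ge0 rs_x psd_x.
have [rs_uniq rs_real _ eig] := rs_x.
have rs_neq : rs != [::].
  apply: contraNneq x0 => rsE; rewrite -ev_id -(rmorph0 ev).
  by apply/eqP/(ev_eq rs_x) => r; rewrite rsE.
have [m mrs mP] := max_spectrum rs0 rs_neq.
have m_gt0 : 0 < m.
  rewrite lt0r rs0 // andbT; apply: contraNneq x0 => m0.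
  rewrite -ev_id -(rmorph0 ev); apply/eqP/(ev_eq rs_x) => r rrs.
  by rewrite hornerX horner0; apply/le_anti; rewrite rs0 // -m0 mP.
have [g gE] := interpolation (fun r => (r == m)%:R) rs_uniq.
have mxE : m *: 1 - x = ev (m%:P - 'X) by rewrite rmorphB /= horner_algC horner_algX.
exists m, (ev g); split=> //.
- have [y y0 [_ yE]] := eig m mrs; apply: contraNneq y0 => evg0.
  pose c := (\prod_(r' <- rem m rs) ('X - r'%:P)).[m].
  have -> : y = ev (c *: g).
    rewrite yE; apply: (ev_eq rs_x) => r rrs; rewrite hornerZ gE //.
    have [->|rm] := eqVneq r m; first by rewrite mulr1.
    rewrite mulr0; apply/eqP; rewrite -rootE root_prod_XsubC.
    by rewrite mem_rem_uniq // inE rm.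
  by rewrite -mul_polyC rmorphM /= evg0 mulr0.
- split; last by apply: (ev_real rs_x) => r rrs; rewrite gE // realn.
  rewrite -rmorphM /=; apply: (ev_eq rs_x) => r rrs.
  by rewrite hornerM gE //; case: eqP; rewrite ?mulr1 ?mulr0.
- split.
    rewrite -{1}ev_id -rmorphM /= -[ev g in RHS]mul1r scalerAl -(horner_algC x) -rmorphM /=.
    apply: (ev_eq rs_x) => r rrs; rewrite !hornerM hornerX hornerC gE //.
    by case: eqP => [->|_]; rewrite ?mulr0.
  rewrite mxE; apply: (ev_positive rs_x) => r rrs.
  by rewrite hornerD hornerN hornerX hornerC subr_ge0 mP.
- split.
    have -> : x - m *: ev g = ev ('X - m *: g).
      by rewrite -mul_polyC rmorphB rmorphM /= horner_algX horner_algC -scalerAl mul1r.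
    apply: (ev_positive rs_x) => r rrs.
    rewrite hornerD hornerN hornerX hornerZ gE //.
    by case: eqP => [->|_]; rewrite ?mulr1 ?mulr0 ?subrr // subr0 rs0.
  move=> z mxz; have : root (g - 1) m.
    by rewrite rootE hornerD hornerN hornerC gE // eqxx subrr.
  case/factor_theorem => q qE; apply/eqP; rewrite -subr_eq0 -[X in _ - X]mul1r -mulrBl.
  rewrite -(rmorph1 ev) -rmorphB /= qE rmorphM /= -opprB rmorphN /= mulrN mulNr.
  by rewrite -mxE -mulrA mxz mulr0 oppr0.
Qed.

End Spectrum.

End TracialAlgebra.

Section Projections.
Variables (R : realType) (P : subfactor_planar_algebra R).
Variables (irr : irreducible_pa P) (s : bool).
Notation C := (complex R).
Notation A := (two_box irr s).
Implicit Types (a b x y z w p q : A) (k : C).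

Definition proj p : Prop := p * p = p /\ star p = p.

Lemma proj_positive p : proj p -> positive p.
Proof. by case=> pp ps; exists p; rewrite ps pp. Qed.

Lemma proj_tau_gt0 p : proj p -> p != 0 -> 0 < tau p.
Proof. by case=> pp ps /tau_gt0; rewrite ps pp. Qed.

Lemma positive_tau_gt0 x : positive x -> x != 0 -> 0 < tau x.
Proof.
case=> y ->; have [->|y0 _] := eqVneq y 0; first by rewrite mulr0 eqxx.
exact: tau_gt0.
Qed.

Lemma psd_positive x : psd x -> positive x.
Proof. by move=> psd_x; apply: psd_positive_sa => //; apply: psd_star. Qed.

Lemma positiveZ k x : 0 <= k -> positive x -> positive (k *: x).
Proof. by move=> k0 /positive_psd sx; apply/psd_positive/psdZ. Qed.

Lemma positive_mul_eq0 a b : positive a -> positive b -> tau (a * b) = 0 -> a * b = 0.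
Proof.
case=> x -> [y ->] E; have : x * star y = 0.
  apply: tau_eq0; rewrite starM starbK -[RHS]E.
  by rewrite -!mulrA [in RHS]mulrA [RHS]tauC !mulrA tauC !mulrA.
by move=> xy; rewrite -mulrA (mulrA x) xy mul0r mulr0.
Qed.

(** If the corner at w of a sum of two positive elements vanishes, so do both
  corners, and a positive element with zero corner at w annihilates w. *)
Lemma psd_add_eq0 a b w : psd a -> psd b -> star w * (a + b) * w = 0 -> a * w = 0.
Proof.
move=> psd_a psd_b ab0.
have : star w * a * w = 0.
  apply: tau_form_eq0 => v; apply/le_anti/andP; split; last exact: psd_conj.
  have := congr1 (fun c => tau (star v * c * v)) ab0.
  rewrite mulrDr mulrDl mulrDr mulrDl tauD mulr0 mul0r tau0 => /eqP.
  rewrite addr_eq0 => /eqP ->; rewrite oppr_le0; exact: psd_conj.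
have [y ->] := psd_positive psd_a => yw0.
suff yw : y * w = 0 by rewrite -mulrA yw mulr0.
by apply: tau_eq0; rewrite starM -[RHS](tau0 irr s) -yw0 !mulrA.
Qed.

Lemma proj_le p q : proj p -> proj q -> positive (q - p) -> q * p = p.
Proof.
move=> [pp ps] [qq qs] /positive_psd qp.
have : p * (1 - q) = 0.
  apply: (psd_add_eq0 (b := q - p)) => //; first exact/positive_psd/proj_positive.
  by rewrite [p + _]addrC subrK starB star1 qs mulrBl mul1r qq subrr mul0r.
rewrite mulrBr mulr1 => /eqP; rewrite subr_eq0 => /eqP /(congr1 (@star _ _ irr s)).
by rewrite starM ps qs.
Qed.

Lemma le_proj p q : proj p -> proj q -> q * p = p -> positive (q - p).
Proof.
move=> [pp ps] [qq qs] qp; have pq : p * q = p by rewrite -ps -[in RHS]qp starM ps qs.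
exists (q - p); rewrite starB ps qs mulrBl !mulrBr qq qp pq pp subrr subr0 //.
Qed.

Lemma projC p : proj p -> proj (1 - p).
Proof.
move=> [pp ps]; split; last by rewrite starB star1 ps.
by rewrite mulrBl mul1r mulrBr mulr1 pp subrr subr0.
Qed.

Lemma projB p q : proj p -> proj q -> q * p = p -> proj (q - p).
Proof.
move=> [pp ps] [qq qs] qp; have pq : p * q = p by rewrite -ps -[in RHS]qp starM ps qs.
by split; rewrite ?starB ?ps ?qs // mulrBl !mulrBr qq qp pq pp subrr subr0.
Qed.

Lemma projM p q : proj p -> proj q -> p * q = q * p -> proj (p * q).
Proof.
move=> [pp ps] [qq qs] pq; split; last by rewrite starM ps qs pq.
by rewrite -mulrA (mulrA q) -pq -(mulrA p q q) qq mulrA pp.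
Qed.

(** The cup-cap diagram u spans a right ideal u A = C u, so h = u u* is a nonzero
  multiple of u with h^2 = k h and k > 0, and h / k is a projection. *)
Lemma cupcap_projection (u : A) : u = cupcap P s :> box P (2%N, s) ->
  exists e k, [/\ proj e, e != 0, k != 0 /\ e = k *: u & forall y, exists t, e * y = t *: e].
Proof.
move=> uE; have u0 : u != 0 by rewrite uE; apply: cupcap_neq0 irr s.
have mul_u y : exists t, u * y = t *: u.
  by have [t tE] := cupcap_mul_scalar irr (y : box P (2%N, s)); exists t; rewrite uE.
pose h := u * star u; have [k hE] := mul_u (star u); rewrite -/h in hE.
have su0 : star u != 0 by apply: contraNneq u0 => su; rewrite -(starbK u) su star0.
have h_sq : positive h by exists (star u); rewrite starbK.
have h0 : h != 0.
  by apply: contraTneq (tau_gt0 su0) => h0; rewrite starbK -/h h0 tau0 ltxx.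
have hs := star_positive h_sq.
have mul_h y : exists t, h * y = t *: h.
  have [t tE] := mul_u y; exists t.
  by rewrite hE -scalerAl tE !scalerA mulrC.
have [k' hhE] := mul_h h.
have k'_gt0 : 0 < k'.
  have := tau_gt0 h0; rewrite hs hhE tauZ.
  by rewrite pmulr_lgt0 // positive_tau_gt0.
have k0 : k != 0 by apply: contraNneq h0 => k0; rewrite hE k0 scale0r.
exists (k'^-1 *: h), (k'^-1 * k); split.
- split.
    by rewrite -scalerAl -scalerAr hhE !scalerA mulrVK ?unitfE ?lt0r_neq0 // mulVr.
  by rewrite starZ hs (CrealP _) // realV gtr0_real.
- by rewrite scaler_eq0 invr_eq0 negb_or h0 lt0r_neq0.
- by split; [rewrite mulf_neq0 // invr_eq0 lt0r_neq0|rewrite hE scalerA].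
- move=> y; have [t tE] := mul_h y; exists t.
  by rewrite -scalerAl tE !scalerA mulrC.
Qed.

End Projections.

(** * Convolution of 2-boxes and biprojections *)

Section Convolution.
Variables (R : realType) (P : subfactor_planar_algebra R).
Variables (irr : irreducible_pa P) (s : bool).
Notation C := (complex R).
Notation A := (two_box irr s).
Notation B := (two_box irr (~~ s)).
Implicit Types (a b c x y z w p q r : A) (k : C).

Definition four a : B := fourier a.
Definition unfour (y : B) : A := inv_fourier y.

Lemma fourK : cancel four unfour. Proof. exact: fourierK. Qed.
Lemma unfourK : cancel unfour four. Proof. exact: inv_fourierK. Qed.

Lemma four_linear k a b : four (k *: a + b) = k *: four a + four b.
Proof. exact: fourier_linear. Qed.

Lemma four0 : four 0 = 0.
Proof.
have := four_linear 1 0 0; rewrite scaler0 addr0 scale1r => /eqP.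
by rewrite -subr_eq subrr eq_sym => /eqP.
Qed.

Lemma fourZ k a : four (k *: a) = k *: four a.
Proof. by have := four_linear k a 0; rewrite four0 !addr0. Qed.

Lemma fourD a b : four (a + b) = four a + four b.
Proof. by have := four_linear 1 a b; rewrite !scale1r. Qed.

Lemma four_eq0 a : four a = 0 -> a = 0.
Proof. by move=> a0; rewrite -(fourK a) a0 -four0 fourK. Qed.

Lemma four_isometry a b : tau (star (four b) * four a) = tau (star b * a).
Proof. exact: fourier_isometry. Qed.

(** The coproduct of the planar algebra: the product of the other shading carried
  over by the Fourier transform. *)
Definition conv a b : A := unfour (four a * four b).

Lemma four_conv a b : four (conv a b) = four a * four b.
Proof. exact: unfourK. Qed.

Lemma conv_eq a b c : four c = four a * four b -> conv a b = c.
Proof. by rewrite /conv => <-; rewrite fourK. Qed.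

Lemma convDl a b c : conv (a + b) c = conv a c + conv b c.
Proof. by apply: conv_eq; rewrite fourD !four_conv fourD mulrDl. Qed.

Lemma convDr a b c : conv c (a + b) = conv c a + conv c b.
Proof. by apply: conv_eq; rewrite fourD !four_conv fourD mulrDr. Qed.

Lemma schur_psd a b : positive a -> positive b -> psd (conv a b).
Proof.
move=> [x ->] [y ->] w; rewrite -mulrA tauC -mulrA tauC.
exact: schur_product_trace.
Qed.

(** When the Fourier transform of y is self-adjoint, so is the operator of right
  convolution by y. *)
Lemma conv_adjoint x y r : star (four y) = four y ->
  tau (star r * conv x y) = tau (star (conv r y) * x).
Proof.
move=> ys; rewrite -!four_isometry !four_conv starM ys.
by rewrite mulrA tauC !mulrA.
Qed.

(** The Jones projection: it is the unit for the convolution up to the factor k,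
  and the multiplication by any element scales it. *)
Definition jones e k : Prop :=
  [/\ proj e, e != 0, k != 0, four e = k *: 1 & forall y, exists t, e * y = t *: e].

Lemma jones_projection : exists e k, jones e k.
Proof.
have [e [k [e_proj e0 [k0 eE] e_min]]] :=
  @cupcap_projection _ _ irr s (cupcap P s : A) erefl.
exists e, k; split=> //.
by rewrite eE fourZ; congr (_ *: _); apply: fourier_cupcap.
Qed.

Lemma conv_jonesl e k y : jones e k -> conv e y = k *: y.
Proof. by case=> _ _ _ Fe _; apply: conv_eq; rewrite Fe fourZ -scalerAl mul1r. Qed.

Lemma conv_jonesr e k y : jones e k -> conv y e = k *: y.
Proof. by case=> _ _ _ Fe _; apply: conv_eq; rewrite Fe fourZ -scalerAr mulr1. Qed.

Lemma jones_absorb e k y r : jones e k -> tau (e * y) != 0 -> r * y = y -> e * r = e.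
Proof.
case=> _ _ _ _ /(_ r)[t tE] ey0 ry; suff t1 : t = 1 by rewrite tE t1 scale1r.
by apply: (mulIf ey0); rewrite mul1r -{2}ry mulrA tE -scalerAl tauZ.
Qed.

Lemma four_one_projection :
  exists e k, [/\ proj e, e != 0, k != 0 /\ four 1 = k *: e
    & forall y : B, exists t, e * y = t *: e].
Proof.
have [e [k [e_proj e0 [k0 eE] e_min]]] :=
  @cupcap_projection _ _ irr (~~ s) (cupcap P (~~ s) : B) erefl.
exists e, k^-1; split=> //; split; first by rewrite invr_eq0.
rewrite eE scalerA mulVf // scale1r; exact: fourier_one.
Qed.

(** The transform of 1 is also a Jones projection, up to a factor, and the
  character y |-> t with e y = t e is multiplicative; composed with the transform
  it is proportional to the trace. *)
Lemma tau_conv : exists2 k, k != 0 & forall a b, tau (conv a b) = k * (tau a * tau b).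
Proof.
have [e [k [e_proj e0 [k0 FE] e_min]]] := four_one_projection.
have te := proj_tau_gt0 e_proj e0; have te0 := lt0r_neq0 te.
have tE a : tau a = Num.conj k * tau (e * four a).
  rewrite -[a in LHS]mul1r -[X in X * a]star1 -four_isometry FE starZ -scalerAl tauZ.
  by case: e_proj => _ ->.
have kc0 : Num.conj k != 0 by rewrite fmorph_eq0.
exists ((Num.conj k * tau e)^-1) => [|a b].
  by rewrite invr_eq0 mulf_neq0.
rewrite !tE four_conv mulrA; have [t ->] := e_min (four a).
rewrite -scalerAl !tauZ; field.
by rewrite te0.
Qed.

(** A positive x whose transform is a multiple of a projection is itself one.

  It satisfies x o x = l x.  For a group this says that x is, up to a
  factor, a probability measure equal to its own convolution square; such a
  measure is constant on its support by the maximum principle, and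
  the same argument works here.  Let m be the greatest
  eigenvalue of x and r its spectral projection.  Since r o x is the adjoint
  convolution applied to r, tr (x (r o x)) = tr (r (x o x)) = l m tr r, while
  tr (r o x) = l tr r: so tr ((m - x) (r o x)) = 0, and both factors being
  positive, r o x lies under r.  It has a nonzero component along the Jones
  projection e, hence e <= r.  Then r o x = e o x + (r - e) o x is a sum of
  positive elements, of which the first is a multiple of x.  So x lies under r,
  which means x = m r. *)
Lemma projection_from_transform x (q : B) (l : C) :
  positive x -> x != 0 -> 0 < l -> proj q -> four x = l *: q ->
  exists m p, [/\ 0 < m, proj p & x = m *: p].
Proof.
move=> x_sq x0 l_gt0 [qq qs] Fx; have xs := star_positive x_sq.
have Fxs : star (four x) = four x by rewrite Fx starZ qs (CrealP (gtr0_real l_gt0)).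
have psd_x := positive_psd x_sq.
have [e [c e_jones]] := jones_projection; have [e_proj e0 c0 _ _] := e_jones.
have [K K0 tau_convE] := tau_conv.
have tx := positive_tau_gt0 x_sq x0.
have xx : conv x x = l *: x.
  by apply: conv_eq; rewrite fourZ Fx -scalerAl -scalerAr qq.
have lE : l = K * tau x.
  have := tau_convE x x; rewrite xx tauZ mulrA => /(mulIf (lt0r_neq0 tx)) //.
have [m [r [m_gt0 r0 r_proj [xr mx_sq] [xr_sq top]]]] := top_projection xs psd_x x0.
have tr_gt0 := proj_tau_gt0 r_proj r0; have r_sq := proj_positive r_proj.
have [rr rs] := r_proj.
have psd_z : psd (conv r x) by apply: schur_psd.
have z_sq := psd_positive psd_z; have zs := star_positive z_sq.
have rz : r * conv r x = conv r x.
  apply: top; apply: positive_mul_eq0 => //.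
  rewrite mulrBl -scalerAl mul1r tauB tauZ tau_convE.
  have -> : tau (x * conv r x) = m * l * tau r.
    rewrite tauC -{1}zs -conv_adjoint // xx rs -scalerAr tauZ tauC xr tauZ.
    by ring.
  by rewrite lE; ring.
have er : e * r = e.
  apply: (jones_absorb e_jones) rz; rewrite -{1}(proj2 e_proj) conv_adjoint //.
  rewrite (conv_jonesl x e_jones) starZ xs -scalerAl xr !tauZ.
  have [m0 tr0] := (lt0r_neq0 m_gt0, lt0r_neq0 tr_gt0).
  by rewrite mulf_neq0 ?fmorph_eq0 // mulf_neq0.
have re : r * e = e by rewrite -{1}(proj2 e_proj) -{1}rs -starM er (proj2 e_proj).
have xr1 : x * (1 - r) = 0.
  have : conv e x * (1 - r) = 0.
    apply: (psd_add_eq0 (b := conv (r - e) x)).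
    - by apply: schur_psd => //; apply: proj_positive.
    - by apply: schur_psd => //; apply/proj_positive/projB.
    - rewrite -convDl [e + _]addrC subrK starB star1 rs mulrBl mul1r rz.
      by rewrite subrr mul0r.
  rewrite (conv_jonesl x e_jones) -scalerAl => /eqP.
  by rewrite scaler_eq0 (negbTE c0) => /eqP.
exists m, r; split=> //.
by move/eqP: xr1; rewrite mulrBr mulr1 subr_eq0 xr => /eqP.
Qed.

Definition multiple_of_projection (y : B) : Prop :=
  exists (l : C) (q : B), [/\ 0 < l, proj q & y = l *: q].

Definition biproj b : Prop := [/\ b != 0, proj b & multiple_of_projection (four b)].

Lemma biproj_four_star b : biproj b -> star (four b) = four b.
Proof.
by case=> _ _ [l [q [l0 [_ qs] ->]]]; rewrite starZ qs (CrealP (gtr0_real l0)).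
Qed.

Lemma biproj_four_positive b : biproj b -> positive (four b).
Proof.
by case=> _ _ [l [q [l0 /proj_positive q_sq ->]]]; apply: positiveZ => //; apply: ltW.
Qed.

Lemma biproj1 : biproj 1.
Proof.
split; first exact: oner_neq0.
  by split; rewrite ?mulr1 ?star1.
have [e [k [e_proj e0 [k0 FE] e_min]]] := four_one_projection.
exists k, e; split=> //.
have one_sq : positive (1 : A) by exists 1; rewrite star1 mulr1.
have /psd_tau : psd (conv 1 1) by apply: schur_psd.
have -> : conv 1 1 = k *: 1.
  by apply: conv_eq; rewrite fourZ FE -scalerAl -scalerAr (proj1 e_proj).
by rewrite tauZ pmulr_lge0 ?tau1_gt0 // lt0r k0.
Qed.

(** Indeed tr (e b) is, up to a factor, the trace of the transform of b. *)
Lemma biproj_ge_jones e k b : jones e k -> biproj b -> e * b = e.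
Proof.
move=> e_jones [b0 [bb bs] [l [q [l0 q_proj Fb]]]].
have [[_ es] e0 c0 Fe _] := e_jones.
have q0 : q != 0.
  by apply: contraNneq b0 => q0; apply/eqP/four_eq0; rewrite Fb q0 scaler0.
apply: (jones_absorb e_jones) bb.
rewrite -{1}es -four_isometry Fe Fb starZ star1 -scalerAl -scalerAr mul1r.
have [l_neq0 tq0] := (lt0r_neq0 l0, lt0r_neq0 (proj_tau_gt0 q_proj q0)).
by rewrite !tauZ mulf_neq0 ?fmorph_eq0 // mulf_neq0.
Qed.

(** For subgroups H and K with H K = K H, this says that the convolution of their
  indicator functions is a multiple of that of the subgroup H K.  Comparison with
  b o e and e o c shows that r lies above b and c. *)
Lemma conv_biproj b c : biproj b -> biproj c ->
  four b * four c = four c * four b ->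
  exists m r, [/\ 0 < m, biproj r, conv b c = m *: r, r * b = b & r * c = c].
Proof.
move=> b_bi c_bi bc.
have [b0 b_proj [l [q [l0 q_proj Fb]]]] := b_bi.
have [c0 c_proj [l' [q' [l'0 q'_proj Fc]]]] := c_bi.
have [e [k e_jones]] := jones_projection; have [e_proj e0 k0 _ _] := e_jones.
have b_sq := proj_positive b_proj; have c_sq := proj_positive c_proj.
have qq' : q * q' = q' * q.
  move: bc; rewrite Fb Fc -!(scalerAl, scalerAr) !scalerA mulrC.
  by apply: scalerI; rewrite mulf_neq0 // lt0r_neq0.
have [K K0 tau_convE] := tau_conv.
have x0 : conv b c != 0.
  apply/eqP => x0; have := tau_convE b c; rewrite x0 tau0 => /esym/eqP.
  rewrite mulf_eq0 (negbTE K0) mulf_eq0.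
  by rewrite (gt_eqF (positive_tau_gt0 b_sq b0)) (gt_eqF (positive_tau_gt0 c_sq c0)).
have x_sq : positive (conv b c) by apply/psd_positive/schur_psd.
have Fx : four (conv b c) = (l * l') *: (q * q').
  by rewrite four_conv Fb Fc -scalerAl -scalerAr scalerA.
have [m [r [m0 r_proj xE]]] :=
  projection_from_transform x_sq x0 (mulr_gt0 l0 l'0) (projM q_proj q'_proj qq') Fx.
have [rr rs] := r_proj.
have xr0 : star (1 - r) * conv b c * (1 - r) = 0.
  by rewrite xE -mulrA -scalerAl mulrBr mulr1 rr subrr scaler0 mulr0.
have below a : star a = a -> k *: a * (1 - r) = 0 -> r * a = a.
  move=> as_ /eqP; rewrite -scalerAl scaler_eq0 (negbTE k0) mulrBr mulr1 subr_eq0 => /eqP ar.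
  by rewrite -{1}as_ -rs -starM -ar as_.
have e_sq := proj_positive e_proj.
have sub a : biproj a -> positive (a - e).
  move=> a_bi; have [_ a_proj _] := a_bi.
  apply/proj_positive/projB => //; rewrite -{1}(proj2 e_proj) -{1}(proj2 a_proj).
  by rewrite -starM (biproj_ge_jones e_jones a_bi) (proj2 e_proj).
exists m, r; split=> //.
- split=> //; first by apply: contraNneq x0 => r0; rewrite xE r0 scaler0.
  exists (m^-1 * (l * l')), (q * q'); split; [|exact: projM|].
    by rewrite !mulr_gt0 ?invr_gt0.
  by rewrite -scalerA -Fx xE fourZ scalerA (mulVf (lt0r_neq0 m0)) scale1r.
- apply: below; first exact: (proj2 b_proj).
  rewrite -(conv_jonesr b e_jones); apply: (psd_add_eq0 (b := conv b (c - e))).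
  + exact: schur_psd.
  + by apply: schur_psd => //; apply: sub.
  + by rewrite -convDr [e + _]addrC subrK.
- apply: below; first exact: (proj2 c_proj).
  rewrite -(conv_jonesl c e_jones); apply: (psd_add_eq0 (b := conv (b - e) c)).
  + exact: schur_psd.
  + by apply: schur_psd => //; apply: sub.
  + by rewrite -convDl [e + _]addrC subrK.
Qed.

(** For subgroups H and K whose join is the whole group G, this is the formula
  |H| |K| = |H K| |G|, with the intersection of H and K as a product of
  indicators.  Both tr (b o c) and tr (e (b o c)) are computed, and the factors
  are found by comparison with b = c = 1. *)
Lemma tau_mul_biproj b c : biproj b -> biproj c ->
  four b * four c = four c * four b ->
  (forall r, biproj r -> r * b = b -> r * c = c -> r = 1) ->
  tau b * tau c = tau (b * c) * tau (1 : A).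
Proof.
have [e [k e_jones]] := jones_projection; have [e_proj e0 k0 _ _] := e_jones.
have te := lt0r_neq0 (proj_tau_gt0 e_proj e0).
have kc0 : Num.conj k != 0 by rewrite fmorph_eq0.
have t1 : tau (1 : A) != 0 by rewrite lt0r_neq0 // tau1_gt0.
have [K K0 tau_convE] := tau_conv.
have key a d : biproj a -> biproj d -> four a * four d = four d * four a ->
    (forall r, biproj r -> r * a = a -> r * d = d -> r = 1) ->
    K * (tau a * tau d) * tau e = Num.conj k * tau (d * a) * tau (1 : A).
  move=> a_bi d_bi ad top; have [m [r [m0 r_bi xE ra rd]]] := conv_biproj a_bi d_bi ad.
  rewrite -tau_convE; have : tau (star e * conv a d) = Num.conj k * tau (d * a).
    rewrite conv_adjoint ?biproj_four_star // (conv_jonesl d e_jones) starZ -scalerAl tauZ.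
    by have [_ [_ ->] _] := d_bi.
  move=> <-; rewrite xE (top r) // (proj2 e_proj) -scalerAr mulr1 !tauZ.
  by ring.
move=> b_bi c_bi bc top.
have kE : Num.conj k = K * tau e.
  have := key 1 1 biproj1 biproj1 erefl; rewrite mulr1 => /(_ _) E.
  apply: (mulIf (mulf_neq0 t1 t1)); rewrite mulrA -E; first by ring.
  by move=> r _; rewrite mulr1.
have := key b c b_bi c_bi bc top; rewrite kE tauC => E.
apply: (mulfI (mulf_neq0 K0 te)); rewrite [RHS]mulrA -E.
by ring.
Qed.

End Convolution.

(** * Ranks of projections *)

Section Rank.
Variables (R : realType) (P : subfactor_planar_algebra R).
Variables (irr : irreducible_pa P) (s : bool).
Notation C := (complex R).
Notation A := (two_box irr s).
Implicit Types (a b x y z w p q u : A).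

Definition left_mul p : A -> A := fun x => p * x.

Fact left_mul_linear p : linear (left_mul p).
Proof. by move=> k x y; rewrite /left_mul mulrDr scalerAr. Qed.

HB.instance Definition _ p :=
  GRing.isLinear.Build C A A *:%R (left_mul p) (left_mul_linear p).

(** The dimension of the right ideal of a projection replaces finiteness of the
  lattices of projections in the arguments by minimality. *)
Definition rank p : nat := \dim (limg (linfun (left_mul p))).

Lemma rank_lt p q : proj p -> proj q -> q * p = p -> p != q -> (rank p < rank q)%N.
Proof.
move=> [pp ps] [qq qs] qp pq; rewrite /rank ltnNge.
have sub : (limg (linfun (left_mul p)) <= limg (linfun (left_mul q)))%VS.
  apply/subvP => _ /memv_imgP[x _ ->]; rewrite lfunE /= /left_mul -qp -mulrA.
  by rewrite -[q * _](lfunE (left_mul q)) memv_img ?memvf.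
apply: contra pq => qp_dim; apply/eqP.
have /eqP E : (limg (linfun (left_mul p)) == limg (linfun (left_mul q)))%VS.
  by rewrite eqEdim sub.
have : q \in limg (linfun (left_mul q)).
  by rewrite -[q in q \in _]mulr1 -[q * _](lfunE (left_mul q)) memv_img ?memvf.
rewrite -E => /memv_imgP[x _]; rewrite lfunE /= /left_mul => qE.
have pqq : p * q = q by rewrite qE mulrA pp.
by rewrite -ps -qp starM ps qs pqq.
Qed.

Lemma minimal_below p : proj p -> p != 0 ->
  exists u, minimal_projection (u : box P (2%N, s)) /\ p * u = u.
Proof.
move: {2}(rank p).+1 (ltnSn (rank p)) => n; elim: n p => // n IHn p pn p_proj p0.
have [[q [q_proj qp q0 qp']]|no] := pselect
    (exists q, [/\ proj q, positive (p - q), q != 0 & q != p]).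
  have pq := proj_le q_proj p_proj qp.
  have [|u [u_min qu]] := IHn q _ q_proj q0.
    by rewrite -ltnS; apply: leq_trans pn; rewrite ltnS; apply: rank_lt.
  by exists u; split=> //; rewrite -qu mulrA pq.
exists p; split; last exact: p_proj.1.
split; [exact: p_proj | exact/eqP |].
move=> q q_proj qp; have [->|q0] := eqVneq (q : A) 0; first by left.
have [->|qp'] := eqVneq (q : A) p; first by right.
by case: no; exists q.
Qed.

End Rank.

(** * The lattice of biprojections *)

Section Lattice.
Variables (R : realType) (P : subfactor_planar_algebra R) (irr : irreducible_pa P).
Notation C := (complex R).
Notation A := (two_box irr false).
Notation B := (two_box irr true).
Implicit Types (a b c d x y p q r u : A).

(** The square of the Fourier transform is the contragredient; it fixes b, since b
  and its transform are self-adjoint. *)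
Lemma four_four b : biproj b -> @four _ _ irr true (four b) = b.
Proof.
move=> b_bi; have [_ [_ bs] _] := b_bi.
have : star (@four _ _ irr true (four b)) = b.
  rewrite [LHS](star_fourier_true (four b : box P (2%N, true))).
  rewrite -[star_box _]/(@star _ _ irr (~~ false) (four b)) (biproj_four_star b_bi).
  exact: fourK.
by move/(congr1 (@star _ _ irr _)); rewrite starbK bs.
Qed.

(** The transform x of b c is the convolution of those of b and c, hence positive;
  as b c is in turn the transform of x, x is a multiple of a projection. *)
Lemma biprojM b c : biproj b -> biproj c -> b * c = c * b -> biproj (b * c).
Proof.
move=> b_bi c_bi bc.
have [_ b_proj _] := b_bi; have [_ c_proj _] := c_bi.
have bc_proj := projM b_proj c_proj bc.
have [e [k e_jones]] := @jones_projection _ _ irr false.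
have bc0 : b * c != 0.
  have [_ e0 _ _ _] := e_jones; apply: contraNneq e0 => bc0.
  rewrite -(biproj_ge_jones e_jones c_bi) -(biproj_ge_jones e_jones b_bi).
  by rewrite -mulrA bc0 mulr0.
pose x : B := @conv _ _ irr true (four b) (four c).
have x_sq : positive x.
  apply/psd_positive/schur_psd; first exact: (biproj_four_positive b_bi).
  exact: (biproj_four_positive c_bi).
have Fx : @four _ _ irr true x = b * c by rewrite four_conv !four_four.
have xE : four (b * c) = x.
  rewrite -[RHS](@unfourK _ _ irr false); congr four.
  have := star_fourier_true (x : box P (2%N, true)).
  rewrite -[star_box (fourier _)]/(star (@four _ _ irr true x)) Fx (proj2 bc_proj) => ->.
  by rewrite -[star_box _]/(star x) (star_positive x_sq).
have x0 : x != 0.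
  rewrite -xE; apply: contraNneq bc0 => F0; apply/eqP.
  exact: (@four_eq0 _ _ irr false (b * c) F0).
split=> //.
rewrite /multiple_of_projection xE.
exact: (@projection_from_transform _ _ irr true x (b * c) 1 x_sq x0 ltr01 bc_proj
  (etrans Fx (esym (scale1r _)))).
Qed.

Hypothesis P_normal : forall b : box P (2%N, false),
  biprojection b -> normal_biprojection b.
Hypothesis P_distributive :
  distributive_lattice (@biprojection R P) (@le_box R P 2 false).

Lemma biprojP b : biprojection (b : box P (2%N, false)) <-> biproj b.
Proof. by split=> -[b0 b_proj Fb]; split=> //; apply/eqP. Qed.

Lemma biproj_central b : biproj b -> forall y, b * y = y * b.
Proof. by move=> /biprojP/P_normal[bc _] y; apply: bc. Qed.

Lemma biproj_four_comm b c : biproj b -> four b * four c = four c * four b.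
Proof. by move=> /biprojP/P_normal[_ bc]; apply: bc. Qed.

Let biproj_proj b : biproj b -> proj b. Proof. by case. Qed.
Let one_bi : biproj (1 : A). Proof. exact: biproj1. Qed.

Lemma le_biproj b c : biproj b -> biproj c ->
  le_box (b : box P (2%N, false)) c <-> c * b = b.
Proof.
move=> /biproj_proj b_proj /biproj_proj c_proj.
by split=> [cb|cb]; [apply: proj_le|apply: le_proj].
Qed.

Lemma biproj_meet b c : biproj b -> biproj c ->
  is_meet (@biprojection R P) (@le_box R P 2 false) b c (b * c : A).
Proof.
move=> b_bi c_bi; have bc := biproj_central b_bi c.
have bc_bi := biprojM b_bi c_bi bc.
have [bb _] := biproj_proj b_bi; have [cc _] := biproj_proj c_bi.
split.
- exact/biprojP.
- by apply/le_biproj => //; rewrite mulrA bb.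
- by apply/le_biproj => //; rewrite bc mulrA cc.
- move=> x /biprojP x_bi /le_biproj xb /le_biproj xc; apply/le_biproj => //.
  by rewrite -mulrA xc // xb.
Qed.

Definition coatom c : Prop :=
  [/\ biproj c, c != 1 & forall d, biproj d -> d * c = c -> d != 1 -> d = c].

Lemma coatom_above b : biproj b -> b != 1 -> exists2 c, coatom c & c * b = b.
Proof.
move: {2}(rank (1%R : A) - rank b)%N.+1 (ltnSn (rank (1%R : A) - rank b)%N) => n.
elim: n b => // n IHn b bn b_bi b1; have b_proj := biproj_proj b_bi.
have [[d [d_bi db d1 d_b]]|no] := pselect
    (exists d, [/\ biproj d, d * b = b, d != 1 & d != b]).
  have d_proj := biproj_proj d_bi.
  have lt_bd : (rank b < rank d)%N by apply: rank_lt; rewrite // eq_sym.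
  have lt_d1 : (rank d < rank (1%R : A))%N.
    by apply: rank_lt => //; rewrite ?mul1r //; exact: (biproj_proj one_bi).
  have [|c c_co cd] := IHn d _ d_bi d1; first by move: bn lt_bd lt_d1; lia.
  by exists c; rewrite // -db mulrA cd.
exists b; last by case: b_proj.
split=> // d d_bi db d1; apply/eqP/negPn/negP => d_b; apply: no; exists d; split=> //.
Qed.

Lemma coatom_join b c : coatom b -> coatom c -> b != c ->
  is_join (@biprojection R P) (@le_box R P 2 false) b c (1 : A).
Proof.
move=> [b_bi b1 b_max] [c_bi c1 c_max] bc; split.
- exact/biprojP/one_bi.
- by apply/le_biproj; rewrite ?mul1r //; exact: one_bi.
- by apply/le_biproj; rewrite ?mul1r //; exact: one_bi.
- move=> x /biprojP x_bi /le_biproj xb /le_biproj xc; apply/le_biproj => //.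
  rewrite mulr1; apply/eqP; apply: contraNT bc => x1.
  by rewrite -(b_max x) ?xb // -(c_max x) ?xc.
Qed.

(** Since m = m (b v c) = m b v m c by distributivity, c lies above m as soon as it
  lies above m b. *)
Lemma coatom_prime b c m : coatom b -> coatom c -> b != c -> biproj m ->
  c * (b * m) = b * m -> c * m = m.
Proof.
move=> b_co c_co bc m_bi cbm.
have [b_bi b1 _] := b_co; have [c_bi c1 _] := c_co.
case: P_distributive => _ _ /(_ m b c).
move/(_ (proj2 (biprojP _) m_bi) (proj2 (biprojP _) b_bi) (proj2 (biprojP _) c_bi)).
move/(_ _ _ _ _ (coatom_join b_co c_co bc) (biproj_meet m_bi one_bi)
  (biproj_meet m_bi b_bi) (biproj_meet m_bi c_bi)).
case=> _ _ _ /(_ c (proj2 (biprojP _) c_bi)) H.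
have mb : m * b = b * m by rewrite (biproj_central m_bi).
have mc : m * c = c * m by rewrite (biproj_central m_bi).
have m1_bi : biproj (m * 1) by rewrite mulr1.
rewrite -[m in LHS]mulr1 -[RHS]mulr1; apply/(le_biproj m1_bi c_bi)/H.
- apply/le_biproj => //; first by apply: biprojM.
  by rewrite mb.
- apply/le_biproj => //; first by apply: biprojM.
  by rewrite mc mulrA; case: (biproj_proj c_bi) => ->.
Qed.

Definition meet_all (cs : seq A) : A := \prod_(c <- cs) c.
Definition avoid_all (cs : seq A) : A := \prod_(c <- cs) (1 - c).

Definition coatoms (cs : seq A) : Prop := forall c, c \in cs -> coatom c.

Lemma coatoms_cons c cs : coatoms (c :: cs) -> coatom c /\ coatoms cs.
Proof.
move=> co; split=> [|d dcs]; first by apply: co; rewrite mem_head.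
by apply: co; rewrite inE dcs orbT.
Qed.

Lemma biproj_meet_all cs : coatoms cs -> biproj (meet_all cs).
Proof.
elim: cs => [|c cs IHcs] co; first by rewrite /meet_all big_nil; exact: one_bi.
have [[c_bi _ _] co'] := coatoms_cons co.
by rewrite /meet_all big_cons; apply: biprojM => //; [exact: IHcs | exact: biproj_central].
Qed.

Lemma meet_all_nle cs c : coatoms cs -> coatom c -> c \notin cs ->
  c * meet_all cs != meet_all cs.
Proof.
elim: cs => [|b cs IHcs] co c_co; first by rewrite /meet_all big_nil mulr1 => _; case: c_co.
rewrite inE negb_or => /andP[cb ccs].
have [b_co co'] := coatoms_cons co.
rewrite /meet_all big_cons; apply: contra (IHcs co' c_co ccs) => /eqP cbm; apply/eqP.
by apply: (coatom_prime b_co c_co) => //; [rewrite eq_sym|apply: biproj_meet_all].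
Qed.

Let t : C := tau (1 : A).
Let t_gt0 : 0 < t. Proof. exact: tau1_gt0. Qed.
Let ntau a : C := tau a / t.
Let ntauB a b : ntau (a - b) = ntau a - ntau b.
Proof. by rewrite /ntau tauB mulrBl. Qed.

(** By primality of coatoms no coatom outside cs lies above the meet of cs, so the
  join of the two is 1 and their traces multiply. *)
Lemma ntau_meet_all cs : uniq cs -> coatoms cs ->
  ntau (meet_all cs) = \prod_(c <- cs) ntau c.
Proof.
elim: cs => [|b cs IHcs] /=.
  by move=> _ _; rewrite /meet_all !big_nil /ntau divff // lt0r_neq0.
case/andP=> bcs /IHcs E co; rewrite big_cons /meet_all big_cons -/(meet_all cs).
have [b_co co'] := coatoms_cons co.
have [b_bi b1 b_max] := b_co; have m_bi := biproj_meet_all co'.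
rewrite -(E co') /ntau; have := tau_mul_biproj b_bi m_bi (biproj_four_comm _ b_bi).
move=> H; have {}H : tau b * tau (meet_all cs) = tau (b * meet_all cs) * t.
  apply: H => r r_bi rb rm; apply/eqP; apply: contraNT (meet_all_nle co' b_co bcs) => r1.
  by rewrite -{1}(b_max r) // rm.
by rewrite mulrACA H; field; rewrite lt0r_neq0.
Qed.

(** The indicators of distinct coatoms are independent for the normalized trace,
  hence so are their complements. *)
Lemma ntau_avoid_all cs ds : uniq (cs ++ ds) -> coatoms (cs ++ ds) ->
  ntau (avoid_all cs * meet_all ds)
  = \prod_(c <- cs) (1 - ntau c) * \prod_(d <- ds) ntau d.
Proof.
elim: cs ds => [|c cs IHcs] ds.
  by move=> /= uds co; rewrite /avoid_all !big_nil !mul1r ntau_meet_all.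
move=> u_cs co; rewrite /avoid_all !big_cons -/(avoid_all cs).
have [[c_bi _ _] co'] := coatoms_cons co.
have pe : perm_eq (cs ++ c :: ds) (c :: cs ++ ds).
  by rewrite perm_catC /= perm_cons perm_catC.
have E1 := IHcs ds; have E2 := IHcs (c :: ds).
have -> : (1 - c) * avoid_all cs * meet_all ds
    = avoid_all cs * meet_all ds - avoid_all cs * meet_all (c :: ds).
  rewrite !mulrBl mul1r; congr (_ - _).
  by rewrite [meet_all (c :: ds)]big_cons mulrA (biproj_central c_bi).
rewrite ntauB E1 // ?E2.
- by rewrite big_cons; ring.
- by rewrite (perm_uniq pe).
- by move=> d; rewrite (perm_mem pe); apply: co.
- by case/andP: u_cs.
Qed.

Lemma avoid_all_proj cs : coatoms cs ->
  proj (avoid_all cs) /\ forall y, avoid_all cs * y = y * avoid_all cs.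
Proof.
elim: cs => [|c cs IHcs] co.
  rewrite /avoid_all big_nil; split; first exact: biproj_proj one_bi.
  by move=> y; rewrite mul1r mulr1.
have [[c_bi _ _] co'] := coatoms_cons co.
have [p_proj p_central] := IHcs co'.
rewrite /avoid_all big_cons -/(avoid_all cs).
have c_central y : (1 - c) * y = y * (1 - c).
  by rewrite mulrBl mulrBr mul1r mulr1 biproj_central.
split; last by move=> y; rewrite -mulrA p_central !mulrA c_central.
by apply: projM => //; apply/projC/biproj_proj.
Qed.

Lemma avoid_all_neq0 cs : uniq cs -> coatoms cs -> avoid_all cs != 0.
Proof.
move=> u_cs co; have := ntau_avoid_all (cs := cs) (ds := [::]).
rewrite cats0 => /(_ u_cs co); rewrite [meet_all _]big_nil big_nil !mulr1 => E.
apply/eqP => p0; move: E; rewrite p0 /ntau tau0 mul0r => /esym/eqP.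
rewrite prodf_seq_eq0 => /hasP[c ccs /=]; rewrite subr_eq0 => /eqP E.
have [c_bi c1 _] := co c ccs.
have : 0 < tau (1 - c).
  by apply: proj_tau_gt0; [apply/projC/biproj_proj|rewrite subr_eq0 eq_sym].
rewrite tauB -/t; have -> : tau c = t; last by rewrite subrr ltxx.
by rewrite -[RHS]mul1r E divfK // lt0r_neq0.
Qed.

Lemma avoid_all_mem cs c : coatoms cs -> c \in cs ->
  c * avoid_all cs = 0.
Proof.
elim: cs => // b cs IHcs co; rewrite inE /avoid_all big_cons -/(avoid_all cs).
have [[b_bi _ _] co'] := coatoms_cons co.
case/predU1P=> [->|ccs].
  by have [bb _] := biproj_proj b_bi; rewrite mulrA mulrBr mulr1 bb subrr mul0r.
have [c_bi _ _] := co' c ccs.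
by rewrite (biproj_central c_bi) -mulrA -(biproj_central c_bi) IHcs // mulr0.
Qed.

(** The complement of the union of all coatoms.  It is reached by a finite list,
  one for which the rank is minimal. *)
Lemma avoid_all_coatoms :
  exists p, [/\ proj p, p != 0 & forall c, coatom c -> c * p = 0].
Proof.
pose good n := `[< exists cs, [/\ uniq cs, coatoms cs & rank (avoid_all cs) = n] >].
have ex_good : exists n, good n.
  by exists (rank (avoid_all [::])); apply/asboolP; exists [::].
case: (ex_minnP ex_good) => n /asboolP[cs [u_cs co <-]] min_n.
have [p_proj p_central] := avoid_all_proj co.
exists (avoid_all cs); split=> //; first exact: avoid_all_neq0.
move=> c c_co; have [c_bi _ _] := c_co.
case: (boolP (c \in cs)) => [ccs|ccs]; first exact: avoid_all_mem.
have co' : coatoms (c :: cs) by move=> d; rewrite inE => /predU1P[->|/co].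
have [p'_proj _] := avoid_all_proj co'.
have p'E : avoid_all (c :: cs) = (1 - c) * avoid_all cs by rewrite /avoid_all big_cons.
apply/eqP; apply: contraT => cp.
suff : (rank (avoid_all (c :: cs)) < rank (avoid_all cs))%N.
  rewrite ltnNge min_n //; apply/asboolP; exists (c :: cs); split=> //.
  by rewrite /= ccs.
apply: rank_lt => //; first by rewrite p'E mulrA p_central -mulrA (proj1 p_proj).
by rewrite p'E mulrBl mul1r -subr_eq0 addrAC subrr add0r oppr_eq0.
Qed.

Lemma generator : exists u : box P (2%N, false),
  minimal_projection u /\ generates u (one_box P 2 false).
Proof.
have [p [p_proj p0 p_avoid]] := avoid_all_coatoms.
have [u [u_min pu]] := minimal_below p_proj p0; exists u; split=> //.
have [u_proj u0 _] := u_min.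
have u_le q : proj q -> q * u = u -> le_box (u : box P (2%N, false)) q.
  by move=> q_proj qu; apply: le_proj.
exists u; split.
- split; [exact: u_proj | by case: u_proj | by move=> q q_proj qu; apply: u_le].
- exact/biprojP.
- by apply: u_le; [exact: biproj_proj|exact: mul1r].
move=> b /biprojP b_bi ub; apply/(le_biproj one_bi b_bi); rewrite mulr1.
apply/eqP/negPn/negP => b1; have [c c_co cb] := coatom_above b_bi b1.
have [c_bi _ _] := c_co.
have bu : (b : A) * u = u by apply: proj_le => //; apply: biproj_proj.
apply: u0; rewrite -[LHS]/(u : A) -bu -cb -mulrA bu -pu.
by rewrite mulrA p_avoid // mul0r.
Qed.

End Lattice.

Local Close Scope ring_scope.

Theorem theorem1p5 (R : realType) (P : subfactor_planar_algebra R)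
    (P_irreducible : irreducible_pa P)
    (P_normal : forall b : box P (2, false), biprojection b -> normal_biprojection b)
    (P_distributive : distributive_lattice (@biprojection R P)
                        (@le_box R P 2 false)) :
  exists u : box P (2, false),
    minimal_projection u /\ generates u (one_box P 2 false).
Proof. exact: (generator P_irreducible P_normal P_distributive). Qed.
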